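(* Assume that there exists a constant $\lambda_0>0$ such that $\mathbb{E}[e^{\lambda_0M_{1,0}}+e^{\lambda_0M_{2,0}}]<\infty$, and that there exists a constant $p>1$ such that $$\mathbb{E}\Big[\frac{Z_{1,1}^p}{m_{1,0}}+\frac{Z_{2,1}^p}{m_{2,0}}\Big]<\infty.$$ Then $$\frac{\mathbb{P}(R_{m,n}\ge x)}{1-\Phi(x)}=1+o(1)$$ uniformly for $x\in[0,o((m\wedge n)^{1/6}))$ as $m\wedge n\to\infty$; that is, for every family $b_{m,n}\ge0$ with $b_{m,n}=o((m\wedge n)^{1/6})$ as $m\wedge n\to\infty$, $$\sup_{0\le x\le b_{m,n}}\bigg|\frac{\mathbb{P}(R_{m,n}\ge x)}{1-\Phi(x)}-1\bigg|\to0\quad\text{as } m\wedge n\to\infty.$$ The same result holds with $\frac{\mathbb{P}(R_{m,n}\ge x)}{1-\Phi(x)}$ replaced by $\frac{\mathbb{P}(R_{m,n}\le -x)}{\Phi(-x)}$.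
   Context: Setting. Write $\mathbb{N}$ for the natural numbers, $m\wedge n=\min\{m,n\}$, $\ln^+x=\max\{\ln x,0\}$, and $\Phi$ for the standard normal distribution function. Let $((\xi_{1,n},\xi_{2,n})^T)_{n\ge0}$ be a sequence of i.i.d. random vectors in $\mathbb{R}^2$ (the environments; for fixed $n$, $\xi_{1,n}$ and $\xi_{2,n}$ may be dependent). For $l=1,2$, each realization of $\xi_{l,n}$ determines a probability law $p(\xi_{l,n})=\{p_k(\xi_{l,n}):k\in\mathbb{N}\}$ on the nonnegative integers. The two branching processes in random environment are $$Z_{l,0}=1,\qquad Z_{l,n+1}=\sum_{i=1}^{Z_{l,n}}X_{l,n,i},\quad n\ge0,\ l=1,2,$$ where, given the environment, the variables $X_{1,n,i},X_{2,n,i}$ ($n\ge 0$, $i\ge1$) are independent, $X_{l,n,i}$ has law $p(\xi_{l,n})$, and those of generation $n$ are independent of $\{Z_{1,k},Z_{2,k}:0\le k\le n\}$. $\mathbb{P}$ and $\mathbb{E}$ denote the annealed (total) probability and expectation. For $l=1,2$ put $$m_{l,n}=\sum_{k=0}^\infty k\,p_k(\xi_{l,n}),\quad M_{l,n}=\ln m_{l,n},\quad \mu_l=\mathbb{E}M_{l,0},\quad \sigma_l^2=\mathrm{Var}(M_{l,0}),\quad \rho=\frac{\mathrm{Cov}(M_{1,0},M_{2,0})}{\sigma_1\sigma_2}.$$ Standing assumptions: $0<\sigma_1,\sigma_2<\infty$; $$\mathbb{E}\Big[\tfrac{Z_{1,1}}{m_{1,0}}\ln^+Z_{1,1}+\tfrac{Z_{2,1}}{m_{2,0}}\ln^+Z_{2,1}\Big]<\infty;$$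 $p_0(\xi_{1,0})=p_0(\xi_{2,0})=0$ a.s.; and either $\rho\in[-1,1)$, or $\rho=1$ and $\sigma_1\ne\sigma_2$. Define for integers $m,n\ge1$ $$V_{m,n,\rho}=\sqrt{\tfrac1n\sigma_1^2+\tfrac1m\sigma_2^2-2\rho\sigma_1\sigma_2\tfrac{m\wedge n}{mn}},\qquad R_{m,n}=\frac{\frac1n\ln Z_{1,n}-\frac1m\ln Z_{2,m}-(\mu_1-\mu_2)}{V_{m,n,\rho}}.$$ *)

(* Defs.v *)
From HB Require Import structures.
From mathcomp Require Import all_boot all_order all_algebra.
From mathcomp Require Import all_classical all_reals all_analysis.

Set Implicit Arguments.
Unset Strict Implicit.
Unset Printing Implicit Defensive.

Import Order.TTheory GRing.Theory Num.Theory.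
Import numFieldNormedType.Exports.

Local Open Scope classical_set_scope.
Local Open Scope ring_scope.

(* The filter "m /\ n --> +oo" on pairs (m, n). *)
Definition minn_infty : set_system (nat * nat) :=
  filter_from setT (fun N => [set mn | (N <= minn mn.1 mn.2)%N]).

Global Instance minn_infty_filter : ProperFilter minn_infty.
Proof.
apply: filter_from_proper; last by move=> N _; exists (N, N) => /=; rewrite minnn.
apply: filter_from_filter; first by exists 0%N.
move=> N N' _ _; exists (maxn N N') => // mn /=.
by rewrite geq_max => /andP[].
Qed.

Canonical minn_infty_filterType := FilterType minn_infty minn_infty_filter.

Section independence.
Context d d' (T : measurableType d) (T' : measurableType d') (R : realType).
Variable P : probability T R.

Definition iid (Y : nat -> {RV P >-> T'}) : Prop :=
  (forall n B, measurable B ->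
     distribution P (Y n) B = distribution P (Y 0%N) B) /\
  (forall (s : seq nat) (B : nat -> set T'), uniq s ->
     (forall n, measurable (B n)) ->
     P (\bigcap_(n in [set` s]) (Y n @^-1` B n)) =
     (\prod_(n <- s) P (Y n @^-1` B n))%E).

(* [f] is a version of the conditional probability P(E | G), for a
   sub-sigma-algebra [G] *)
Definition is_cond_prob (G : set (set T)) (E : set T) (f : T -> R) : Prop :=
  (forall B : set R, measurable B -> G (f @^-1` B)) /\
  (forall A, G A -> P (A `&` E) = (\int[P]_(w in A) (f w)%:E)%E).

Definition g_sigma_process (Y : nat -> {RV P >-> T'}) : set (set T) :=
  <<s \bigcup_n preimage_set_system setT (Y n) measurable >>.

End independence.

Section branching.
Context d (T : measurableType d) (R : realType) (P : probability T R).

(* Throughout, the index l = 1, 2 of the two processes is encoded as a boolean: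
   [false] is l = 1 and [true] is l = 2. *)
Variable xi : nat -> {RV P >-> (R * R)%type}.
Definition env (l : bool) (n : nat) (w : T) : R :=
  if l then (xi n w).2 else (xi n w).1.

(* [p x] is the offspring law attached to the environment value x; as [p] is a
   probability kernel, each p_k is a measurable function of x. *)
Variable p : R.-pker R ~> nat.
Definition offspring_pmf (x : R) (k : nat) : R := fine (p x [set k]).

(* [X l n i] is the number of offspring of the particle of generation n which
   is numbered i in process l, particles being numbered from 0. *)
Variable X : bool -> nat -> nat -> {RV P >-> nat}.

(* Given the whole environment, the X l n i are independent, over all l, n and
   i jointly, and X l n i has law p (env l n). *)
Definition offspring_given_env : Prop :=
  forall (s : seq (bool * nat * nat)) (k : bool * nat * nat -> nat), uniq s ->
  is_cond_prob P (g_sigma_process xi)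
    (\bigcap_(t in [set` s]) (X t.1.1 t.1.2 t.2 @^-1` [set k t]))
    (fun w => \prod_(t <- s) offspring_pmf (env t.1.1 t.1.2 w) (k t)).

Fixpoint Z (l : bool) (n : nat) (w : T) : nat :=
  if n is n'.+1 then (\sum_(i < Z l n' w) X l n' i w)%N else 1%N.

Definition mean_law (x : R) : \bar R :=
  (\sum_(0 <= k <oo) (k%:R * offspring_pmf x k)%:E)%E.

(* [fine] sends +oo to 0, so [m_] and [M_] are meaningful only where the mean of
   the offspring law is finite. *)
Definition m_ (l : bool) (n : nat) (w : T) : R := fine (mean_law (env l n w)).

Definition M_ (l : bool) (n : nat) (w : T) : R := ln (m_ l n w).

Definition mu_ (l : bool) : R := fine 'E_P[M_ l 0].
Definition sigma_ (l : bool) : R := Num.sqrt (fine 'V_P[M_ l 0]).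
Definition rho_ : R :=
  fine (covariance P (M_ false 0) (M_ true 0)) / (sigma_ false * sigma_ true).

Definition V_ (m n : nat) : R :=
  Num.sqrt (n%:R^-1 * sigma_ false ^+ 2 + m%:R^-1 * sigma_ true ^+ 2
    - 2 * rho_ * sigma_ false * sigma_ true * ((minn m n)%:R / (m%:R * n%:R))).

Definition R_ (m n : nat) (w : T) : R :=
  (n%:R^-1 * ln (Z false n w)%:R - m%:R^-1 * ln (Z true m w)%:R
    - (mu_ false - mu_ true)) / V_ m n.

End branching.

Definition lnplus {R : realType} (x : R) : R := Num.max (ln x) 0.

Definition Phi {R : realType} (x : R) : R :=
  fine (normal_prob (0 : R) 1 `]-oo, x]).

(* Main.v *)
Require Import Defs.
From HB Require Import structures.
From mathcomp Require Import all_boot all_order all_algebra.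
From mathcomp Require Import all_classical all_reals all_analysis.
From mathcomp Require Import measurable_realfun.
From mathcomp Require Import ring lra.

Set Implicit Arguments.
Unset Strict Implicit.
Unset Printing Implicit Defensive.

Import Order.TTheory GRing.Theory Num.Theory.
Import numFieldNormedType.Exports.

Local Open Scope classical_set_scope.
Local Open Scope ring_scope.

Import HBNNSimple.

(** Let S_l(n) be the sum of the first n values of M_l, so that
    ln Z_l(n) = S_l(n) + ln W_l(n), where W_l(n) = Z_l(n) exp(- S_l(n)) is the
    normalised population.  Then R_(m,n) = Y + D, where Y collects the centred
    environments and D the two terms ln W_1(n) and ln W_2(m).

    The variable Y is a sum of max(m, n) independent increments, the i-th one
    being a(i) (M_1(i) - mu_1) - b(i) (M_2(i) - mu_2) with a(i) = [i < n] / (n V)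
    and b(i) = [i < m] / (m V), and V is chosen so that its variance is 1.  Because
    of the assumption on rho, N V^2 is bounded below, N = min(m, n)
    ([two_var_lower]); hence every increment is of order N^(-1/2), uniformly in m
    and n, and [comb_sakhanenko] puts it under the hypothesis of a Cramer-type
    theorem ([cramer]): the tail P(Y >= x) equals 1 - Phi x up to a relative
    error th as soon as x^3 is at most a small multiple of th^2 N^(1/2).  That
    theorem is proved by Lindeberg's replacement of one increment at a time, in the
    heat flow started from a tail indicator.  All the errors are measured against
    the weight [wt], an exponential solution of the same heat equation which at the
    final time has the size of the Gaussian density at x; this is what makes
    the error relative instead of absolute.

    The variable D is negligible because ln W_l(n) has exponential tails uniformly
    in n ([log_deviation]).  The upper tail is Markov's inequality for
    E W_l(n) = 1.  For the lower tail, the absence of death makes E (1 / Z_l(n))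
    decay geometrically ([integral_hinv]), so that from generation k on the
    population is large and, by the moment of order p > 1, the law of large numbers
    inside one generation can fail only with a probability that is geometrically
    small in the generation ([prob_fail]).  Without failure ln W_l loses at most a
    convergent series after generation k, and before generation k it loses at most
    S_l(k); k proportional to the deviation t balances the two.  These estimates
    rest on the description of (Z_l(n), Z_l(n+1)) given the environment
    ([markov_env]), obtained from the conditional law of the offspring numbers.

    Finally, shifting x by th / (1 + x) changes 1 - Phi x by a factor 1 + O(th), and
    P(|D| > th / (1 + x)) <= C exp(- c th N^(1/2) / (1 + x)) is much smaller than
    1 - Phi x when x = o(N^(1/6)) ([perturb_ratio], [mean_tail_choice]).  The left
    tail is the right tail of the opposite increments. *)

(** * The normal tail *)

Lemma mvt_der (R : realType) (f df : R -> R) (a b : R) : a <= b ->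
  (forall x : R, a <= x <= b -> is_derive x 1 f (df x)) ->
  exists2 c, a <= c <= b & f b - f a = df c * (b - a).
Proof.
move=> ab fd; have [||c cab fE] := @MVT_segment R f df a b ab.
- by move=> x; rewrite in_itv/= => /andP[/ltW ? /ltW ?]; apply: fd; apply/andP.
- apply: derivable_within_continuous => x; rewrite in_itv/= => xab.
  by have [] := fd x xab.
by exists c => //; move: cab; rewrite in_itv.
Qed.

Lemma mvt_abs (R : realType) (f df : R -> R) (x M : R) :
  f 0 = 0 -> (forall y : R, is_derive y 1 f (df y)) ->
  (forall y, `|y| <= `|x| -> `|df y| <= M) -> `|f x| <= M * `|x|.
Proof.
move=> f0 fd dM; have [x0|x0] := leP 0 x.
  have [c /andP[c0 cx]] := @mvt_der R f df 0 x x0 (fun y _ => fd y).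
  rewrite f0 !subr0 => ->; rewrite normrM ler_wpM2r//.
  by apply: dM; rewrite !ger0_norm.
have [c /andP[c0 cx]] := @mvt_der R f df x 0 (ltW x0) (fun y _ => fd y).
rewrite f0 => e; have -> : f x = df c * x by move: e; lra.
rewrite normrM ler_wpM2r//; apply: dM.
by rewrite !ler0_norm ?lerN2// ltW.
Qed.

Definition phi {R : realType} (u : R) : R := normal_pdf 0 1 u.

Lemma phiE (R : realType) (u : R) : phi u = (Num.sqrt (pi *+ 2))^-1 * expR (- u ^+ 2 / 2).
Proof.
rewrite /phi normal_pdfE ?oner_neq0// /normal_peak /normal_fun !expr1n mul1r subr0.
by rewrite mulr2n.
Qed.

Lemma is_derive_Phi (R : realType) (x : R) : is_derive x 1 (@Phi R) (phi x).
Proof.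
have intp (y : R) : (lebesgue_measure).-integrable [set` Interval -oo%O (BRight y)]
    (EFin \o normal_pdf (0:R) 1).
  by apply: (integrableS measurableT) => //; exact: integrable_normal_pdf.
have [] := @continuous_FTC1 R (normal_pdf 0 1) -oo%O x (x + 1) _ (intp _) _ _.
- by rewrite ltrDl.
- by rewrite ltNyr.
- by apply: continuous_normal_pdf; rewrite oner_neq0.
rewrite derive1E => df fE.
apply: DeriveDef; first exact: df.
exact: fE.
Qed.

Lemma cvg_Phi (R : realType) : Phi x @[x --> +oo] --> (1 : R).
Proof.
have mid : measurable_fun setT (idfun : R -> R) by exact: measurable_id.
pose X : {RV (normal_prob (0:R) 1) >-> R} :=
  HB.pack (idfun : R -> R) (isMeasurableFun.Build _ _ (measurableTypeR R) R _ mid).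
have := @cvg_cdfy1 _ _ _ (normal_prob (0:R) 1) X.
move=> /fine_cvgP[_]; apply: cvg_trans; apply: near_eq_cvg.
by apply: nearW => x /=; rewrite /Phi /cdf /distribution /pushforward /=.
Qed.

Lemma cvg_PhiNy (R : realType) : Phi x @[x --> -oo] --> (0 : R).
Proof.
have mid : measurable_fun setT (idfun : R -> R) by exact: measurable_id.
pose X : {RV (normal_prob (0:R) 1) >-> R} :=
  HB.pack (idfun : R -> R) (isMeasurableFun.Build _ _ (measurableTypeR R) R _ mid).
have := @cvg_cdfNy0 _ _ _ (normal_prob (0:R) 1) X.
move=> /fine_cvgP[_]; apply: cvg_trans; apply: near_eq_cvg.
by apply: nearW => x /=; rewrite /Phi /cdf /distribution /pushforward /=.
Qed.

Lemma Phi_le1 (R : realType) (x : R) : Phi x <= 1.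
Proof.
by rewrite /Phi -lee_fin fineK ?fin_num_measure//; exact: probability_le1.
Qed.

Lemma Phi_ge0 (R : realType) (x : R) : 0 <= Phi x.
Proof. by rewrite /Phi fine_ge0. Qed.

(** By symmetry of the density the sum of the two sides has derivative 0, and it
    tends to 1 at infinity. *)
Lemma PhiN (R : realType) (x : R) : Phi (- x) = 1 - Phi x.
Proof.
have d (y : R) : is_derive y 1 (fun t => Phi t + Phi (- t)) 0.
  have h := @is_derive_Phi R y; have h' := @is_derive_Phi R (- y).
  have e : phi (- y) = phi y by rewrite !phiE sqrrN.
  rewrite e in h'.
  have h2 : is_derive y 1 (fun t : R => Phi (- t)) (phi y * -1).
    by apply: (@is_derive1_comp _ (@Phi R) -%R).
  by apply: is_derive_eq; ring.
pose f (t : R) := Phi t + Phi (- t).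
have fx (b : R) : x <= b -> f b = f x.
  move=> xb; have [c _] := @mvt_der _ f _ x b xb (fun y _ => d y).
  by rewrite mul0r => /eqP; rewrite subr_eq0 => /eqP.
have c1 : f b @[b --> +oo] --> (1 + 0 : R).
  apply: cvgD; first exact: cvg_Phi.
  apply: (@cvg_comp _ _ _ -%R); last exact: cvg_PhiNy.
  by rewrite ninfty.
have c2 : f b @[b --> +oo] --> f x.
  apply: (@cvg_trans _ (cst (f x) @ +oo)); last exact: cvg_cst.
  apply: near_eq_cvg; near=> b; rewrite /= (fx b)//.
have := cvg_unique _ c1 c2; rewrite addr0 /f => ->//.
ring.
Unshelve. all: by end_near. Qed.

Definition Phib {R : realType} (x : R) : R := 1 - Phi x.

Lemma Phib_ge0 (R : realType) (x : R) : 0 <= Phib x.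
Proof. by rewrite subr_ge0 Phi_le1. Qed.

Lemma Phib_le1 (R : realType) (x : R) : Phib x <= 1.
Proof. by rewrite lerBlDr lerDl Phi_ge0. Qed.

Lemma is_derive_Phib (R : realType) (x : R) : is_derive x 1 (@Phib R) (- phi x).
Proof.
have h := @is_derive_Phi R x.
have -> : @Phib R = cst 1 - @Phi R by apply/funext.
by apply: is_derive_eq; rewrite sub0r.
Qed.

(** Rational substitutes for the normalising constant: 2 <= sqrt (2 pi) <= 3. *)
Lemma phi_bounds (R : realType) (u : R) :
  3^-1 * expR (- u ^+ 2 / 2) <= phi u <= 2^-1 * expR (- u ^+ 2 / 2).
Proof.
rewrite phiE; have pi2 : 2 <= pi :> R.
  by have := @pihalf_ge1 R; lra.
have pi4 : pi < 4 :> R by have := @pihalf_lt2 R; lra.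
have s0 : 0 < Num.sqrt (pi *+ 2) :> R by rewrite sqrtr_gt0 mulrn_wgt0// pi_gt0.
have s2 : Num.sqrt (pi *+ 2) ^+ 2 = pi *+ 2 :> R.
  by rewrite sqr_sqrtr// mulrn_wge0// pi_ge0.
apply/andP; split; rewrite ler_wpM2r ?expR_ge0//.
  by rewrite lef_pV2 ?posrE//; nra.
by rewrite lef_pV2 ?posrE//; nra.
Qed.

Lemma phi_ge0 (R : realType) (u : R) : 0 <= phi u.
Proof. exact: normal_pdf_ge0. Qed.

Lemma is_derive_phi (R : realType) (u : R) : is_derive u 1 (@phi R) (- u * phi u).
Proof.
have -> : @phi R = (fun u => (Num.sqrt (pi *+ 2))^-1 * expR (- u ^+ 2 / 2)).
  by apply/funext => t; rewrite phiE.
have h : is_derive u 1 (fun t : R => - t ^+ 2 / 2) (- u).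
  by apply: is_derive_eq; rewrite /GRing.scale/=; field.
have h2 : is_derive u 1 (fun t : R => expR (- t ^+ 2 / 2)) (expR (- u ^+ 2 / 2) * - u).
  by apply: (@is_derive1_comp _ expR (fun t : R => - t ^+ 2 / 2)).
by apply: is_derive_eq; rewrite /GRing.scale/=; ring.
Qed.

Lemma expR_gauss_le1 (R : realType) (a : R) : expR (- a ^+ 2 / 2) <= 1.
Proof. by rewrite -expR0 ler_expR mulNr oppr_le0 divr_ge0// sqr_ge0. Qed.

(** Mills' ratio.  The difference of the two sides tends to 0 at infinity and is
    monotone where -1 <= x; the denominator x + 2 instead of x keeps the bound
    meaningful on the whole half-line that the applications need. *)
Lemma Phib_ge (R : realType) (x : R) : -1 <= x -> phi x / (x + 2) <= Phib x.
Proof.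
move=> x1; pose k (u : R) := Phib u - phi u / (u + 2).
have dk (u : R) : -1 <= u -> is_derive u 1 k (- phi u * (1 - (u + 1) ^+ 2 / (u + 2) ^+ 2)).
  move=> u1; have h := @is_derive_Phib R u; have h2 := @is_derive_phi R u.
  have u2 : u + 2 != 0 by apply: lt0r_neq0; lra.
  have h3 : is_derive u 1 (fun t : R => (t + 2)^-1) (- (u + 2) ^- 2 *: (1 + 0)).
    exact: is_deriveV.
  by apply: is_derive_eq; rewrite /GRing.scale/=; field.
have kb (b : R) : x <= b -> - (b + 2)^-1 <= k x.
  move=> xb; have dk' (y : R) : x <= y <= b ->
      is_derive y 1 k (- phi y * (1 - (y + 1) ^+ 2 / (y + 2) ^+ 2)).
    by move=> /andP[xy _]; apply: dk; apply: le_trans xy.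
  have [c /andP[xc cb] kE] := mvt_der xb dk'.
  have k1 : k b <= k x.
    rewrite -subr_le0 kE mulr_le0_ge0 ?subr_ge0//.
    rewrite mulNr oppr_le0 mulr_ge0 ?phi_ge0// subr_ge0 ler_pdivrMr; last first.
      by apply: exprn_gt0; lra.
    by rewrite mul1r; nra.
  apply: le_trans k1; rewrite /k lerBrDl (@le_trans _ _ 0)//; last exact: Phib_ge0.
  rewrite subr_le0 ler_pdivrMr ?mulVf//; [|apply: lt0r_neq0; lra|lra].
  have /andP[_ +] := phi_bounds b; move=> /le_trans; apply.
  have := expR_gauss_le1 b.
  by lra.
rewrite -subr_ge0 leNgt; apply/negP => kx0.
have kx : k x < 0 by [].
have h : 0 < - k x by lra.
have := kb (Num.max x (- k x)^-1); rewrite le_max lexx => /(_ isT).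
rewrite lerNl; apply/negP; rewrite -ltNge.
rewrite -[ltRHS]invrK ltf_pV2 ?posrE ?invr_gt0//.
  have : (- k x)^-1 <= Num.max x (- k x)^-1 by rewrite le_max lexx orbT.
  by lra.
have : x <= Num.max x (- k x)^-1 by rewrite le_max lexx.
lra.
Qed.

Lemma Phib_gt0 (R : realType) (x : R) : -1 <= x -> 0 < Phib x.
Proof.
move=> x1; apply: lt_le_trans (Phib_ge x1).
apply: divr_gt0; last lra.
have /andP[+ _] := phi_bounds x; apply: lt_le_trans.
by rewrite mulr_gt0 ?expR_gt0// invr_gt0.
Qed.

(** For x >= 1 the function Phib x - exp (- x^2 / 2) increases to its limit 0. *)
Lemma Phib_le (R : realType) (x : R) : 0 <= x -> Phib x <= 2 * expR (- x ^+ 2 / 2).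
Proof.
move=> x0; have [x1|x1] := leP x 1.
  apply: le_trans (Phib_le1 x) _.
  have := @expR_ge1Dx R (- x ^+ 2 / 2); nra.
pose h (u : R) := Phib u - expR (- u ^+ 2 / 2).
have dh (u : R) : is_derive u 1 h (- phi u + u * expR (- u ^+ 2 / 2)).
  have h1 := @is_derive_Phib R u.
  have h0 : is_derive u 1 (fun t : R => - t ^+ 2 / 2) (- u).
    by apply: is_derive_eq; rewrite /GRing.scale/=; field.
  have h2 : is_derive u 1 (fun t : R => expR (- t ^+ 2 / 2)) (expR (- u ^+ 2 / 2) * - u).
    by apply: (@is_derive1_comp _ expR (fun t : R => - t ^+ 2 / 2)).
  by apply: is_derive_eq; ring.
have hb (b : R) : x <= b -> h x <= Phib b.
  move=> xb; have [c /andP[xc cb] hE] := @mvt_der _ h _ x b xb (fun y _ => dh y).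
  have h1 : h x <= h b.
    rewrite -subr_ge0 hE mulr_ge0 ?subr_ge0// addrC subr_ge0.
    have /andP[_ /le_trans] := phi_bounds c; apply.
    by rewrite ler_wpM2r ?expR_ge0//; lra.
  by apply: le_trans h1 _; rewrite /h gerBl expR_ge0.
have : h x <= 0.
  have c1 : Phib b @[b --> +oo] --> (1 - 1 : R).
    by apply: cvgB; [exact: cvg_cst|exact: cvg_Phi].
  rewrite subrr in c1.
  apply: (cvgr_to_ge c1); near=> b; apply: hb.
  by near: b; apply: nbhs_pinfty_ge; rewrite num_real.
rewrite /h subr_le0 => /le_trans; apply.
by have := @expR_ge0 R (- x ^+ 2 / 2); lra.
Unshelve. all: by end_near. Qed.

(** [heat v z] is the probability that a centred normal variable of variance v
    exceeds z: the solution at time v of the heat equation (time derivative equal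
    to half of the second space derivative) started from the indicator of z <= 0.
    [heat1] is the opposite of its space derivative, that is, the derivative in x of
    [heat v (z - x)]; [heat2], [heat3] and [heat4] are the next space derivatives. *)
Definition heat {R : realType} (v z : R) : R := Phib (z / Num.sqrt v).
Definition heat1 {R : realType} (v z : R) : R := phi (z / Num.sqrt v) / Num.sqrt v.
Definition heat2 {R : realType} (v z : R) : R :=
  (z / Num.sqrt v) * phi (z / Num.sqrt v) / v.
Definition heat3 {R : realType} (v z : R) : R :=
  (1 - (z / Num.sqrt v) ^+ 2) * phi (z / Num.sqrt v) / (v * Num.sqrt v).
Definition heat4 {R : realType} (v z : R) : R :=
  ((z / Num.sqrt v) ^+ 3 - 3 * (z / Num.sqrt v)) * phi (z / Num.sqrt v) / (v ^+ 2).

Lemma is_derive_heat (R : realType) (v z x : R) : 0 < v ->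
  is_derive x 1 (fun x => heat v (z - x)) (heat1 v (z - x)).
Proof.
move=> v0; have h0 : is_derive x 1 (fun x : R => (z - x) / Num.sqrt v) (- (Num.sqrt v)^-1).
  by apply: is_derive_eq; rewrite /GRing.scale/=; ring.
have h1 := is_derive_Phib ((z - x) / Num.sqrt v).
have h2 := @is_derive1_comp _ Phib (fun x : R => (z - x) / Num.sqrt v) _ _ _ h1 h0.
by apply: is_derive_eq; rewrite /heat1; ring.
Qed.

Lemma is_derive_heat1 (R : realType) (v z x : R) : 0 < v ->
  is_derive x 1 (fun x => heat1 v (z - x)) (heat2 v (z - x)).
Proof.
move=> v0; have h0 : is_derive x 1 (fun x : R => (z - x) / Num.sqrt v) (- (Num.sqrt v)^-1).
  by apply: is_derive_eq; rewrite /GRing.scale/=; ring.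
have h1 := is_derive_phi ((z - x) / Num.sqrt v).
have h2 := @is_derive1_comp _ phi (fun x : R => (z - x) / Num.sqrt v) _ _ _ h1 h0.
apply: is_derive_eq; rewrite /heat2 /GRing.scale/=.
have s0 : Num.sqrt v != 0 by rewrite gt_eqF// sqrtr_gt0.
move: (sqr_sqrtr (ltW v0)) s0; set s := Num.sqrt v => <- s0.
by field; rewrite ?s0.
Qed.

Lemma is_derive_heat2 (R : realType) (v z x : R) : 0 < v ->
  is_derive x 1 (fun x => heat2 v (z - x)) (- heat3 v (z - x)).
Proof.
move=> v0; have h0 : is_derive x 1 (fun x : R => (z - x) / Num.sqrt v) (- (Num.sqrt v)^-1).
  by apply: is_derive_eq; rewrite /GRing.scale/=; ring.
have h1 := is_derive_phi ((z - x) / Num.sqrt v).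
have h2 := @is_derive1_comp _ phi (fun x : R => (z - x) / Num.sqrt v) _ _ _ h1 h0.
apply: is_derive_eq; rewrite /heat3 /GRing.scale/=.
have s0 : Num.sqrt v != 0 by rewrite gt_eqF// sqrtr_gt0.
have v0' : v != 0 by rewrite gt_eqF.
by field; rewrite ?s0 ?v0'.
Qed.

Lemma is_derive_div_sqrt (R : realType) (z v : R) : 0 < v ->
  is_derive v 1 (fun v => z / Num.sqrt v) (- (z / Num.sqrt v) / (2 * v)).
Proof.
move=> v0; have h := is_derive1_sqrt v0.
have s0 : Num.sqrt v != 0 by rewrite gt_eqF// sqrtr_gt0.
have h1 := @is_deriveV _ (@Num.sqrt R) v _ 1 s0 h.
apply: is_derive_eq; rewrite /GRing.scale/=.
move: (sqr_sqrtr (ltW v0)) s0; set s := Num.sqrt v => <- s0.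
by field; rewrite ?s0.
Qed.

(** The heat equation; it is what makes a normal step of variance t and a lapse of
    time t have the same effect. *)
Lemma is_derive_heat_time (R : realType) (z v : R) : 0 < v ->
  is_derive v 1 (fun v => heat v z) (heat2 v z / 2).
Proof.
move=> v0; have h0 := is_derive_div_sqrt z v0.
have h1 := is_derive_Phib (z / Num.sqrt v).
have h2 := @is_derive1_comp _ Phib (fun v : R => z / Num.sqrt v) _ _ _ h1 h0.
apply: is_derive_eq; rewrite /heat2.
have v0' : v != 0 by rewrite gt_eqF.
have s0 : Num.sqrt v != 0 by rewrite gt_eqF// sqrtr_gt0.
by field; rewrite ?s0 ?v0'.
Qed.

Lemma is_derive_heat2_time (R : realType) (z v : R) : 0 < v ->
  is_derive v 1 (fun v => heat2 v z) (heat4 v z / 2).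
Proof.
move=> v0; have h0 := is_derive_div_sqrt z v0.
have h1 := is_derive_phi (z / Num.sqrt v).
have h2 := @is_derive1_comp _ phi (fun v : R => z / Num.sqrt v) _ _ _ h1 h0.
have v0' : v != 0 by rewrite gt_eqF.
have h3 : is_derive v 1 (fun v : R => v^-1) (- v ^- 2 *: 1).
  exact: is_deriveV.
have s0 : Num.sqrt v != 0 by rewrite gt_eqF// sqrtr_gt0.
apply: is_derive_eq; rewrite /heat4 /GRing.scale/=.
by field; rewrite ?s0 ?v0'.
Qed.

Lemma expR_sqr_half (R : realType) (a : R) : a ^+ 2 * expR (- a ^+ 2 / 2) <= 2.
Proof.
have := @expR_ge1Dx R (a ^+ 2 / 2).
have := @expRxMexpNx_1 R (a ^+ 2 / 2).
rewrite mulNr; have := @expR_ge0 R (- (a ^+ 2 / 2)); nra.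
Qed.

Lemma expR_cube_half (R : realType) (a : R) : `|a| ^+ 3 * expR (- a ^+ 2 / 2) <= 9.
Proof.
have -> : `|a| ^+ 3 = a ^+ 2 * `|a| by rewrite exprSr -normrX ger0_norm ?sqr_ge0.
have h := @expR_sqr_half _ (a / Num.sqrt 2).
have h2 := @expR_sqr_half _ a.
have e : (a / Num.sqrt 2) ^+ 2 = a ^+ 2 / 2 by rewrite exprMn exprVn sqr_sqrtr.
rewrite e in h.
have e2 : expR (- a ^+ 2 / 2) = expR (- (a ^+ 2 / 2) / 2) ^+ 2.
  by rewrite -expRM_natl; congr expR; field.
have e3 := @expR_ge0 R (- (a ^+ 2 / 2) / 2).
have h4 : a ^+ 4 * expR (- a ^+ 2 / 2) <= 16.
  have -> : a ^+ 4 * expR (- a ^+ 2 / 2) =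
     (2 * (a ^+ 2 / 2 * expR (- (a ^+ 2 / 2) / 2))) ^+ 2 by rewrite e2; field.
  have : 0 <= a ^+ 2 / 2 * expR (- (a ^+ 2 / 2) / 2).
    by rewrite mulr_ge0// divr_ge0// sqr_ge0.
  by nra.
have e0 := @expR_ge0 R (- a ^+ 2 / 2).
apply: (@le_trans _ _ ((a ^+ 2 + a ^+ 4) / 2 * expR (- a ^+ 2 / 2))); last lra.
rewrite ler_wpM2r//.
have : a ^+ 2 = `|a| ^+ 2 by rewrite -normrX ger0_norm ?sqr_ge0.
have -> : a ^+ 4 = (a ^+ 2) ^+ 2 by rewrite -exprM.
move=> ->; have := sqr_ge0 (`|a| * (`|a| - 1)); nra.
Qed.

(** The exponential solution exp (l^2 v / 2 - l z) of the heat equation, used as a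
    weight: it dominates the Gaussian profile for every l, and convolution with an
    increment only multiplies it by a Laplace transform ([wtB]). *)
Definition wt {R : realType} (l v z : R) : R := expR (l ^+ 2 * v / 2 - l * z).

(** Completing the square: the Gaussian at z is the weight times the Gaussian
    centred at l v. *)
Lemma expR_wt (R : realType) (l v z : R) : 0 < v ->
  expR (- (z / Num.sqrt v) ^+ 2 / 2) =
  wt l v z * expR (- (z / Num.sqrt v - l * Num.sqrt v) ^+ 2 / 2).
Proof.
move=> v0; rewrite /wt -expRD; congr expR.
have s0 : Num.sqrt v != 0 by rewrite gt_eqF// sqrtr_gt0.
rewrite -[X in l ^+ 2 * X](sqr_sqrtr (ltW v0)); field.
by rewrite ?s0.
Qed.

(** After [expR_wt] only a polynomial in a centred Gaussian variable is left, and
    the shift l sqrt v of that variable accounts for the factor in l. *)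
Lemma heat3_bound (R : realType) (l v z : R) : 0 < v -> 0 <= l ->
  `|heat3 v z| <= 3 * (1 + l ^+ 2 * v) / (v * Num.sqrt v) * wt l v z.
Proof.
move=> v0 l0; set u := z / Num.sqrt v; have s0 : 0 < Num.sqrt v by rewrite sqrtr_gt0.
have vs0 : 0 < v * Num.sqrt v by rewrite mulr_gt0.
rewrite /heat3 -/u normrM normfV (gtr0_norm vs0) [leRHS]mulrAC.
apply: ler_wpM2r; first by rewrite invr_ge0 ltW.
rewrite normrM (ger0_norm (phi_ge0 _)).
have /andP[_ pu] := phi_bounds u.
apply: le_trans (ler_wpM2l (normr_ge0 _) pu) _.
rewrite /u (expR_wt l z v0) -/u; set a := u - l * Num.sqrt v.
have w0 : 0 <= wt l v z by exact: expR_ge0.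
rewrite [leLHS](_ : _ = (`|1 - u ^+ 2| * expR (- a ^+ 2 / 2) / 2) * wt l v z); last by field.
rewrite ler_wpM2r//.
have e0 := expR_ge0 (- a ^+ 2 / 2); have ea := expR_sqr_half a.
have e1 := expR_gauss_le1 a.
have : `|1 - u ^+ 2| <= 1 + 2 * a ^+ 2 + 2 * (l ^+ 2 * v).
  have -> : u = a + l * Num.sqrt v by rewrite /a; ring.
  have := sqr_sqrtr (ltW v0); set s := Num.sqrt v => sv.
  rewrite -sv ler_norml; have := sqr_ge0 (a - l * s); have := sqr_ge0 (a + l * s).
  by move=> ? ?; apply/andP; split; nra.
have lv : 0 <= l ^+ 2 * v by rewrite mulr_ge0 ?sqr_ge0// ltW.
move=> h; have := ler_wpM2r e0 h; nra.
Qed.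

Lemma heat4_bound (R : realType) (l v z : R) : 0 < v -> 0 <= l ->
  `|heat4 v z| <= 80 * (1 + l ^+ 3 * (v * Num.sqrt v)) / v ^+ 2 * wt l v z.
Proof.
move=> v0 l0; set u := z / Num.sqrt v; have s0 : 0 < Num.sqrt v by rewrite sqrtr_gt0.
have vs0 : 0 < v ^+ 2 by rewrite exprn_gt0.
rewrite /heat4 -/u normrM normfV (gtr0_norm vs0) [leRHS]mulrAC.
apply: ler_wpM2r; first by rewrite invr_ge0 ltW.
rewrite normrM (ger0_norm (phi_ge0 _)).
have /andP[_ pu] := phi_bounds u.
apply: le_trans (ler_wpM2l (normr_ge0 _) pu) _.
rewrite /u (expR_wt l z v0) -/u; set a := u - l * Num.sqrt v.
have w0 : 0 <= wt l v z by exact: expR_ge0.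
rewrite [leLHS](_ : _ = (`|u ^+ 3 - 3 * u| * expR (- a ^+ 2 / 2) / 2) * wt l v z); last by field.
rewrite ler_wpM2r//.
have e0 := expR_ge0 (- a ^+ 2 / 2); have ea := expR_cube_half a.
have e1 := expR_gauss_le1 a.
have -> : l ^+ 3 * (v * Num.sqrt v) = (l * Num.sqrt v) ^+ 3.
  by rewrite -{1}(sqr_sqrtr (ltW v0)); ring.
set b := l * Num.sqrt v; have b0 : 0 <= b by rewrite mulr_ge0// ltW.
have : `|u ^+ 3 - 3 * u| <= 16 * `|a| ^+ 3 + 16 * b ^+ 3 + 3.
  have ub : `|u| <= `|a| + b.
    have -> : u = a + b by rewrite /a /b; ring.
    by rewrite (le_trans (ler_normD _ _))// (ger0_norm b0).
  have := ler_normB (u ^+ 3) (3 * u).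
  have -> : `|3 * u| = 3 * `|u| by rewrite normrM normr_nat.
  rewrite normrX => /le_trans; apply.
  have t3 : 3 * `|u| <= 3 + 3 * `|u| ^+ 3.
    have c0 := normr_ge0 u; have [c1|c1] := leP `|u| 1.
      by have := exprn_ge0 3 c0; lra.
    have : 0 <= `|u| * (`|u| - 1) * (`|u| + 1) by rewrite !mulr_ge0//; lra.
    by nra.
  have : `|u| ^+ 3 <= (`|a| + b) ^+ 3 by rewrite lerXn2r ?nnegrE ?addr_ge0.
  have : (`|a| + b) ^+ 3 <= 4 * (`|a| ^+ 3 + b ^+ 3).
    have := normr_ge0 a; move: (`|a|) => c c0.
    have : 0 <= (c + b) * (c - b) ^+ 2 by rewrite mulr_ge0 ?sqr_ge0// addr_ge0.
    nra.
  by lra.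
have b3 : 0 <= b ^+ 3 by rewrite exprn_ge0.
move=> h; have := ler_wpM2r e0 h; nra.
Qed.

Lemma wtB (R : realType) (l v z y : R) : wt l v (z - y) = wt l v z * expR (l * y).
Proof. by rewrite /wt -expRD; congr expR; ring. Qed.

Lemma expR_taylor3 (R : realType) (x : R) :
  `|expR x - 1 - x - x ^+ 2 / 2| <= `|x| ^+ 3 * expR `|x|.
Proof.
have e1 (y : R) : is_derive y 1 (fun t : R => expR t - 1) (expR y).
  by apply: is_derive_eq; rewrite subr0.
have e2 (y : R) : is_derive y 1 (fun t : R => expR t - 1 - t) (expR y - 1).
  by apply: is_derive_eq; ring.
have e3 (y : R) : is_derive y 1 (fun t : R => expR t - 1 - t - t ^+ 2 / 2) (expR y - 1 - y).
  by apply: is_derive_eq; rewrite /GRing.scale/=; field.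
have b0 (y : R) : `|y| <= `|x| -> `|expR y| <= expR `|x|.
  by move=> yx; rewrite ger0_norm ?expR_ge0// ler_expR (le_trans (ler_norm _)).
have b1 (y : R) : `|y| <= `|x| -> `|expR y - 1| <= expR `|x| * `|x|.
  move=> yx; apply: (@le_trans _ _ (expR `|x| * `|y|)).
    apply: (mvt_abs _ e1); first by rewrite expR0 subrr.
    by move=> t ty; apply: b0; apply: le_trans yx.
  by rewrite ler_wpM2l ?expR_ge0.
have b2 (y : R) : `|y| <= `|x| -> `|expR y - 1 - y| <= expR `|x| * `|x| * `|x|.
  move=> yx; apply: (@le_trans _ _ (expR `|x| * `|x| * `|y|)).
    apply: (mvt_abs _ e2); first by rewrite expR0 subrr subr0.
    by move=> t ty; apply: b1; apply: le_trans yx.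
  by rewrite ler_wpM2l ?mulr_ge0 ?expR_ge0.
rewrite [leRHS](_ : _ = expR `|x| * `|x| * `|x| * `|x|); last by ring.
apply: (mvt_abs _ e3); last exact: b2.
by rewrite expR0; ring.
Qed.

(** Third order expansion in space, integrating [heat3_bound] three times.  The
    weight at z - x costs exp (l |x|), which the exponential moment of an increment
    absorbs. *)
Lemma heat_taylor (R : realType) (l v z x : R) : 0 < v -> 0 <= l ->
  `|heat v (z - x) - heat v z - x * heat1 v z - x ^+ 2 / 2 * heat2 v z| <=
  3 * (1 + l ^+ 2 * v) / (v * Num.sqrt v) * wt l v z * (`|x| ^+ 3 * expR (l * `|x|)).
Proof.
move=> v0 l0; set M := 3 * _ / _ * _.
have M0 : 0 <= M.
  rewrite /M mulr_ge0 ?expR_ge0// divr_ge0 ?mulr_ge0 ?sqrtr_ge0 ?addr_ge0 ?mulr_ge0 ?sqr_ge0// ltW//.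
have d0 (y : R) := is_derive_heat z y v0.
have d1 (y : R) := is_derive_heat1 z y v0.
have d2 (y : R) := is_derive_heat2 z y v0.
have e1 (y : R) : is_derive y 1 (fun t : R => heat2 v (z - t) - heat2 v z) (- heat3 v (z - y)).
  by apply: is_derive_eq; rewrite subr0.
have e2 (y : R) : is_derive y 1 (fun t : R => heat1 v (z - t) - heat1 v z - t * heat2 v z)
    (heat2 v (z - y) - heat2 v z).
  by apply: is_derive_eq; rewrite /GRing.scale/=; ring.
have e3 (y : R) : is_derive y 1
    (fun t : R => heat v (z - t) - heat v z - t * heat1 v z - t ^+ 2 / 2 * heat2 v z)
    (heat1 v (z - y) - heat1 v z - y * heat2 v z).
  by apply: is_derive_eq; rewrite /GRing.scale/=; field.
set N := M * expR (l * `|x|).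
have N0 : 0 <= N by rewrite mulr_ge0 ?expR_ge0.
have b0 (y : R) : `|y| <= `|x| -> `|- heat3 v (z - y)| <= N.
  move=> yx; rewrite normrN; apply: le_trans (heat3_bound (z - y) v0 l0) _.
  rewrite wtB mulrA /N /M ler_wpM2l// ler_expR ler_wpM2l//.
  by rewrite (le_trans (ler_norm _)).
have b1 (y : R) : `|y| <= `|x| -> `|heat2 v (z - y) - heat2 v z| <= N * `|x|.
  move=> yx; apply: (@le_trans _ _ (N * `|y|)); last by rewrite ler_wpM2l.
  apply: (mvt_abs _ e1); first by rewrite subr0 subrr.
  by move=> t ty; apply: b0; apply: le_trans yx.
have b2 (y : R) : `|y| <= `|x| -> `|heat1 v (z - y) - heat1 v z - y * heat2 v z| <= N * `|x| * `|x|.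
  move=> yx; apply: (@le_trans _ _ (N * `|x| * `|y|)); last first.
    by apply: ler_wpM2l => //; rewrite mulr_ge0.
  apply: (mvt_abs _ e2); first by rewrite subr0; ring.
  by move=> t ty; apply: b1; apply: le_trans yx.
rewrite [leRHS](_ : _ = N * `|x| * `|x| * `|x|); last by rewrite /N; ring.
apply: (mvt_abs _ e3); last exact: b2.
by rewrite subr0; ring.
Qed.

(** Expansion in time, whose first order term is the second order term of
    [heat_taylor] for an increment of variance t. *)
Lemma heat_taylor_time (R : realType) (l v z t : R) : 0 < v -> 0 <= l -> 0 <= t <= v ->
  l ^+ 2 * t <= 1 ->
  `|heat (v + t) z - heat v z - t / 2 * heat2 v z| <=
  40 * t ^+ 2 * (1 + 4 * l ^+ 3 * (v * Num.sqrt v)) / v ^+ 2 * wt l v z.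
Proof.
move=> v0 l0 /andP[t0 tv] lt1.
have [||c /andP[vc ct] cE] := @mvt_der R (fun v => heat v z) (fun v => heat2 v z / 2) v (v + t).
- by rewrite lerDl.
- by move=> y /andP[vy _]; apply: is_derive_heat_time; apply: lt_le_trans vy.
have [//||b /andP[vb bc] bE] := @mvt_der R (fun v => heat2 v z) (fun v => heat4 v z / 2) v c.
- by move=> y /andP[vy _]; apply: is_derive_heat2_time; apply: lt_le_trans vy.
have b0 : 0 < b by apply: lt_le_trans vb.
have b2v : b <= v + t by apply: le_trans ct.
rewrite cE (_ : _ - _ = (heat4 b z) * ((c - v) * t / 4)); last first.
  have -> : heat2 c z = heat2 v z + heat4 b z / 2 * (c - v) by rewrite -bE; ring.
  by field.
have sb : Num.sqrt b <= 2 * Num.sqrt v.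
  have -> : 2 = Num.sqrt (2 ^+ 2) :> R by rewrite sqrtr_sqr ger0_norm.
  by rewrite -sqrtrM ?sqr_ge0// ler_wsqrtr//; lra.
have sv0 : 0 < Num.sqrt v by rewrite sqrtr_gt0.
have wb : wt l b z <= 2 * wt l v z.
  have -> : wt l b z = expR (l ^+ 2 * (b - v) / 2) * wt l v z.
    by rewrite /wt -expRD; congr expR; field.
  rewrite ler_wpM2r ?expR_ge0//.
  have : l ^+ 2 * (b - v) / 2 <= 2^-1.
    have : l ^+ 2 * (b - v) <= l ^+ 2 * t by rewrite ler_wpM2l ?sqr_ge0//; lra.
    by lra.
  rewrite -ler_expR => /le_trans; apply.
  have : expR (2^-1) * expR (- 2^-1) = 1 :> R by rewrite expRN divff// expR_eq0.
  have := @expR_ge1Dx R (- 2^-1); have := @expR_gt0 R (2^-1); nra.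
have w0 : 0 <= wt l v z := expR_ge0 _.
have hb : `|heat4 b z| <= 80 * (1 + 4 * l ^+ 3 * (v * Num.sqrt v)) / v ^+ 2 * (2 * wt l v z).
  apply: le_trans (heat4_bound z b0 l0) _.
  apply: ler_pM; rewrite ?expR_ge0//.
    by rewrite divr_ge0 ?sqr_ge0// mulr_ge0// addr_ge0// !mulr_ge0 ?exprn_ge0 ?sqrtr_ge0// ltW.
  apply: ler_pM.
  - by rewrite mulr_ge0// addr_ge0// !mulr_ge0 ?exprn_ge0 ?sqrtr_ge0// ltW.
  - by rewrite invr_ge0 sqr_ge0.
  - rewrite ler_wpM2l// lerD2l.
    have bb : b * Num.sqrt b <= (2 * v) * (2 * Num.sqrt v).
      by apply: ler_pM => //; [exact: ltW|lra].
    by have := ler_wpM2l (exprn_ge0 3 l0) bb; lra.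
  - rewrite lef_pV2 ?posrE ?exprn_gt0//.
    by apply: lerXn2r => //; rewrite nnegrE ltW.
have ct0 : 0 <= (c - v) * t / 4 by rewrite divr_ge0// mulr_ge0// subr_ge0.
rewrite normrM (ger0_norm ct0).
have ct1 : (c - v) * t / 4 <= t ^+ 2 / 4 by rewrite ler_wpM2r// expr2 ler_wpM2r// lerBlDl.
apply: le_trans (ler_pM (normr_ge0 _) ct0 hb ct1) _.
by rewrite le_eqVlt; apply/orP; left; apply/eqP; field; rewrite gt_eqF.
Qed.

Lemma integrable_le d (T : measurableType d) (R : realType) (P : probability T R)
  (f g : T -> R) : measurable_fun setT f -> (forall w, `|f w| <= g w) ->
  P.-integrable setT (EFin \o g) -> P.-integrable setT (EFin \o f).
Proof.
move=> mf fg ig; apply: le_integrable ig => //; first exact/measurable_EFinP.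
by move=> w _ /=; rewrite lee_fin (le_trans (fg w))// ler_norm.
Qed.

Lemma integrable_fin_cst d (T : measurableType d) (R : realType) (P : probability T R)
  (c : R) : P.-integrable setT (EFin \o (fun=> c)).
Proof. by apply: finite_measure_integrable_cst. Qed.

Lemma intD d (T : measurableType d) (R : realType) (P : probability T R)
  (f g : T -> R) : P.-integrable setT (EFin \o f) -> P.-integrable setT (EFin \o g) ->
  P.-integrable setT (EFin \o (fun w => f w + g w)).
Proof. by move=> fi gi; exact: (integrableD measurableT fi gi). Qed.

Lemma intB d (T : measurableType d) (R : realType) (P : probability T R)
  (f g : T -> R) : P.-integrable setT (EFin \o f) -> P.-integrable setT (EFin \o g) ->
  P.-integrable setT (EFin \o (fun w => f w - g w)).
Proof. by move=> fi gi; exact: (integrableB measurableT fi gi). Qed.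

Lemma intZl d (T : measurableType d) (R : realType) (P : probability T R)
  (c : R) (f : T -> R) : P.-integrable setT (EFin \o f) ->
  P.-integrable setT (EFin \o (fun w => c * f w)).
Proof. by move=> fi; exact: (integrableZl measurableT c fi). Qed.

Lemma intZr d (T : measurableType d) (R : realType) (P : probability T R)
  (c : R) (f : T -> R) : P.-integrable setT (EFin \o f) ->
  P.-integrable setT (EFin \o (fun w => f w * c)).
Proof. by move=> fi; exact: (integrableZr measurableT c fi). Qed.

Lemma Rintegral_le_abs d (T : measurableType d) (R : realType) (P : probability T R)
  (f g : T -> R) : measurable_fun setT f -> P.-integrable setT (EFin \o g) ->
  (forall w, `|f w| <= g w) -> `|\int[P]_w f w| <= \int[P]_w g w.
Proof.
move=> mf ig fg; have if' := integrable_le mf fg ig.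
apply: le_trans (le_normr_Rintegral _ if') _ => //.
by apply: le_Rintegral => //; exact: (integrable_norm if').
Qed.

Lemma Rintegral1 d (T : measurableType d) (R : realType) (P : probability T R) (c : R) :
  \int[P]_(w in setT) c = c.
Proof. by rewrite Rintegral_cst//= probability_setT mulr1. Qed.

(** * A Cramer-type theorem by the Lindeberg method *)

Definition mkRV d d' (T : measurableType d) (T' : measurableType d') (R : realType)
  (P : probability T R) (X : T -> T') (mX : measurable_fun setT X) : {RV P >-> T'} :=
  HB.pack X (isMeasurableFun.Build _ _ _ _ X mX).

(** The product rule says that the joint law of X and Y is the product of their laws;
    the formula is then Tonelli's theorem. *)
Lemma freeze d d1 d2 (T : measurableType d) (T1 : measurableType d1)
  (T2 : measurableType d2) (R : realType) (P : probability T R)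
  (X : T -> T1) (Y : T -> T2) :
  measurable_fun setT X -> measurable_fun setT Y ->
  (forall A B, measurable A -> measurable B ->
    P (X @^-1` A `&` Y @^-1` B) = (P (X @^-1` A) * P (Y @^-1` B))%E) ->
  forall f : T1 * T2 -> \bar R, measurable_fun setT f -> (forall z, (0 <= f z)%E) ->
  (\int[P]_w f (X w, Y w) = \int[P]_w \int[P]_w' f (X w, Y w'))%E.
Proof.
move=> mX mY ind f mf f0.
pose X' := mkRV P mX; pose Y' := mkRV P mY.
have mXY : measurable_fun setT (fun w => (X w, Y w)) by exact: measurable_fun_pair.
pose XY := mkRV P mXY.
have E : forall A, measurable A ->
    (distribution P X' \x distribution P Y')%E A = distribution P XY A.
  by apply: product_measure_unique => A B mA mB; rewrite /distribution /pushforward/= -ind.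
transitivity (\int[distribution P XY]_z f z)%E.
  by rewrite ge0_integral_distribution.
transitivity (\int[distribution P X' \x distribution P Y']_z f z)%E.
  by apply: eq_measure_integral => A mA _; exact/esym/E.
rewrite fubini_tonelli1// ge0_integral_distribution//.
- by apply: eq_integral => w _ /=; rewrite /fubini_F ge0_integral_distribution//; exact: measurableT_comp.
- exact: measurable_fun_fubini_tonelli_F.
- by move=> y; apply: integral_ge0 => *; exact: f0.
Qed.

Lemma freezeR d d1 d2 (T : measurableType d) (T1 : measurableType d1)
  (T2 : measurableType d2) (R : realType) (P : probability T R)
  (X : T -> T1) (Y : T -> T2) :
  measurable_fun setT X -> measurable_fun setT Y ->
  (forall A B, measurable A -> measurable B ->
    P (X @^-1` A `&` Y @^-1` B) = (P (X @^-1` A) * P (Y @^-1` B))%E) ->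
  forall f : T1 * T2 -> R, measurable_fun setT f -> (forall z, 0 <= f z) ->
  (forall x, P.-integrable setT (fun w => (f (x, Y w))%:E)) ->
  \int[P]_w f (X w, Y w) = \int[P]_w \int[P]_w' f (X w, Y w').
Proof.
move=> mX mY ind f mf f0 fi; rewrite /Rintegral.
have := freeze mX mY ind (f := EFin \o f); rewrite /= => ->.
- by congr fine; apply: eq_integral => w _; rewrite /= fineK// integrable_fin_num.
- exact/measurable_EFinP.
- by move=> z; rewrite lee_fin.
Qed.

(** Sakhanenko's condition with scale G for a centred variable of variance s2: the
    third absolute moment, even with an exponential weight at scale G, is at most G
    times the variance. *)
Definition sakhanenko d (T : measurableType d) (R : realType) (P : probability T R)
    (G : R) (X : T -> R) (s2 : R) : Prop :=
  [/\ measurable_fun setT X,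
      P.-integrable setT (EFin \o (fun w => `|X w| ^+ 3 * expR (`|X w| / G))),
      \int[P]_w X w = 0, \int[P]_w (X w ^+ 2) = s2 &
      \int[P]_w (`|X w| ^+ 3 * expR (`|X w| / G)) <= G * s2].

Definition step_const {R : realType} : R := 30 * 40.

Lemma step_const_ge1 (R : realType) : 1 <= step_const :> R.
Proof. by rewrite /step_const; lra. Qed.

Lemma step_const_ge0 (R : realType) : 0 <= step_const :> R.
Proof. exact: le_trans (@step_const_ge1 R). Qed.

Section onestep.
Context d (T : measurableType d) (R : realType) (P : probability T R).
Variables (G : R) (X : T -> R) (s2 : R).
Hypothesis G0 : 0 < G.
Hypothesis sX : sakhanenko P G X s2.

Let mX : measurable_fun setT X. Proof. by case: sX. Qed.

Let e1 (x : R) : 1 <= expR (`|x| / G).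
Proof. by rewrite -expR0 ler_expR divr_ge0// ltW. Qed.

Let m3 : measurable_fun setT (fun w => `|X w| ^+ 3).
Proof. by apply: measurable_funX; exact: measurableT_comp. Qed.

Let i3 : P.-integrable setT (EFin \o (fun w => `|X w| ^+ 3)).
Proof.
have [_ h _ _ _] := sX; apply: integrable_le h => // w.
by rewrite ger0_norm ?exprn_ge0// ler_peMr ?exprn_ge0.
Qed.

Let idom : P.-integrable setT (EFin \o (fun w => 1 + `|X w| ^+ 3)).
Proof. exact: (intD (integrable_fin_cst P 1) i3). Qed.

Lemma sakh_integrable1 : P.-integrable setT (EFin \o X).
Proof.
apply: integrable_le idom => // w; have c0 := normr_ge0 (X w).
have [c1|c1] := leP `|X w| 1; first by have := exprn_ge0 3 c0; lra.
have : 0 <= `|X w| * (`|X w| - 1) * (`|X w| + 1) by rewrite !mulr_ge0//; lra.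
nra.
Qed.

Lemma sakh_integrable2 : P.-integrable setT (EFin \o (fun w => X w ^+ 2)).
Proof.
apply: integrable_le idom; first exact: measurable_funX.
move=> w; have c0 := normr_ge0 (X w); rewrite normrX.
have [c1|c1] := leP `|X w| 1; first by have := exprn_ge0 3 c0; nra.
have : 0 <= `|X w| ^+ 2 * (`|X w| - 1) by rewrite !mulr_ge0 ?sqr_ge0//; lra.
nra.
Qed.

Lemma sakh_ge0 : 0 <= s2.
Proof. by have [_ _ _ <- _] := sX; apply: Rintegral_ge0 => w _; exact: sqr_ge0. Qed.

(** E |X|^3 is at least s2^(3/2), by the inequality |x|^3 >= (3/2) c x^2 - c^3 / 2 at
    c = sqrt s2, so that Sakhanenko's condition bounds the variance. *)
Lemma sakh_le : s2 <= G ^+ 2.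
Proof.
have [_ ie _ E2 E3] := sX; have s0 := sakh_ge0.
set c := Num.sqrt s2; have c2 : c ^+ 2 = s2 by rewrite sqr_sqrtr.
have c0 : 0 <= c by exact: sqrtr_ge0.
have : \int[P]_w (3 / 2 * c * X w ^+ 2 - c ^+ 3 / 2) <=
    \int[P]_w (`|X w| ^+ 3 * expR (`|X w| / G)).
  apply: le_Rintegral => //.
    apply: intB; last exact: integrable_fin_cst.
    by apply: intZl; exact: sakh_integrable2.
  move=> w _; apply: (@le_trans _ _ (`|X w| ^+ 3)); last first.
    by rewrite ler_peMr ?exprn_ge0.
  have -> : X w ^+ 2 = `|X w| ^+ 2 by rewrite -normrX ger0_norm ?sqr_ge0.
  have x0 := normr_ge0 (X w).
  have : 0 <= (`|X w| - c) ^+ 2 * (`|X w| + c / 2).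
    by rewrite mulr_ge0 ?sqr_ge0//; lra.
  nra.
rewrite RintegralB//; [|by apply: intZl; exact: sakh_integrable2|exact: integrable_fin_cst].
rewrite RintegralZl//; last exact: sakh_integrable2.
rewrite Rintegral1 E2 => /le_trans /(_ E3).
rewrite -c2 => h; have [->|cn0] := eqVneq c 0; first by rewrite expr0n/= sqr_ge0.
have cp : 0 < c by rewrite lt_def cn0.
apply: lerXn2r; rewrite ?nnegrE; [exact: ltW|exact: ltW|].
by rewrite -(ler_pM2r (exprn_gt0 2 cp)); lra.
Qed.

Lemma sakh_weight (l : R) : 0 <= l -> l * G <= 1 ->
  P.-integrable setT (EFin \o (fun w => `|X w| ^+ 3 * expR (l * `|X w|))) /\
  \int[P]_w (`|X w| ^+ 3 * expR (l * `|X w|)) <= G * s2.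
Proof.
move=> l0 lG; have [_ ie _ _ E3] := sX.
have le w : `|X w| ^+ 3 * expR (l * `|X w|) <= `|X w| ^+ 3 * expR (`|X w| / G).
  rewrite ler_wpM2l ?exprn_ge0// ler_expR mulrC ler_wpM2l//.
  by rewrite -(ler_pM2r G0) mulVf// gt_eqF.
have il : P.-integrable setT (EFin \o (fun w => `|X w| ^+ 3 * expR (l * `|X w|))).
  apply: integrable_le ie.
    by apply: measurable_funM => //; apply: measurableT_comp => //; apply: measurable_funM => //; exact: measurableT_comp.
  by move=> w; rewrite ger0_norm// mulr_ge0 ?exprn_ge0 ?expR_ge0.
split; first exact: il.
apply: le_trans E3; apply: (le_Rintegral measurableT il ie) => w _.
exact: le.
Qed.

(** Third order expansion of the exponential; the remainder is what Sakhanenko's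
    condition controls. *)
Lemma sakh_mgf (l : R) : 0 <= l -> l * G <= 1 ->
  P.-integrable setT (EFin \o (fun w => expR (l * X w))) /\
  \int[P]_w (expR (l * X w)) <= expR (l ^+ 2 * s2 / 2 + l ^+ 3 * G * s2).
Proof.
move=> l0 lG; have [i l3] := sakh_weight l0 lG; have [_ _ E1 E2 _] := sX.
have i1 := sakh_integrable1; have i2 := sakh_integrable2.
pose g w := 1 + l * X w + l ^+ 2 / 2 * X w ^+ 2 + l ^+ 3 * (`|X w| ^+ 3 * expR (l * `|X w|)).
have ga : P.-integrable setT (EFin \o (fun w => 1 + l * X w)).
  apply: (intD (integrable_fin_cst P 1)).
  exact: (intZl l i1).
have gb : P.-integrable setT (EFin \o (fun w => 1 + l * X w + l ^+ 2 / 2 * X w ^+ 2)).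
  apply: (intD ga).
  exact: (intZl (l ^+ 2 / 2) i2).
have gc := integrableZl measurableT (l ^+ 3) i.
have gi : P.-integrable setT (EFin \o g) by exact: (intD gb gc).
have gE : \int[P]_w g w = 1 + l ^+ 2 * s2 / 2 +
    l ^+ 3 * \int[P]_w (`|X w| ^+ 3 * expR (l * `|X w|)).
  rewrite RintegralD// RintegralD//; last exact: (intZl (l ^+ 2 / 2) i2).
  rewrite RintegralD//; [|exact: integrable_fin_cst|exact: (intZl l i1)].
  rewrite !RintegralZl// Rintegral1 E1 E2; ring.
have le w : expR (l * X w) <= g w.
  have := expR_taylor3 (l * X w); rewrite normrM (ger0_norm l0) exprMn => h.
  have := le_trans (ler_norm _) h; rewrite /g; lra.
have me : measurable_fun setT (fun w => expR (l * X w)).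
  by apply: measurableT_comp => //; exact: measurable_funM.
have ie : P.-integrable setT (EFin \o (fun w => expR (l * X w))).
  by apply: integrable_le gi => // w; rewrite ger0_norm ?expR_ge0.
split => //; apply: (@le_trans _ _ (\int[P]_w g w)); first exact: le_Rintegral.
rewrite gE; apply: le_trans (expR_ge1Dx _).
have := ler_wpM2l (exprn_ge0 3 l0) l3; lra.
Qed.

Lemma measurable_heat v : measurable_fun setT (@heat R v).
Proof.
apply: measurableT_comp; last exact: measurable_funM.
apply: measurable_funB => //; apply: continuous_measurable_fun => x.
by apply: differentiable_continuous; apply/derivable1_diffP; have [] := is_derive_Phi x.
Qed.

Lemma heat_integrable v z : P.-integrable setT (EFin \o (fun w => heat v (z - X w))).
Proof.
apply: (integrable_le _ _ (integrable_fin_cst P 1)).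
  by apply: measurableT_comp; [exact: measurable_heat|exact: measurable_funB].
by move=> w; rewrite ger0_norm ?Phib_le1 ?Phib_ge0.
Qed.

(** A potential for the errors of the successive replacements: its decrease between
    the times v and v + t dominates the error of one step ([pot_step]), so that the
    errors telescope. *)
Definition pot (l v : R) := (Num.sqrt v)^-1 - l ^+ 2 * Num.sqrt v.

Lemma pot_step l v t : 0 < v -> 0 <= t <= v ->
  t * ((v * Num.sqrt v)^-1 + l ^+ 2 / Num.sqrt v) <= 6 * (pot l v - pot l (v + t)).
Proof.
move=> v0 /andP[t0 tv].
set s := Num.sqrt v; set s' := Num.sqrt (v + t).
have s0 : 0 < s by rewrite sqrtr_gt0.
have vt0 : 0 < v + t by lra.
have s'0 : 0 < s' by rewrite sqrtr_gt0.
have sE : s ^+ 2 = v by rewrite sqr_sqrtr// ltW.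
have s'E : s' ^+ 2 = v + t by rewrite sqr_sqrtr// ltW.
have ss' : s <= s' by rewrite ler_wsqrtr// lerDl.
have s's : s' <= 2 * s by nra.
have tE : t = (s' - s) * (s' + s) by rewrite -subr_sqr sE s'E; ring.
rewrite /pot -/s -/s'.
have h1 : t / s <= 3 * (s' - s).
  by rewrite ler_pdivrMr// tE; nra.
have h2 : t / (v * s) <= 6 * (s^-1 - s'^-1).
  have -> : s^-1 - s'^-1 = (s' - s) / (s * s').
    by field; rewrite ?(gt_eqF s0) ?(gt_eqF s'0).
  rewrite ler_pdivrMr; last by rewrite mulr_gt0.
  rewrite -sE (_ : 6 * ((s' - s) / (s * s')) * (s ^+ 2 * s) = 6 * (s' - s) * s ^+ 2 / s'); last first.
    by field; rewrite ?(gt_eqF s0) ?(gt_eqF s'0).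
  rewrite ler_pdivlMr// tE -!mulrA (mulrCA 6) ler_wpM2l ?subr_ge0//.
  nra.
have := ler_wpM2l (sqr_ge0 l) h1.
by rewrite mulrDr => h3; move: h2; rewrite /=; nra.
Qed.

(** Replacing an increment of variance s2 by a lapse of time s2: the expansions of
    [heat_taylor] and [heat_taylor_time] agree up to the remainders. *)
Lemma heat_onestep (l v z : R) : 0 <= l -> l * G <= 1 -> G ^+ 2 <= v ->
  `|\int[P]_w heat v (z - X w) - heat (v + s2) z| <=
  step_const * G * (pot l v - pot l (v + s2)) * wt l v z.
Proof.
move=> l0 lG Gv; have v0 : 0 < v by apply: lt_le_trans Gv; rewrite exprn_gt0.
have [i l3] := sakh_weight l0 lG; have [_ _ E1 E2 _] := sX.
have i1 := sakh_integrable1; have i2 := sakh_integrable2.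
have s20 := sakh_ge0; have s2G := sakh_le.
set s := Num.sqrt v; have s0 : 0 < s by rewrite sqrtr_gt0.
have sE : s ^+ 2 = v by rewrite sqr_sqrtr// ltW.
have Gs : G <= s by rewrite leNgt; apply/negP => h; nra.
set M := 3 * (1 + l ^+ 2 * v) / (v * s) * wt l v z.
have M0 : 0 <= M.
  rewrite mulr_ge0 ?expR_ge0// divr_ge0 ?mulr_ge0 ?addr_ge0 ?mulr_ge0 ?sqr_ge0//; exact: ltW.
have A1 : `|\int[P]_w heat v (z - X w) - heat v z - s2 / 2 * heat2 v z| <= M * (G * s2).
  pose f w := heat v (z - X w) - heat v z - X w * heat1 v z - X w ^+ 2 / 2 * heat2 v z.
  have j0 := heat_integrable v z.
  have j1 : P.-integrable setT (EFin \o (fun w => heat v (z - X w) - heat v z)).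
    by apply: (intB j0); exact: integrable_fin_cst.
  have k1 : P.-integrable setT (EFin \o (fun w => X w * heat1 v z)).
    exact: (intZr (heat1 v z) i1).
  have j2 : P.-integrable setT (EFin \o (fun w => heat v (z - X w) - heat v z - X w * heat1 v z)).
    exact: (intB j1 k1).
  have k0 : P.-integrable setT (EFin \o (fun w => X w ^+ 2 / 2)).
    exact: (intZr (2^-1) i2).
  have k2 : P.-integrable setT (EFin \o (fun w => X w ^+ 2 / 2 * heat2 v z)).
    exact: (intZr (heat2 v z) k0).
  have fE : \int[P]_w f w = \int[P]_w heat v (z - X w) - heat v z - s2 / 2 * heat2 v z.
    rewrite RintegralB// RintegralB// RintegralB//; last exact: integrable_fin_cst.
    by rewrite Rintegral1 !RintegralZr// E1 E2; ring.
  have fi : P.-integrable setT (EFin \o f) by exact: (intB j2 k2).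
  rewrite -fE; apply: (@le_trans _ _ (\int[P]_w (M * (`|X w| ^+ 3 * expR (l * `|X w|))))).
    apply: Rintegral_le_abs.
    - by have /measurable_int/measurable_EFinP := fi.
    - exact: (intZl M i).
    - by move=> w; exact: heat_taylor.
  by rewrite RintegralZl// ler_wpM2l.
have ls : l ^+ 2 * s2 <= 1.
  apply: (@le_trans _ _ (l ^+ 2 * G ^+ 2)); first by rewrite ler_wpM2l ?sqr_ge0.
  by rewrite -exprMn expr_le1// mulr_ge0// ltW.
have tv : 0 <= s2 <= v by rewrite s20 (le_trans s2G).
have A2 := heat_taylor_time z v0 l0 tv ls.
rewrite -/s in A2.
have tri (a b c e : R) : a - b = (a - c - e) - (b - c - e) by ring.
rewrite (tri _ _ (heat v z) (s2 / 2 * heat2 v z)).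
apply: le_trans (ler_normB _ _) _; apply: le_trans (lerD A1 A2) _.
rewrite /M mulrAC -mulrDl ler_wpM2r ?expR_ge0//.
have := pot_step l v0 tv; rewrite -/s => ps.
have ps' := ler_wpM2l (ltW G0) ps.
rewrite /step_const.
suff : 3 * (1 + l ^+ 2 * v) / (v * s) * (G * s2) +
  40 * s2 ^+ 2 * (1 + 4 * l ^+ 3 * (v * s)) / v ^+ 2 <=
  200 * (G * (s2 * ((v * s)^-1 + l ^+ 2 / s))) by lra.
have k1 : s2 ^+ 2 / v ^+ 2 <= G * s2 / (v * s).
  rewrite ler_pdivrMr ?exprn_gt0// (_ : _ / _ * _ = G * s2 * s); last first.
    by rewrite -sE; field; rewrite gt_eqF.
  have : s2 * s2 <= s2 * G ^+ 2 by rewrite ler_wpM2l.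
  have : s2 * G * G <= s2 * G * s by rewrite ler_wpM2l// mulr_ge0// ltW.
  by lra.
have k2 : s2 ^+ 2 * (l ^+ 3 * (v * s)) / v ^+ 2 <= G * s2 * (l ^+ 2 / s).
  rewrite (_ : s2 ^+ 2 * _ / _ = (s2 ^+ 2 * l) * (l ^+ 2 / s)); last first.
    by rewrite -sE; field; rewrite gt_eqF.
  apply: ler_wpM2r; first by rewrite divr_ge0 ?sqr_ge0// ltW.
  have : s2 * s2 * l <= s2 * G ^+ 2 * l by rewrite ler_wpM2r// ler_wpM2l.
  have : (s2 * G) * (l * G) <= (s2 * G) * 1 by rewrite ler_wpM2l// mulr_ge0// ltW.
  by lra.
have k3 : 0 <= G * s2 / (v * s).
  by rewrite divr_ge0 ?mulr_ge0// ltW.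
have k4 : 0 <= G * s2 * (l ^+ 2 / s).
  by rewrite mulr_ge0 ?divr_ge0 ?sqr_ge0 ?mulr_ge0// ltW.
have -> : 3 * (1 + l ^+ 2 * v) / (v * s) * (G * s2) =
   3 * (G * s2 / (v * s)) + 3 * (G * s2 * (l ^+ 2 / s)).
  by field; rewrite ?(gt_eqF v0) ?(gt_eqF s0).
have -> : 40 * s2 ^+ 2 * (1 + 4 * l ^+ 3 * (v * s)) / v ^+ 2 =
   40 * (s2 ^+ 2 / v ^+ 2) + 160 * (s2 ^+ 2 * (l ^+ 3 * (v * s)) / v ^+ 2).
  by field; rewrite (gt_eqF v0).
have -> : 200 * (G * (s2 * ((v * s)^-1 + l ^+ 2 / s))) =
  200 * (G * s2 / (v * s)) + 200 * (G * s2 * (l ^+ 2 / s)).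
  by field; rewrite ?(gt_eqF v0) ?(gt_eqF s0).
lra.
Qed.

End onestep.

Section lindeberg.
Context d (T : measurableType d) (R : realType) (P : probability T R).
Variables (G : R) (X : nat -> T -> R) (s2 : nat -> R).
Hypothesis G0 : 0 < G.
Hypothesis sX : forall i, sakhanenko P G (X i) (s2 i).
Let S i w := \sum_(j < i) X j w.
Let V i := \sum_(j < i) s2 j.
Hypothesis indep : forall i A B, measurable A -> measurable B ->
  P (S i @^-1` A `&` X i @^-1` B) = (P (S i @^-1` A) * P (X i @^-1` B))%E.

Let mX i : measurable_fun setT (X i). Proof. by case: (sX i). Qed.

Let mS i : measurable_fun setT (S i).
Proof. by apply: measurable_sum => j; exact: mX. Qed.

Let V0 i : 0 <= V i.
Proof. by apply: sumr_ge0 => j _; exact: (sakh_ge0 (sX j)). Qed.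

Let SS i w : S i.+1 w = S i w + X i w. Proof. by rewrite /S big_ord_recr. Qed.
Let VS i : V i.+1 = V i + s2 i. Proof. by rewrite /V big_ord_recr. Qed.

(** It bounds the mean of the weight carried by the increments that are still to be
    replaced. *)
Lemma partial_mgf (l : R) i : 0 <= l -> l * G <= 1 ->
  P.-integrable setT (EFin \o (fun w => expR (l * S i w))) /\
  \int[P]_w (expR (l * S i w)) <= expR (l ^+ 2 * V i / 2 + l ^+ 3 * G * V i).
Proof.
move=> l0 lG; elim: i => [|i [IHi IH]].
  have -> : (fun w => expR (l * S 0%N w)) = cst 1.
    by apply/funext => w; rewrite /S big_ord0 mulr0 expR0.
  split; first exact: integrable_fin_cst.
  by rewrite Rintegral1 /V big_ord0 !mulr0 mul0r addr0 expR0.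
have [mi ml] := sakh_mgf G0 (sX i) l0 lG.
set m := \int[P]_w expR (l * X i w) in ml.
have m0 : 0 <= m by apply: Rintegral_ge0 => w _; exact: expR_ge0.
have mfe (f : T -> R) : measurable_fun setT f -> measurable_fun setT (fun w => expR (l * f w)).
  by move=> mf; apply: measurableT_comp => //; exact: measurable_funM.
pose f (z : R * R) := expR (l * z.1) * expR (l * z.2).
have mf : measurable_fun setT f.
  by apply: measurable_funM; apply: measurableT_comp => //; apply: measurable_funM.
have f0 z : 0 <= f z by rewrite mulr_ge0 ?expR_ge0.
have SE w : expR (l * S i.+1 w) = f (S i w, X i w) by rewrite SS mulrDr expRD.
have E : (\int[P]_w (expR (l * S i.+1 w))%:E = (m * \int[P]_w expR (l * S i w))%:E)%E.
  under eq_integral do rewrite SE.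
  rewrite (freeze (mS i) (mX i) (@indep i) (f := EFin \o f)) //=; last first.
    exact/measurable_EFinP.
  transitivity (\int[P]_w (m * expR (l * S i w))%:E)%E.
    apply: eq_integral => w _; rewrite /f/=.
    under eq_integral do rewrite EFinM.
    rewrite ge0_integralZl//; last first.
      by apply/measurable_EFinP; exact: mfe.
    by rewrite EFinM muleC /m /Rintegral fineK// integrable_fin_num.
  rewrite -RintegralZl// /Rintegral fineK//; apply: integrable_fin_num => //.
  exact: intZl.
have I : P.-integrable setT (EFin \o (fun w => expR (l * S i.+1 w))).
  apply/integrableP; split; first by apply/measurable_EFinP; exact: mfe.
  under eq_integral do rewrite /= ger0_norm ?expR_ge0//.
  by rewrite E ltry.
split => //; rewrite {1}/Rintegral E /=.
rewrite VS (_ : _ + _ = (l ^+ 2 * s2 i / 2 + l ^+ 3 * G * s2 i) +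
   (l ^+ 2 * V i / 2 + l ^+ 3 * G * V i)); last by ring.
rewrite expRD; apply: ler_pM m0 _ ml IH.
by apply: Rintegral_ge0 => w _; exact: expR_ge0.
Qed.

Lemma pot_nincr (l v t : R) : 0 < v -> 0 <= t -> 0 <= pot l v - pot l (v + t).
Proof.
move=> v0 t0; rewrite /pot.
have s0 : 0 < Num.sqrt v by rewrite sqrtr_gt0.
have h : Num.sqrt v <= Num.sqrt (v + t) by rewrite ler_wsqrtr// lerDl.
have h1 : (Num.sqrt (v + t))^-1 <= (Num.sqrt v)^-1.
  by rewrite lef_pV2// posrE//; apply: lt_le_trans h.
have := ler_wpM2l (sqr_ge0 l) h; lra.
Qed.

Let heat_S_int i v z : P.-integrable setT (EFin \o (fun w => heat v (z - S i w))).
Proof.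
apply: (integrable_le _ _ (integrable_fin_cst P 1)).
  by apply: measurableT_comp; [exact: measurable_heat|exact: measurable_funB].
by move=> w; rewrite ger0_norm ?Phib_le1 ?Phib_ge0.
Qed.

(** Increments are replaced from the last one to the first one; freezing the
    earlier ones, one replacement is [heat_onestep], and the weight is then averaged
    by [partial_mgf]. *)
Lemma lindeberg (l v z : R) i : 0 <= l -> l * G <= 1 -> G ^+ 2 <= v ->
  `|\int[P]_w heat v (z - S i w) - heat (v + V i) z| <=
  step_const * G * (pot l v - pot l (v + V i)) * (expR (l ^+ 3 * G * V i) * wt l (v + V i) z).
Proof.
move=> l0 lG; elim: i v => [|i IH] v Gv.
  have -> : V 0%N = 0 by rewrite /V big_ord0.
  have -> : (fun w => heat v (z - S 0%N w)) = cst (heat v z).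
    by apply/funext => w; rewrite /S big_ord0 subr0.
  by rewrite Rintegral1 !addr0 !subrr normr0 mulr0 mul0r.
have v0 : 0 < v by apply: lt_le_trans Gv; rewrite exprn_gt0.
have s0 : 0 <= s2 i := sakh_ge0 (sX i).
pose h z' := \int[P]_w heat v (z' - X i w).
have hE : \int[P]_w heat v (z - S i.+1 w) = \int[P]_w h (z - S i w).
  have := freezeR (mS i) (mX i) (@indep i) (f := fun p => heat v (z - p.1 - p.2)).
  rewrite /= => <-.
  - by apply: eq_Rintegral => w _; rewrite SS opprD addrA.
  - by apply: measurableT_comp; [exact: measurable_heat|do 2 apply: measurable_funB => //].
  - by move=> p; exact: Phib_ge0.
  - move=> s; exact: (heat_integrable (sX i) v (z - s)).
have h01 z' : 0 <= h z' <= 1.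
  apply/andP; split; first by apply: Rintegral_ge0 => w _; exact: Phib_ge0.
  rewrite -[leRHS](Rintegral1 P); apply: le_Rintegral => //.
  - exact: (heat_integrable (sX i) v z').
  - exact: integrable_fin_cst.
  - by move=> w _; exact: Phib_le1.
have mh : measurable_fun setT (fun w => h (z - S i w)).
  apply: (@measurableT_comp _ _ _ _ _ _ fine _ (fun w => \int[P]_w' (heat v (z - S i w - X i w'))%:E)%E) => //.
  have := @measurable_fun_fubini_tonelli_F _ _ T T R P
    (fun p : T * T => (heat v (z - S i p.1 - X i p.2))%:E).
  apply.
  - apply/measurable_EFinP; apply: measurableT_comp; first exact: measurable_heat.
    apply: measurable_funB => //; last exact: (measurableT_comp (mX i)).
    by apply: measurable_funB => //; exact: (measurableT_comp (mS i)).
  - by move=> p; rewrite lee_fin Phib_ge0.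
have hi : P.-integrable setT (EFin \o (fun w => h (z - S i w))).
  apply: (integrable_le mh _ (integrable_fin_cst P 1)) => w.
  by have /andP[? ?] := h01 (z - S i w); rewrite ger0_norm.
have [Si Sm] := partial_mgf i l0 lG.
set r := step_const * G * (pot l v - pot l (v + s2 i)).
have r0 : 0 <= r.
  by rewrite /r !mulr_ge0 ?step_const_ge0 ?pot_nincr// ltW.
have A1 : `|\int[P]_w h (z - S i w) - \int[P]_w heat (v + s2 i) (z - S i w)| <=
    r * wt l v z * \int[P]_w expR (l * S i w).
  rewrite -RintegralB// -RintegralZl//; apply: Rintegral_le_abs.
  - apply: measurable_funB => //.
    by apply: measurableT_comp; [exact: measurable_heat|exact: measurable_funB].
  - exact: intZl.
  - move=> w; rewrite -mulrA -wtB; exact: (heat_onestep G0 (sX i) _ l0 lG Gv).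
have Gv' : G ^+ 2 <= v + s2 i by apply: le_trans Gv _; rewrite lerDl.
have A2 := IH (v + s2 i) Gv'.
rewrite -(addrA v) (addrC (s2 i)) -VS in A2.
rewrite hE.
have -> : \int[P]_w h (z - S i w) - heat (v + V i.+1) z =
  (\int[P]_w h (z - S i w) - \int[P]_w heat (v + s2 i) (z - S i w)) +
  (\int[P]_w heat (v + s2 i) (z - S i w) - heat (v + V i.+1) z) by ring.
apply: le_trans (ler_normD _ _) _; apply: le_trans (lerD A1 A2) _.
set W := wt l (v + V i.+1) z.
have W0 : 0 <= W := expR_ge0 _.
have eV : expR (l ^+ 3 * G * V i) <= expR (l ^+ 3 * G * V i.+1).
  by rewrite ler_expR ler_wpM2l ?VS ?lerDl// mulr_ge0 ?exprn_ge0// ltW.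
have B1 : wt l v z * \int[P]_w expR (l * S i w) <= expR (l ^+ 3 * G * V i.+1) * W.
  apply: (@le_trans _ _ (wt l v z * expR (l ^+ 2 * V i / 2 + l ^+ 3 * G * V i))).
    by rewrite ler_wpM2l ?expR_ge0.
  rewrite /wt /W /wt -!expRD ler_expR VS.
  have : 0 <= l ^+ 2 * s2 i by rewrite mulr_ge0 ?sqr_ge0.
  have : 0 <= l ^+ 3 * G * s2 i by rewrite !mulr_ge0 ?exprn_ge0// ltW.
  by lra.
have B2 : expR (l ^+ 3 * G * V i) * W <= expR (l ^+ 3 * G * V i.+1) * W by rewrite ler_wpM2r.
have C1 := ler_wpM2l r0 B1.
have p0 : 0 <= step_const * G * (pot l (v + s2 i) - pot l (v + V i.+1)).
  rewrite !mulr_ge0 ?step_const_ge0 ?(ltW G0)// VS (addrC (V i)) addrA pot_nincr//.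
  by apply: ltr_pwDl.
have C2 := ler_wpM2l p0 B2.
apply: (@le_trans _ _ (r * (expR (l ^+ 3 * G * V i.+1) * W) +
  step_const * G * (pot l (v + s2 i) - pot l (v + V i.+1)) * (expR (l ^+ 3 * G * V i.+1) * W))).
  by rewrite -mulrA lerD.
by rewrite -mulrDl /r le_eqVlt; apply/orP; left; apply/eqP; ring.
Qed.

End lindeberg.

(** The error of smoothing an indicator is of Gaussian size, and a Gaussian bump is
    itself dominated by a difference of two smoothed indicators.  The smoothing
    error can therefore be estimated by the replacement theorem once more. *)
Lemma gauss_le_Phib_gap (R : realType) (u : R) :
  expR (- u ^+ 2 / 2) <= 6 * (Phib (u - 1) - Phib (u + 1)).
Proof.
have gap (a : R) : exists2 c, a <= c <= a + 1 & Phib a - Phib (a + 1) = phi c.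
  have [|c ac e] := @mvt_der R (@Phib R) (fun x => - phi x) a (a + 1) _ (fun y _ => is_derive_Phib y).
    by rewrite lerDl.
  by exists c => //; move: e; lra.
have lo (c : R) : `|c| <= Num.max `|u| 1 -> expR (- u ^+ 2 / 2) <= 6 * phi c.
  move=> cu; have /andP[+ _] := phi_bounds c.
  suff : expR (- u ^+ 2 / 2) <= 2 * expR (- c ^+ 2 / 2) by lra.
  have e2 : 1 <= 2 * expR (- 2^-1) :> R by have := @expR_ge1Dx R (- 2^-1); lra.
  have cc : c ^+ 2 = `|c| ^+ 2 by rewrite -normrX ger0_norm ?sqr_ge0.
  have uu : u ^+ 2 = `|u| ^+ 2 by rewrite -normrX ger0_norm ?sqr_ge0.
  have c0 := normr_ge0 c.
  have : c ^+ 2 <= u ^+ 2 + 1.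
    rewrite cc uu; move: cu; rewrite le_max => /orP[] h; have := normr_ge0 u; nra.
  move=> h; apply: le_trans (_ : expR (- 2^-1) * 2 * expR (- u ^+ 2 / 2) <= _).
    by rewrite ler_peMl ?expR_ge0//; lra.
  rewrite mulrAC mulrC ler_wpM2l// -expRD ler_expR; lra.
have [c1 /andP[a1 b1] e1] := gap (u - 1); have [c2 /andP[a2 b2] e2] := gap u.
rewrite (_ : u - 1 + 1 = u) in e1 b1; last by ring.
have p1 := phi_ge0 c1; have p2 := phi_ge0 c2.
have [u0|u0] := leP 0 u.
  suff : expR (- u ^+ 2 / 2) <= 6 * phi c1 by lra.
  apply: lo; clear e1 e2 p1 p2 a2 b2; rewrite le_max (ger0_norm u0) !ler_norml; apply/orP.
  by have [u1|u1] := leP u 1; [right|left]; apply/andP; split; lra.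
suff : expR (- u ^+ 2 / 2) <= 6 * phi c2 by lra.
apply: lo; clear e1 e2 p1 p2 a1 b1; rewrite le_max (ltr0_norm u0) !ler_norml; apply/orP.
by have [u1|u1] := leP u (- 1); [left|right]; apply/andP; split; lra.
Qed.

Lemma indic_Phib (R : realType) (u : R) :
  `|((u <= 0)%R)%:R - Phib u| <= 12 * (Phib (u - 1) - Phib (u + 1)).
Proof.
have g := gauss_le_Phib_gap u.
suff : `|((u <= 0)%R)%:R - Phib u| <= 2 * expR (- u ^+ 2 / 2) by lra.
have [u0|u0] := leP u 0.
  have -> : 1%:R - Phib u = Phib (- u) by rewrite /Phib PhiN /=; ring.
  rewrite ger0_norm ?Phib_ge0// -sqrrN; apply: Phib_le; lra.
rewrite sub0r normrN ger0_norm ?Phib_ge0//; apply: Phib_le; exact: ltW.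
Qed.

Lemma Phib_lip (R : realType) (a b M : R) :
  (forall c, Num.min a b <= c <= Num.max a b -> phi c <= M) ->
  `|Phib a - Phib b| <= M * `|a - b|.
Proof.
wlog ab : a b / a <= b => [h|] hM.
  have [ab|/ltW ab] := leP a b; first exact: h.
  rewrite distrC (distrC a); apply: h => // c; rewrite minC maxC; exact: hM.
have [c cab e] := mvt_der ab (fun y _ => is_derive_Phib y).
rewrite distrC e normrM normrN (distrC a) ler_wpM2r// ger0_norm ?phi_ge0//.
by apply: hM; rewrite min_l// max_r.
Qed.

(** Size of the errors when the smoothing time is (th / l)^2 with l = x + 2: shifting
    x by th / l, or adding that time to the variance, changes the tail at x by a
    fraction th of exp (- x^2 / 2) / l, which is of the size of the tail itself. *)
Lemma heat_numerics (R : realType) (x th : R) : -1 <= x -> 0 < th <= 1 ->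
  let l := x + 2 in let tau := th / l in let v := tau ^+ 2 in
  let E0 := expR (- x ^+ 2 / 2) / l in let e5 := expR 5 in
  heat (v + 1) (x - tau) - heat (v + 1) (x + tau) <= 2 * (e5 * th * E0) /\
  `|heat (v + 1) x - Phib x| <= e5 * th * E0.
Proof.
move=> x1 /andP[th0 th1] l tau v E0 e5.
have l1 : 1 <= l by rewrite /l; lra.
have l0 : 0 <= l by lra.
have lp : 0 < l by lra.
have tau0 : 0 < tau by rewrite divr_gt0.
have tau1 : tau <= 1 by rewrite ler_pdivrMr// mul1r; lra.
have ltau : l * tau = th by rewrite /tau mulrC divfK// gt_eqF.
have v0 : 0 < v by rewrite exprn_gt0.
set s1 := Num.sqrt (v + 1).
have s1v : s1 ^+ 2 = v + 1 by rewrite sqr_sqrtr//; lra.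
have s10 : 0 < s1 by rewrite sqrtr_gt0; lra.
have s11 : 1 <= s1 by nra.
have xl : `|x| <= l by rewrite ler_norml /l; apply/andP; split; lra.
have lv : l * v = th * tau by rewrite /v expr2 mulrA ltau.
have lv2 : l ^+ 2 * v = th ^+ 2 by rewrite /v -exprMn ltau.
have xv : x ^+ 2 * v <= 1.
  apply: (@le_trans _ _ (l ^+ 2 * v)); last by rewrite lv2 expr_le1// ltW.
  by rewrite ler_wpM2r ?(ltW v0)// -(ger0_norm (sqr_ge0 x)) normrX lerXn2r ?nnegrE.
have xtau : `|x| * tau <= 1.
  by apply: (@le_trans _ _ (l * tau)); [rewrite ler_wpM2r// ltW|rewrite ltau].
split.
  rewrite [leRHS](_ : _ = 2 * e5 * th * E0); last by ring.
  apply: le_trans (ler_norm _) _; rewrite /heat -/s1.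
  have ab : (x - tau) / s1 <= (x + tau) / s1 by rewrite ler_wpM2r ?invr_ge0 ?(ltW s10)//; lra.
  apply: le_trans (Phib_lip (M := e5 * expR (- x ^+ 2 / 2)) _) _.
    rewrite min_l// max_r// => c /andP[]; rewrite ler_pdivrMr// ler_pdivlMr// => c1 c2.
    have /andP[_ /le_trans] := phi_bounds c; apply.
    suff : expR (- c ^+ 2 / 2) <= e5 * expR (- x ^+ 2 / 2).
      by have := expR_ge0 (- c ^+ 2 / 2); lra.
    rewrite /e5 -expRD ler_expR.
    suff : x ^+ 2 - 6 <= c ^+ 2 by lra.
    have cs : (x ^+ 2 - 2) <= (c * s1) ^+ 2.
      have : 0 <= (c * s1 - x) ^+ 2 by exact: sqr_ge0.
      have : `|x * (c * s1 - x)| <= 1.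
        rewrite normrM; apply: le_trans xtau; rewrite ler_wpM2l// ler_norml.
        by apply/andP; split; lra.
      by rewrite ler_norml => /andP[? ?]; nra.
    rewrite -(@ler_pM2r _ (v + 1)); last lra.
    by rewrite -[in leRHS]s1v -exprMn; nra.
  rewrite -mulrBl (_ : x - tau - (x + tau) = - (2 * tau)); last by ring.
  rewrite normrM normrN (gtr0_norm (_ : 0 < 2 * tau)); last lra.
  rewrite (gtr0_norm (_ : 0 < s1^-1)) ?invr_gt0//.
  have : 2 * tau / s1 <= 2 * tau by rewrite ler_pdivrMr//; nra.
  have ee : 0 <= e5 * expR (- x ^+ 2 / 2) by rewrite mulr_ge0 ?expR_ge0.
  move=> /(ler_wpM2l ee) /le_trans; apply.
  by rewrite /E0 /tau le_eqVlt; apply/orP; left; apply/eqP; ring.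
  rewrite /heat -/s1.
  apply: le_trans (Phib_lip (M := e5 * expR (- x ^+ 2 / 2)) _) _.
    move=> c cx; have /andP[_ /le_trans] := phi_bounds c; apply.
    suff : expR (- c ^+ 2 / 2) <= e5 * expR (- x ^+ 2 / 2).
      by have := expR_ge0 (- c ^+ 2 / 2); lra.
    rewrite /e5 -expRD ler_expR.
    suff : x ^+ 2 - 2 <= c ^+ 2 by lra.
    have cs : x ^+ 2 <= (c * s1) ^+ 2.
      have [x0|x0] := leP 0 x.
        have h : x / s1 <= x by rewrite ler_pdivrMr//; nra.
        move: cx; rewrite min_l// max_r// ler_pdivrMr// => /andP[h2 _].
        by apply: lerXn2r; rewrite ?nnegrE// (le_trans x0).
      have h : x <= x / s1 by rewrite ler_pdivlMr//; nra.
      move: cx; rewrite min_r// max_l// ler_pdivlMr// => /andP[_ h2].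
      by nra.
    rewrite -(@ler_pM2r _ (v + 1)); last lra.
    by rewrite -[in leRHS]s1v -exprMn; nra.
  rewrite -mulrA -[leRHS]mulrA; apply: ler_wpM2l; first exact: expR_ge0.
  rewrite (_ : x / s1 - x = - (x * (1 - s1^-1))); last by ring.
  have is1 : 1 - s1^-1 <= v.
    rewrite lerBlDl -lerBlDr -(@ler_pM2r _ (s1 ^+ 2)); last by rewrite exprn_gt0.
    rewrite (_ : s1^-1 * _ = s1); last by field; rewrite gt_eqF.
    rewrite s1v; nra.
  have is0 : 0 <= 1 - s1^-1 by rewrite subr_ge0 invf_le1.
  rewrite normrN normrM (ger0_norm is0).
  have : `|x| * (1 - s1^-1) <= l * v by apply: ler_pM.
  rewrite lv => h; have h2 : `|x| * (1 - s1^-1) <= th / l.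
    apply: le_trans h _; rewrite /tau ler_wpM2l ?(ltW th0)//.
    by rewrite ler_piMl// invr_ge0.
  apply: le_trans (ler_wpM2l (expR_ge0 _) h2) _.
  by rewrite /E0 le_eqVlt; apply/orP; left; apply/eqP; ring.
Qed.

(** Triangle inequality along the chain probability, smoothed probability, smoothed
    normal tail, normal tail; hm, hp are the smoothed probabilities at the shifted
    arguments and a, b their normal counterparts. *)
Lemma error_chain (R : realType) (p Q h0 hm hp a b c B sc : R) :
  `|p - h0| <= 12 * (hm - hp) -> `|hm - a| <= 3 * sc * B -> `|hp - b| <= 3 * sc * B ->
  `|h0 - c| <= 3 * sc * B -> a - b <= 2 * B -> `|c - Q| <= B -> 0 <= B -> B <= sc * B ->
  `|p - Q| <= 100 * sc * B.
Proof.
rewrite !ler_norml => /andP[? ?] /andP[? ?] /andP[? ?] /andP[? ?] ? /andP[? ?] ? ?.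
by apply/andP; split; lra.
Qed.

Definition cramer_const {R : realType} : R := 300 * step_const * expR 5.

Section cramer.
Context d (T : measurableType d) (R : realType) (P : probability T R).
Variables (G : R) (X : nat -> T -> R) (s2 : nat -> R) (k : nat).
Hypothesis G0 : 0 < G.
Hypothesis sX : forall i, sakhanenko P G (X i) (s2 i).
Let S i w := \sum_(j < i) X j w.
Hypothesis indep : forall i A B, measurable A -> measurable B ->
  P (S i @^-1` A `&` X i @^-1` B) = (P (S i @^-1` A) * P (X i @^-1` B))%E.
Hypothesis V1 : \sum_(j < k) s2 j = 1.

Let mS i : measurable_fun setT (S i).
Proof. by apply: measurable_sum => j; case: (sX j). Qed.

Let heat_S_int i v z : P.-integrable setT (EFin \o (fun w => heat v (z - S i w))).
Proof.
apply: (integrable_le _ _ (integrable_fin_cst P 1)).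
  by apply: measurableT_comp; [exact: measurable_heat|exact: measurable_funB].
by move=> w; rewrite ger0_norm ?Phib_le1 ?Phib_ge0.
Qed.

(** Smooth the indicator over the time (th / l)^2, l = x + 2, replace the increments by
    [lindeberg], and undo the smoothing by [indic_Phib].  The weight of slope l is, at
    the final time 1, of the size of exp (- x^2 / 2), and the Lindeberg error relative to
    the tail is of order G l^3 / th, hence at most th. *)
Lemma cramer (x th : R) : -1 <= x -> 0 < th <= 1 -> G * (x + 2) ^+ 3 <= th ^+ 2 ->
  `|fine (P [set w | x <= S k w]) - Phib x| <= cramer_const * th * Phib x.
Proof.
move=> x1 /andP[th0 th1] Gx.
set l := x + 2; have l1 : 1 <= l by rewrite /l; lra.
rewrite -/l in Gx.
have l0 : 0 <= l by lra.
have lp : 0 < l by lra.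
have Gl3 : l ^+ 3 * G <= 1 by rewrite mulrC (le_trans Gx)// expr_le1// ltW.
have l3l : l <= l ^+ 3 by rewrite -[leLHS]expr1; exact: ler_weXn2l.
have Glth : G * l <= th.
  have : G * l <= G * l ^+ 3 by rewrite ler_wpM2l// ltW.
  have : th ^+ 2 <= th * 1 by rewrite expr2 ler_wpM2l// ltW.
  lra.
have lG : l * G <= 1 by lra.
set tau := th / l; have tau0 : 0 < tau by rewrite divr_gt0.
have tau1 : tau <= 1 by rewrite ler_pdivrMr// mul1r; lra.
have ltau : l * tau = th by rewrite /tau mulrC divfK// gt_eqF.
set v := tau ^+ 2; have v0 : 0 < v by rewrite exprn_gt0.
have sv : Num.sqrt v = tau by rewrite sqrtr_sqr gtr0_norm.
have Gv : G ^+ 2 <= v.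
  apply: lerXn2r; rewrite ?nnegrE; [exact: ltW|exact: ltW|].
  by rewrite ler_pdivlMr.
set E0 := expR (- x ^+ 2 / 2) / l.
have E00 : 0 <= E0 by rewrite divr_ge0 ?expR_ge0.
set e5 := expR 5 : R.
have err z : x - tau <= z -> `|\int[P]_w heat v (z - S k w) - heat (v + 1) z| <=
    3 * step_const * (e5 * th * E0).
  move=> xz; rewrite [leRHS](_ : _ = 3 * step_const * e5 * th * E0); last by ring.
  have := lindeberg (v := v) G0 sX indep z k l0 lG Gv.
  rewrite -/(S k) V1 => /le_trans; apply.
  (* the potential is largest at the smoothing time, where it is l / th *)
  have pb : pot l v - pot l (v + 1) <= 3 * l ^+ 2 / th.
    rewrite /pot sv.
    have s1 : 0 < Num.sqrt (v + 1) by rewrite sqrtr_gt0; lra.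
    have s2' : Num.sqrt (v + 1) <= 2.
      have -> : 2 = Num.sqrt (2 ^+ 2) :> R by rewrite sqrtr_sqr ger0_norm.
      have v1 : v <= 1 by rewrite expr_le1// ltW.
      by rewrite ler_wsqrtr//; lra.
    have h1 : l ^+ 2 * Num.sqrt (v + 1) <= l ^+ 2 * 2 by rewrite ler_wpM2l ?sqr_ge0.
    have h2 : tau^-1 <= l ^+ 2 / th.
      rewrite /tau invf_div ler_wpM2r ?invr_ge0 ?(ltW th0)//; nra.
    have h3 : l ^+ 2 <= l ^+ 2 / th.
      by rewrite ler_peMr ?sqr_ge0// invf_ge1.
    have h4 : 0 <= (Num.sqrt (v + 1))^-1 by rewrite invr_ge0 ltW.
    have h5 : 0 <= l ^+ 2 * tau by rewrite mulr_ge0 ?sqr_ge0// ltW.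
    by lra.
  have wb : expR (l ^+ 3 * G * 1) * wt l (v + 1) z <= e5 * expR (- x ^+ 2 / 2).
    rewrite /wt /e5 -!expRD ler_expR mulr1.
    have : l ^+ 2 * v = th ^+ 2 by rewrite /v -exprMn ltau.
    have : th ^+ 2 <= 1 by rewrite expr_le1// ltW.
    have : l * (x - tau) <= l * z by rewrite ler_wpM2l.
    have : l * x = x ^+ 2 + 2 * x by rewrite /l; ring.
    have : l ^+ 2 = x ^+ 2 + 4 * x + 4 by rewrite /l; ring.
    by lra.
  have p0 : 0 <= pot l v - pot l (v + 1) by rewrite pot_nincr.
  apply: (@le_trans _ _ (step_const * G * (3 * l ^+ 2 / th) * (e5 * expR (- x ^+ 2 / 2)))).
    apply: ler_pM => //.
    - by rewrite !mulr_ge0 ?step_const_ge0// ltW.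
    - by rewrite mulr_ge0 ?expR_ge0.
    - by rewrite ler_wpM2l// mulr_ge0 ?step_const_ge0// ltW.
  rewrite (_ : _ * (e5 * _) = 3 * step_const * e5 * (G * l ^+ 3 / th) * E0); last first.
    by rewrite /E0; field; rewrite ?(gt_eqF th0) ?(gt_eqF lp).
  rewrite ler_wpM2r// ler_wpM2l ?mulr_ge0 ?expR_ge0 ?step_const_ge0//.
  by rewrite ler_pdivrMr// -expr2.
have mA : measurable [set w | x <= S k w].
  have -> : [set w | x <= S k w] = S k @^-1` `[x, +oo[.
    by apply/seteqP; split => w /=; rewrite in_itv/= andbT.
  by rewrite -[X in measurable X]setTI; exact: mS.
pose ind w : R := (((x - S k w) / tau <= 0)%R)%:R.
have indE0 : ind = \1_[set w | x <= S k w].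
  apply/funext => w; rewrite /ind indicE pmulr_lle0 ?invr_gt0// subr_le0.
  by rewrite (_ : (w \in _) = (x <= S k w))//; apply/idP/idP; rewrite inE.
have mind : measurable_fun setT ind by rewrite indE0; exact: measurable_indic.
have indE : fine (P [set w | x <= S k w]) = \int[P]_w ind w.
  by rewrite /Rintegral indE0 integral_indic// setIT.
have indI : P.-integrable setT (EFin \o ind).
  apply: (integrable_le mind _ (integrable_fin_cst P 1)) => w.
  by rewrite /ind; case: (_ / tau <= 0)%R; rewrite ?normr1 ?normr0.
have step1 : `|fine (P [set w | x <= S k w]) - \int[P]_w heat v (x - S k w)| <=
    12 * (\int[P]_w heat v (x - tau - S k w) - \int[P]_w heat v (x + tau - S k w)).
  rewrite indE -RintegralB// -RintegralB// -RintegralZl//; last exact: intB.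
  apply: Rintegral_le_abs.
  - apply: measurable_funB => //.
    by apply: measurableT_comp; [exact: measurable_heat|exact: measurable_funB].
  - by apply: intZl; exact: intB.
  - move=> w; rewrite /ind /heat sv.
    rewrite (_ : (x - tau - S k w) / tau = (x - S k w) / tau - 1); last first.
      by field; rewrite gt_eqF.
    rewrite (_ : (x + tau - S k w) / tau = (x - S k w) / tau + 1); last first.
      by field; rewrite gt_eqF.
    exact: indic_Phib.
have [gap cen] := heat_numerics x1 (introT andP (conj th0 th1)).
have e5t : 0 <= e5 * th by apply: mulr_ge0; [exact: expR_ge0|exact: ltW].
have B0 : 0 <= e5 * th * E0 by exact: mulr_ge0.
have B1 : e5 * th * E0 <= step_const * (e5 * th * E0).
  by rewrite ler_peMl// step_const_ge1.
have xt : x - tau <= x by rewrite gerBl ltW.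
have xt' : x - tau <= x + tau by rewrite (le_trans xt)// lerDl ltW.
have tot : `|fine (P [set w | x <= S k w]) - Phib x| <= 100 * step_const * (e5 * th * E0).
  exact: (error_chain step1 (err _ (lexx _)) (err _ xt') (err _ xt) gap cen B0 B1).
apply: le_trans tot _.
have Pb := Phib_ge x1; have /andP[pb _] := phi_bounds x.
(* the error so far is relative to exp (- x^2 / 2) / l; Mills makes it relative to the tail *)
have E3 : E0 <= 3 * Phib x.
  rewrite -ler_pdivrMl//; apply: le_trans Pb.
  by rewrite /E0 mulrA ler_wpM2r// invr_ge0.
rewrite /cramer_const -/e5.
have := ler_wpM2l (mulr_ge0 (mulr_ge0 (ler0n R 100) (step_const_ge0 R)) e5t) E3.
move/le_trans => h; apply: (le_trans _ (h _ _)).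
  by rewrite le_eqVlt; apply/orP; left; apply/eqP; ring.
by rewrite le_eqVlt; apply/orP; left; apply/eqP; ring.
Qed.

End cramer.

(** * Independence of the past and of the present environment *)

Lemma nneseriesZe (R : realType) (x : \bar R) (f : nat -> \bar R) :
  (0 <= x)%E -> (forall i, (0 <= f i)%E) ->
  (\sum_(0 <= i <oo) (x * f i) = x * \sum_(0 <= i <oo) f i)%E.
Proof.
case: x => [r r0|_|//] f0; first by rewrite nneseriesZl.
have [fz|/existsNP[i /eqP fi]] := pselect (forall i, f i = 0%E).
  by rewrite !eseries0 ?mule0// => i _ _; rewrite fz ?mule0.
have fi0 : (0 < f i)%E by rewrite lt_def fi f0.
rewrite (@nneseries_pinfty _ (fun i => +oo * f i)%E xpredT i)//;
  [|by move=> n _; rewrite mule_ge0|by rewrite gt0_mulye].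
rewrite gt0_mulye//; apply: lt_le_trans fi0 _.
apply: le_trans (nneseries_lim_ge i.+1 _) => //.
by rewrite big_nat_recr//= leeDr// sume_ge0.
Qed.

Lemma eseries_single (R : realType) (u : nat -> \bar R) (m : nat) :
  (forall k, k != m -> u k = 0%E) -> (\sum_(0 <= k <oo) u k = u m)%E.
Proof.
move=> um; apply/cvg_lim => //.
apply: (@cvg_near_cst) => //; near=> n.
have mn : (m < n)%N by near: n; exact: nbhs_infty_gt.
rewrite big_mkord (bigD1 (Ordinal mn))//= big1 ?adde0// => i im.
by apply: um; apply: contra im => /eqP im; apply/eqP/val_inj.
Unshelve. all: by end_near. Qed.

Lemma measurable_EFin_indic d (T : measurableType d) (R : realType) (A : set T) :
  measurable A -> measurable_fun setT (fun w => (\1_A w : R)%:E).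
Proof. by move=> mA; apply/measurable_EFinP; exact: measurable_indic. Qed.

(** Equality of the integrals over the events of a sigma-algebra extends to the
    nonnegative functions measurable for it, by approximation with simple functions. *)
Lemma sub_ext d (T : measurableType d) (R : realType) (P : probability T R)
  (C : set (set T)) (g f : T -> \bar R) :
  C `<=` measurable ->
  measurable_fun setT g -> measurable_fun setT f ->
  (forall w, (0 <= g w)%E) -> (forall w, (0 <= f w)%E) ->
  (forall A, <<s C >> A -> (\int[P]_(w in A) g w = \int[P]_(w in A) f w)%E) ->
  forall h : T -> \bar R, measurable_fun (setT : set (g_sigma_algebraType C)) h ->
  (forall w, (0 <= h w)%E) ->
  (\int[P]_w (g w * h w) = \int[P]_w (f w * h w))%E.
Proof.
move=> Cm mg mf g0 f0 gf h mh h0.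
have sCm : <<s C >> `<=` measurable.
  exact: (smallest_sub (@sigma_algebra_measurable _ T) Cm).
pose h_ := nnsfun_approx (measurableT : measurable (setT : set (g_sigma_algebraType C))) mh.
have hC n r : <<s C >> ((h_ n : T -> R) @^-1` [set r]).
  have := @measurable_funP _ _ _ _ setT (h_ n) measurableT [set r] (measurable_set1 r).
  by rewrite setTI.
have mhn n : measurable_fun (setT : set T) (h_ n : T -> R).
  move=> _ B mB; apply: sCm.
  exact: (@measurable_funP _ _ _ _ setT (h_ n) measurableT B mB).
have ndh w n m : (n <= m)%N -> h_ n w <= h_ m w.
  by move=> nm; exact/lefP/nd_nnsfun_approx.
have cvh w : (h_ n w)%:E @[n --> \oo] --> h w.
  by apply: cvg_nnsfun_approx.
have key (u : T -> \bar R) : measurable_fun setT u -> (forall w, (0 <= u w)%E) ->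
    (\int[P]_w (u w * h w) = limn (fun n => \int[P]_w (u w * (h_ n w)%:E)))%E.
  move=> mu u0; rewrite -monotone_convergence//.
  - apply: eq_integral => w _; apply/esym/cvg_lim => //.
    have := u0 w; case: (u w) => [r _|_|//]; first exact: cvgeZl.
    have := h0 w; rewrite le_eqVlt => /predU1P[hw|hw].
      rewrite -hw mule0.
      have -> : (fun n => +oo * (h_ n w)%:E)%E = cst 0%E; last exact: cvg_cst.
      apply/funext => n; suff -> : h_ n w = 0 by rewrite mule0.
      apply/eqP; rewrite eq_le fun_ge0 andbT -lee_fin.
      have -> : 0%:E = h w by rewrite -hw.
      apply: (cvge_to_ge (cvh w)); exists n => // m /= nm.
      by rewrite lee_fin ndh.
    rewrite gt0_mulye//; apply: (@cvg_near_cst) => //.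
    have [n hn] : exists n, (0 < (h_ n w)%:E)%E.
      apply: contrapT => /forallNP H; suff : (h w <= 0)%E by rewrite leNgt hw.
      apply: (cvge_to_le (cvh w)); apply: nearW => n; rewrite leNgt; exact/negP.
    exists n => // m /= nm; rewrite gt0_mulye//; apply: lt_le_trans hn _.
    by rewrite lee_fin ndh.
  - move=> n; apply: emeasurable_funM => //; exact/measurable_EFinP.
  - by move=> n w _; rewrite mule_ge0// lee_fin.
  - by move=> w _ a b ab; rewrite lee_wpmul2l// lee_fin ndh.
rewrite key// key//; congr (limn _); apply/funext => n.
have keyn (u : T -> \bar R) : measurable_fun setT u -> (forall w, (0 <= u w)%E) ->
    (\int[P]_w (u w * (h_ n w)%:E) =
     \sum_(r \in range (h_ n)) (r%:E * \int[P]_(w in h_ n @^-1` [set r]) u w))%E.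
  move=> mu u0.
  have mA r : measurable ((h_ n : T -> R) @^-1` [set r]) by apply: sCm; exact: hC.
  under eq_integral => w _.
    rewrite fimfunE -fsumEFin// ge0_mule_fsumr; last first.
      by move=> r; rewrite EFinM nnfun_muleindic_ge0.
    over.
  rewrite ge0_integral_fsum//; last 2 first.
  - move=> r; apply: emeasurable_funM => //; apply/measurable_EFinP.
    by apply: measurable_funM => //; exact: measurable_indic.
  - by move=> r w _; rewrite mule_ge0// EFinM nnfun_muleindic_ge0.
  apply: eq_fsbigr => r /[!inE]/= -[x _ <-].
  under eq_integral do rewrite EFinM muleCA.
  rewrite ge0_integralZl//.
  - by congr (_ * _)%E; rewrite [RHS]integral_mkcond epatch_indic.
  - by apply: emeasurable_funM => //; apply/measurable_EFinP; exact: measurable_indic.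
  - by move=> w _; rewrite mule_ge0// lee_fin.
  - by rewrite lee_fin.
rewrite keyn// keyn//; apply: eq_fsbigr => r _; congr (_ * _)%E.
exact: gf.
Qed.

Section environment.
Context d (T : measurableType d) (R : realType) (P : probability T R).
Variable xi : nat -> {RV P >-> (R * R)%type}.

Definition past n : set (set T) :=
  \bigcup_(i in `I_n) preimage_set_system setT (xi i) measurable.

Definition env_events : set (set T) :=
  \bigcup_i preimage_set_system setT (xi i) measurable.

Lemma past_measurable n : past n `<=` measurable.
Proof. by move=> A [i _ [B mB <-]]; exact: (measurable_funP (xi i)). Qed.

Lemma env_events_measurable : env_events `<=` measurable.
Proof. by move=> A [i _ [B mB <-]]; exact: (measurable_funP (xi i)). Qed.

Lemma past_sub n : past n `<=` env_events.
Proof. by move=> A [i _ H]; exists i. Qed.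

Lemma past_mono n m : (n <= m)%N -> past n `<=` past m.
Proof. by move=> nm A [i /= ni H]; exists i => //=; exact: leq_trans nm. Qed.

Lemma xi_past i n : (i < n)%N ->
  measurable_fun (setT : set (g_sigma_algebraType (past n))) (xi i).
Proof.
move=> ni _ B mB; rewrite setTI; apply: sub_sigma_algebra.
by exists i => //; exists B => //; rewrite setTI.
Qed.

Lemma xi_env i : measurable_fun (setT : set (g_sigma_algebraType env_events)) (xi i).
Proof.
move=> _ B mB; rewrite setTI; apply: sub_sigma_algebra.
by exists i => //; exists B => //; rewrite setTI.
Qed.

Lemma past_env d' (T' : measurableType d') n (f : T -> T') :
  measurable_fun (setT : set (g_sigma_algebraType (past n))) f ->
  measurable_fun (setT : set (g_sigma_algebraType env_events)) f.
Proof.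
move=> mf _ B mB; have := mf measurableT B mB.
by rewrite !setTI; apply: sub_sigma_algebra2; exact: past_sub.
Qed.

Lemma env_meas d' (T' : measurableType d') (f : T -> T') :
  measurable_fun (setT : set (g_sigma_algebraType env_events)) f ->
  measurable_fun (setT : set T) f.
Proof.
move=> mf _ B mB; have := mf measurableT B mB.
by apply: (smallest_sub (@sigma_algebra_measurable _ T)); exact: env_events_measurable.
Qed.

Hypothesis xi_iid : iid xi.

(** Both sides are finite measures in A that agree on the finite intersections of events
    of the individual environments, a pi-system that generates the past. *)
Lemma past_indep n A B : <<s past n >> A -> measurable B ->
  P (A `&` xi n @^-1` B) = (P A * P (xi n @^-1` B))%E.
Proof.
move=> sA mB; have [_ prodP] := xi_iid.
have mC : measurable (xi n @^-1` B).
  by rewrite -[X in measurable X]setTI; exact: (measurable_funP (xi n)).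
pose Dn : set (set T) := [set A | exists2 U : nat -> set (R * R),
  (forall i, measurable (U i)) & A = \bigcap_(i in [set` iota 0 n]) (xi i @^-1` U i)].
have mDn : Dn `<=` measurable.
  move=> _ [U mU ->]; apply: fin_bigcap_measurable => // i _.
  by rewrite -[X in measurable X]setTI; exact: (measurable_funP (xi i)).
have DnT : Dn setT.
  exists (fun=> setT) => //; apply/seteqP; split => // w _ i _ //.
have Pfin : P (xi n @^-1` B) \is a fin_num by exact: fin_num_measure.
pose q := NngNum (fine_ge0 (measure_ge0 P (xi n @^-1` B))).
pose m1 := mrestr P mC.
pose m2 := mscale q P.
have m2E D : m2 D = (P (xi n @^-1` B) * P D)%E.
  by rewrite /m2 /mscale; congr (_ * _)%E; rewrite -[RHS]fineK.
have := @g_sigma_algebra_measure_unique _ _ _ Dn mDn (fun=> setT) (fun=> DnT) _ m1 m2.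
move=> H; have : m1 A = m2 A.
  apply: H.
  - by rewrite bigcup_const.
  - move=> _ _ [U mU ->] [V mV ->]; exists (fun i => U i `&` V i).
      by move=> i; exact: measurableI.
    by rewrite -bigcapI; apply: eq_bigcapr.
  - move=> _ [U mU ->]; rewrite -[RHS]/(m2 _) m2E -[LHS]/(m1 _) /m1 /mrestr.
    pose U' i := if i == n then B else U i.
    have mU' i : measurable (U' i) by rewrite /U'; case: ifP.
    have := prodP (iota 0 n.+1) U' (iota_uniq _ _) mU'.
    have := prodP (iota 0 n) U (iota_uniq _ _) mU.
    rewrite -addn1 iotaD add0n big_cat/= big_seq1 => -> E.
    have E1 : (\prod_(i <- iota 0 n) P (xi i @^-1` U' i) = \prod_(i <- iota 0 n) P (xi i @^-1` U i))%E.
      apply: eq_big_seq => i; rewrite mem_iota add0n /U' => /andP[_ ni].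
      by rewrite ltn_eqF.
    rewrite E1 /U' eqxx muleC in E; rewrite -E; congr (P _).
    apply/seteqP; split => [w [/= H1 H2] i|w H].
      rewrite /= mem_cat inE mem_iota add0n => /orP[/andP[_ ni]|/eqP ->].
        by rewrite ltn_eqF//; apply: H1; rewrite /= mem_iota add0n.
      by rewrite eqxx.
    split; last by have := H n; rewrite /= mem_cat inE eqxx orbT => /(_ isT).
    move=> i /= ini; have := H i; rewrite /= mem_cat ini => /(_ isT).
    by move: ini; rewrite mem_iota add0n => /andP[_ ni]; rewrite ltn_eqF.
  - move=> _; rewrite -[X in (X < _)%E]/(m1 setT) /m1 /mrestr setTI.
    by rewrite ltey_eq fin_num_measure.
  - apply: sub_sigma_algebra2 sA => _ [i /= ni [V mV <-]].
    exists (fun j => if j == i then V else setT); first by move=> j; case: ifP.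
    rewrite setTI; apply/seteqP; split => [w /= Hw j _ /=|w Hw].
      by case: eqP => [->|].
    by have := Hw i; rewrite /= mem_iota add0n ni eqxx => /(_ isT).
by rewrite -[X in X = _]/(m1 _) -[X in _ = X]/(m2 _) m2E /m1 /mrestr muleC.
Qed.

Lemma past_indep_integral n (f : T -> \bar R) (psi : R * R -> \bar R) :
  measurable_fun (setT : set (g_sigma_algebraType (past n))) f ->
  (forall w, (0 <= f w)%E) ->
  measurable_fun setT psi -> (forall x, (0 <= psi x)%E) ->
  (\int[P]_w (f w * psi (xi n w)) = \int[P]_w f w * \int[P]_w psi (xi 0 w))%E.
Proof.
move=> mf f0 mpsi psi0.
have mf' := env_meas (past_env mf).
have mxi i : measurable_fun setT (xi i) by exact: measurable_funP.
have -> : (\int[P]_w psi (xi 0%N w) = \int[P]_w psi (xi n w))%E.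
  have E := (@ge0_integral_distribution _ _ _ _ _ P (xi 0%N) psi mpsi psi0).
  have E' := (@ge0_integral_distribution _ _ _ _ _ P (xi n) psi mpsi psi0).
  rewrite -[LHS]E -[RHS]E'; apply: eq_measure_integral => A mA _.
  by have [H _] := xi_iid; exact/esym/H.
have I0 : (0 <= \int[P]_w f w)%E by exact: integral_ge0.
pose C := preimage_set_system setT (xi n) measurable.
have Cm : C `<=` measurable by move=> A [B mB <-]; exact: mxi.
have sC A : <<s C >> A -> exists2 B, measurable B & A = xi n @^-1` B.
  rewrite /C sigma_algebra_id; last first.
    by apply: sigma_algebra_preimage; exact: sigma_algebra_measurable.
  by move=> [B mB <-]; exists B => //; rewrite setTI.
have step1 B : measurable B ->
    (\int[P]_(w in xi n @^-1` B) f w = P (xi n @^-1` B) * \int[P]_w f w)%E.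
  move=> mB; have mC : measurable (xi n @^-1` B) by rewrite -[X in measurable X]setTI; exact: mxi.
  have := @sub_ext _ T R P (past n) (EFin \o \1_(xi n @^-1` B)) (fun=> P (xi n @^-1` B)).
  move=> /(_ (@past_measurable n)) H.
  rewrite integral_mkcond epatch_indic.
  under eq_integral do rewrite muleC.
  rewrite H//.
  - by rewrite ge0_integralZl.
  - by apply/measurable_EFinP; exact: measurable_indic.
  - by move=> w; rewrite lee_fin.
  - move=> A sA; have mA : measurable A.
      exact: (smallest_sub (@sigma_algebra_measurable _ T) (@past_measurable n)).
    transitivity (P (xi n @^-1` B `&` A)); first exact: integral_indic.
    by rewrite setIC integral_cst// (past_indep sA mB) muleC.
rewrite (@sub_ext _ T R P C f (fun=> (\int[P]_w f w)%E))//.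
- rewrite ge0_integralZl//; exact: measurableT_comp.
- move=> A /sC[B mB ->]; rewrite (step1 _ mB) [RHS]integral_cst; first exact: muleC.
  by rewrite -[X in measurable X]setTI; exact: mxi.
- apply: measurableT_comp => //.
  move=> _ B mB; rewrite setTI; apply: sub_sigma_algebra.
  by exists B => //; rewrite setTI.
Qed.

End environment.

(** * Generations given the environment *)

Section series_operator.
Context (R : realType).
Implicit Types (a : nat -> R) (f g : nat -> \bar R).

(** The mean of f at the sum of y independent variables of probability mass function
    a.  The recursion on y gives a sense to it for every f with values in [0, +oo],
    without any construction of random variables. *)
Fixpoint sum_law a (y : nat) f : \bar R :=
  if y is y'.+1 then (\sum_(0 <= k <oo) (a k)%:E * sum_law a y' (fun s => f (k + s)%N))%E
  else f 0%N.

Lemma sum_law_ge0 a y f : (forall k, 0 <= a k) -> (forall s, (0 <= f s)%E) ->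
  (0 <= sum_law a y f)%E.
Proof.
move=> a0; elim: y f => [|y IH] f f0 //=.
by apply: nneseries_ge0 => k _ _; rewrite mule_ge0 ?lee_fin// IH.
Qed.

Lemma sum_law_le a y f g : (forall k, 0 <= a k) -> (forall s, (0 <= f s)%E) ->
  (forall s, (f s <= g s)%E) -> (sum_law a y f <= sum_law a y g)%E.
Proof.
move=> a0; elim: y f g => [|y IH] f g f0 fg //=.
apply: lee_nneseries => k _; first by rewrite mule_ge0 ?lee_fin// sum_law_ge0.
by rewrite lee_wpmul2l ?lee_fin// IH.
Qed.

Lemma sum_lawZ a y f (c : \bar R) : (forall k, 0 <= a k) -> (0 <= c)%E ->
  (forall s, (0 <= f s)%E) ->
  sum_law a y (fun s => c * f s)%E = (c * sum_law a y f)%E.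
Proof.
move=> a0 c0; elim: y f => [|y IH] f f0 //=.
rewrite -nneseriesZe//; last by move=> k; rewrite mule_ge0 ?lee_fin// sum_law_ge0.
by apply: eq_eseriesr => k _; rewrite IH// muleCA.
Qed.

Lemma sum_law_series a y (F : nat -> nat -> \bar R) : (forall k, 0 <= a k) ->
  (forall j s, (0 <= F j s)%E) ->
  sum_law a y (fun s => \sum_(0 <= j <oo) F j s)%E =
  (\sum_(0 <= j <oo) sum_law a y (F j))%E.
Proof.
move=> a0; elim: y F => [|y IH] F F0 //=.
rewrite nneseries_interchange; last first.
  by move=> j k; rewrite mule_ge0 ?lee_fin// sum_law_ge0.
apply: eq_eseriesr => k _; rewrite IH// nneseriesZl// => i _.
exact: sum_law_ge0.
Qed.

Lemma sum_lawD a y f g : (forall k, 0 <= a k) -> (forall s, (0 <= f s)%E) ->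
  (forall s, (0 <= g s)%E) ->
  sum_law a y (fun s => f s + g s)%E = (sum_law a y f + sum_law a y g)%E.
Proof.
move=> a0; elim: y f g => [|y IH] f g f0 g0 //=.
rewrite -nneseriesD//; try by move=> k _; rewrite mule_ge0 ?lee_fin// sum_law_ge0.
by apply: eq_eseriesr => k _; rewrite IH// ge0_muleDr// sum_law_ge0.
Qed.

Definition dirac_fun (m : nat) (s : nat) : \bar R := ((s == m)%:R)%:E.

Lemma dirac_fun_ge0 m s : (0 <= dirac_fun m s)%E.
Proof. by rewrite lee_fin. Qed.

Lemma dirac_expand f s : (\sum_(0 <= m <oo) dirac_fun m s * f m)%E = f s.
Proof.
rewrite (@eseries_single _ _ s) ?/dirac_fun ?eqxx ?mul1e// => k ks.
by rewrite eq_sym (negbTE ks) mul0e.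
Qed.

(** It reduces the measurability and the integration of [sum_law] for functions that depend
    on the environment to those of countably many probabilities. *)
Lemma sum_law_expand a y f : (forall k, 0 <= a k) -> (forall s, (0 <= f s)%E) ->
  sum_law a y f = (\sum_(0 <= m <oo) sum_law a y (dirac_fun m) * f m)%E.
Proof.
move=> a0 f0.
have -> : f = (fun s => \sum_(0 <= m <oo) dirac_fun m s * f m)%E.
  by apply/funext => s; rewrite dirac_expand.
rewrite sum_law_series//; last by move=> j s; rewrite mule_ge0 ?dirac_fun_ge0.
apply: eq_eseriesr => m _; rewrite dirac_expand.
under eq_fun do rewrite muleC.
rewrite sum_lawZ//; first exact: muleC.
by move=> s; exact: dirac_fun_ge0.
Qed.

End series_operator.

Lemma measurable_proj (R : realType) (l : bool) :
  measurable_fun setT (fun x : R * R => if l then x.2 else x.1).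
Proof. by case: l; [exact: measurable_snd|exact: measurable_fst]. Qed.

Section quenched.
Context d (T : measurableType d) (R : realType) (P : probability T R).
Variable xi : nat -> {RV P >-> (R * R)%type}.
Variable p : R.-pker R ~> nat.
Variable X : bool -> nat -> nat -> {RV P >-> nat}.
Local Notation Tenv := (g_sigma_algebraType (env_events xi)).
Local Notation pmf := (offspring_pmf p).
Local Notation idx := (bool * nat * nat)%type.

Lemma pmf_ge0 x k : 0 <= pmf x k. Proof. exact: fine_ge0. Qed.

Lemma measurable_pmf k : measurable_fun setT (fun x => pmf x k).
Proof.
apply: (@measurableT_comp _ _ _ _ _ _ fine) => //; exact: measurable_kernel.
Qed.

Lemma pmf_sum1 x : (\sum_(0 <= k <oo) (pmf x k)%:E = 1)%E.
Proof.
have E k : (pmf x k)%:E = p x [set k].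
  rewrite fineK// ge0_fin_numE//; apply: (@le_lt_trans _ _ (p x setT)).
    by apply: le_measure; rewrite ?inE.
  by rewrite prob_kernel ltry.
under eq_eseriesr do rewrite E.
transitivity (p x (\bigcup_n [set n])).
  rewrite measure_bigcup//.
    by apply: eq_eseriesl => i; rewrite in_setT.
  apply/trivIsetP => i j _ _ ij; apply/seteqP; split => // y [/= -> /eqP].
  by rewrite (negbTE ij).
rewrite (_ : \bigcup_n [set n] = setT) ?prob_kernel//.
by apply/seteqP; split => // k _; exists k.
Qed.

Lemma measurable_env l n :
  measurable_fun (setT : set (g_sigma_algebraType (past xi n.+1))) (env xi l n).
Proof.
rewrite /env; case: l.
  by apply: measurableT_comp => //; exact: xi_past.
by apply: measurableT_comp => //; exact: xi_past.
Qed.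

Lemma measurable_env' l n : measurable_fun (setT : set Tenv) (env xi l n).
Proof.
rewrite /env; case: l.
  by apply: measurableT_comp => //; exact: xi_env.
by apply: measurableT_comp => //; exact: xi_env.
Qed.

Definition cyl (s : seq idx) (k : idx -> nat) : set T :=
  \bigcap_(t in [set` s]) (X t.1.1 t.1.2 t.2 @^-1` [set k t]).

Definition cyl_pmf (s : seq idx) (k : idx -> nat) (w : T) : R :=
  \prod_(t <- s) pmf (env xi t.1.1 t.1.2 w) (k t).

Lemma measurable_X l n i (k : nat) : measurable (X l n i @^-1` [set k]).
Proof.
by rewrite -[X in measurable X]setTI; exact: (measurable_funP (X l n i)).
Qed.

Lemma measurable_cyl s k : measurable (cyl s k).
Proof. by apply: fin_bigcap_measurable => // t _; exact: measurable_X. Qed.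

Lemma measurable_cyl_pmf s k : measurable_fun (setT : set Tenv) (cyl_pmf s k).
Proof.
rewrite /cyl_pmf; elim: s => [|t s IH].
  by under eq_fun do rewrite big_nil; exact: measurable_cst.
under eq_fun do rewrite big_cons; apply: measurable_funM => //.
exact: (measurableT_comp (measurable_pmf _) (measurable_env' _ _)).
Qed.

Lemma cyl_pmf_ge0 s k w : 0 <= cyl_pmf s k w.
Proof. by apply: prodr_ge0 => t _; exact: pmf_ge0. Qed.

(** g' is the conditional mean of g given the environment and, given the environment,
    g is independent of the offspring numbers whose index is outside D. *)
Definition quenched_mean (D : set idx) (g g' : T -> \bar R) : Prop :=
  [/\ measurable_fun setT g, forall w, (0 <= g w)%E,
      measurable_fun (setT : set Tenv) g', forall w, (0 <= g' w)%E &
   forall s k h, uniq s -> (forall t, t \in s -> ~ D t) ->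
     measurable_fun (setT : set Tenv) h -> (forall w, (0 <= h w)%E) ->
     (\int[P]_w (g w * (\1_(cyl s k) w)%:E * h w) =
      \int[P]_w (g' w * (cyl_pmf s k w)%:E * h w))%E].

Hypothesis X_law : offspring_given_env xi p X.

(** With no factor g this is the conditional law of the offspring numbers, extended
    from environment events to environment functions. *)
Lemma quenched_mean1 D : quenched_mean D (fun=> 1%E) (fun=> 1%E).
Proof.
split => // s k h us _ mh h0.
under eq_integral do rewrite mul1e.
under [RHS]eq_integral do rewrite mul1e.
have [mf fP] := X_law k us.
apply: (@sub_ext _ T R P (env_events xi)) => //.
- exact: env_events_measurable.
- exact: (measurable_EFin_indic (measurable_cyl s k)).
- by apply/measurable_EFinP; exact: (env_meas (measurable_cyl_pmf s k)).
- by move=> w; rewrite lee_fin cyl_pmf_ge0.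
- move=> A sA; rewrite -(fP A sA) setIC.
  apply: integral_indic; last exact: measurable_cyl.
  exact: (smallest_sub (@sigma_algebra_measurable _ T) (@env_events_measurable _ _ _ _ xi)).
Qed.

Lemma quenched_mean_sub (D D' : set idx) g g' : D `<=` D' ->
  quenched_mean D g g' -> quenched_mean D' g g'.
Proof.
move=> DD' [mg g0 mg' g0' H]; split => // s k h us sD; apply: H => // t ts Dt.
exact: (sD t ts (DD' t Dt)).
Qed.

Lemma quenched_meanZ D g g' (c : \bar R) : (0 <= c)%E ->
  quenched_mean D g g' -> quenched_mean D (fun w => c * g w)%E (fun w => c * g' w)%E.
Proof.
move=> c0 [mg g0 mg' g0' H]; split.
- exact: measurable_funeM.
- by move=> w; rewrite mule_ge0.
- exact: measurable_funeM.
- by move=> w; rewrite mule_ge0.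
- move=> s k h us sD mh h0.
  have mh' := env_meas mh.
  have mi := measurable_EFin_indic (R := R) (measurable_cyl s k).
  have mc : measurable_fun setT (fun w => (cyl_pmf s k w)%:E).
    by apply/measurable_EFinP; exact: (env_meas (measurable_cyl_pmf s k)).
  have key (u v : T -> \bar R) : measurable_fun setT u -> measurable_fun setT v ->
      (forall w, (0 <= u w)%E) -> (forall w, (0 <= v w)%E) ->
      (\int[P]_w (c * u w * v w * h w) = c * \int[P]_w (u w * v w * h w))%E.
    move=> mu mv u0 v0; rewrite -ge0_integralZl//.
    - by apply: eq_integral => w _; rewrite !muleA.
    - by apply: emeasurable_funM => //; exact: emeasurable_funM.
    - by move=> w _; rewrite !mule_ge0.
  rewrite (key g)//.
  rewrite (key g')//; last 2 first.
  + exact: env_meas mg'.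
  + by move=> w; rewrite lee_fin cyl_pmf_ge0.
  by rewrite H.
Qed.

Lemma quenched_mean_series D (g g' : nat -> T -> \bar R) :
  (forall i, quenched_mean D (g i) (g' i)) ->
  quenched_mean D (fun w => \sum_(0 <= i <oo) g i w)%E (fun w => \sum_(0 <= i <oo) g' i w)%E.
Proof.
move=> H.
have g0 i w : (0 <= g i w)%E by case: (H i).
have g0' i w : (0 <= g' i w)%E by case: (H i).
split.
- by apply: ge0_emeasurable_sum => // k _; case: (H k).
- by move=> w; apply: nneseries_ge0.
- by apply: ge0_emeasurable_sum => // k _; case: (H k).
- by move=> w; apply: nneseries_ge0.
- move=> s k h us sD mh h0; have mh' := env_meas mh.
  have key (u : nat -> T -> \bar R) (v : T -> \bar R) : (forall i, measurable_fun setT (u i)) ->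
      measurable_fun setT v ->
      (forall i w, (0 <= u i w)%E) -> (forall w, (0 <= v w)%E) ->
      (\int[P]_w ((\sum_(0 <= i <oo) u i w) * v w * h w) =
       \sum_(0 <= i <oo) \int[P]_w (u i w * v w * h w))%E.
    move=> mu mv u0 v0; rewrite -integral_nneseries//.
    - apply: eq_integral => w _; rewrite -muleA muleC -nneseriesZe//; last by rewrite mule_ge0.
      by apply: eq_eseriesr => i _; rewrite muleC muleA.
    - by move=> n; apply: emeasurable_funM => //; exact: emeasurable_funM.
    - by move=> n w _; rewrite !mule_ge0.
  rewrite key; last 4 first.
  + by move=> i; case: (H i).
  + exact: (measurable_EFin_indic (measurable_cyl s k)).
  + by [].
  + by move=> w; rewrite lee_fin.
  rewrite key; last 4 first.
  + by move=> i; have [_ _ h' _ _] := H i; exact: (env_meas h').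
  + by apply/measurable_EFinP; exact: (env_meas (measurable_cyl_pmf s k)).
  + by [].
  + by move=> w; rewrite lee_fin cyl_pmf_ge0.
  by apply: eq_eseriesr => i _; case: (H i) => _ _ _ _; apply.
Qed.

(** Observing one more offspring number enlarges the cylinder by one index. *)
Lemma quenched_mean_obs D g g' (t : idx) (m : nat) : ~ D t -> quenched_mean D g g' ->
  quenched_mean (D `|` [set t]) (fun w => g w * dirac_fun R m (X t.1.1 t.1.2 t.2 w))%E
    (fun w => g' w * (pmf (env xi t.1.1 t.1.2 w) m)%:E)%E.
Proof.
move=> Dt [mg g0 mg' g0' H].
have mpm : measurable_fun (setT : set Tenv) (fun w => pmf (env xi t.1.1 t.1.2 w) m).
  exact: (measurableT_comp (measurable_pmf _) (measurable_env' _ _)).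
have dE w : dirac_fun R m (X t.1.1 t.1.2 t.2 w) = (\1_(X t.1.1 t.1.2 t.2 @^-1` [set m]) w)%:E.
  rewrite /dirac_fun indicE; congr (_%:E); congr (_%:R).
  by congr nat_of_bool; apply/eqP/idP; rewrite inE.
split.
- apply: emeasurable_funM => //; under eq_fun do rewrite dE.
  exact: (measurable_EFin_indic (measurable_X _ _ _ _)).
- by move=> w; rewrite mule_ge0// dirac_fun_ge0.
- by apply: emeasurable_funM => //; exact/measurable_EFinP.
- by move=> w; rewrite mule_ge0// lee_fin pmf_ge0.
move=> s k h us sD mh h0.
have ts : t \notin s.
  by apply/negP => ts; apply: (sD t ts); right.
pose k' u := if u == t then m else k u.
have k's u : u \in s -> k' u = k u.
  by move=> us'; rewrite /k'; case: eqP => // ut; rewrite -ut us' in ts.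
have := H (t :: s) k' h; rewrite /= ts us => /(_ isT) H'.
transitivity (\int[P]_w (g w * (\1_(cyl (t :: s) k') w)%:E * h w))%E.
  apply: eq_integral => w _; congr (_ * _)%E; rewrite -muleA; congr (_ * _)%E.
  rewrite dE -EFinM; congr (_%:E); rewrite !indicE -natrM mulnb; congr (_%:R); congr nat_of_bool.
  apply/andP/idP; rewrite !inE /cyl.
    move=> [/= tm H1] u; rewrite /= inE /k' => /predU1P[->|us'].
      by rewrite eqxx.
    by rewrite -/(k' u) k's//; exact: H1.
  move=> H1; split.
    by have := H1 t; rewrite /= inE eqxx => /(_ isT); rewrite /k' eqxx.
  by move=> u /= us'; have := H1 u; rewrite /= inE us' orbT => /(_ isT); rewrite k's.
rewrite H'//.
- apply: eq_integral => w _; congr (_ * _)%E; rewrite -muleA; congr (_ * _)%E.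
  rewrite /cyl_pmf big_cons EFinM /k' eqxx; congr (_ * (_%:E))%E.
  by apply: eq_big_seq => u us'; rewrite -/(k' u) k's.
- by move=> u; rewrite inE => /predU1P[->//|us'] Du; apply: (sD u us'); left.
Qed.

Definition psum (l : bool) (n y : nat) (w : T) : nat := (\sum_(i < y) X l n i w)%N.

(** Induction on y: conditioning on the value of the last of the offspring numbers turns the
    recursion of [sum_law] into [quenched_mean_obs] and a countable sum. *)
Lemma quenched_mean_psum D g g' l n : quenched_mean D g g' ->
  (forall i, ~ D (l, n, i)) -> forall y f, (forall s, (0 <= f s)%E) ->
  quenched_mean (D `|` [set t | t.1 = (l, n) /\ (t.2 < y)%N])
    (fun w => g w * f (psum l n y w))%E
    (fun w => g' w * sum_law (pmf (env xi l n w)) y f)%E.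
Proof.
move=> H nD; elim => [|y IH] f f0.
  have := quenched_meanZ (f0 0%N) H.
  move=> /(@quenched_mean_sub D (D `|` [set t | t.1 = (l, n) /\ (t.2 < 0)%N])).
  move=> /(_ (@subsetUl _ _ _)); congr quenched_mean.
    by apply/funext => w; rewrite /psum big_ord0 muleC.
  by apply/funext => w /=; rewrite muleC.
have K k := IH (fun s => f (k + s)%N) (fun s => f0 (k + s)%N).
have nD' : ~ (D `|` [set t | t.1 = (l, n) /\ (t.2 < y)%N]) (l, n, y).
  by move=> [/nD//|/= []]; rewrite ltnn.
have := quenched_mean_series (fun k => quenched_mean_obs k nD' (K k)).
move/(@quenched_mean_sub _ (D `|` [set t | t.1 = (l, n) /\ (t.2 < y.+1)%N])).
have sub : (D `|` [set t | t.1 = (l, n) /\ (t.2 < y)%N]) `|` [set (l, n, y)] `<=`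
   D `|` [set t | t.1 = (l, n) /\ (t.2 < y.+1)%N].
  move=> u [[Du|[u1 u2]]|->]; [by left|right|right] => /=; split => //.
  exact: ltnW.
move=> /(_ sub); congr quenched_mean.
- apply/funext => w /=; rewrite (@eseries_single _ _ (X l n y w)); last first.
    by move=> k kX; rewrite /dirac_fun eq_sym (negbTE kX) mule0.
  by rewrite /dirac_fun eqxx mule1 /psum big_ord_recr/= addnC.
- apply/funext => w /=; rewrite -nneseriesZe; last 2 first.
  + by case: H.
  + by move=> k; rewrite mule_ge0 ?lee_fin ?pmf_ge0// sum_law_ge0// => ?; exact: pmf_ge0.
  by apply: eq_eseriesr => k _; rewrite -muleA [(sum_law _ _ _ * _)%E]muleC.
Qed.

(** The conditional probability of [Z l n = z] given the environment, computed by the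
    Chapman-Kolmogorov recursion. *)
Fixpoint qlaw (l : bool) (n : nat) (z : nat) (w : T) : \bar R :=
  if n is n'.+1 then
    (\sum_(0 <= y <oo) qlaw l n' y w * sum_law (pmf (env xi l n' w)) y (dirac_fun R z))%E
  else dirac_fun R z 1%N.

Definition gens (l : bool) (n : nat) : set idx := [set t | t.1.1 = l /\ (t.1.2 < n)%N].

Lemma quenched_mean_Zpsum l n z f : (forall s, (0 <= f s)%E) ->
  quenched_mean (gens l n) (fun w => dirac_fun R z (Z X l n w)) (qlaw l n z) ->
  quenched_mean (gens l n.+1)
   (fun w => dirac_fun R z (Z X l n w) * f (psum l n z w))%E
   (fun w => qlaw l n z w * sum_law (pmf (env xi l n w)) z f)%E.
Proof.
move=> f0 H; have nD i : ~ gens l n (l, n, i) by move=> [_ /=]; rewrite ltnn.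
apply: quenched_mean_sub (quenched_mean_psum H nD z f0).
by move=> [[t1 t2] t3] [[/= -> tn]|[/= [-> ->] _]]; split => //=; exact: ltnW.
Qed.

(** The generation n + 1 is a sum over the value y of generation n, and on that event the
    population is a sum of y offspring numbers of a generation that is not yet used. *)
Lemma quenched_mean_Z l n z :
  quenched_mean (gens l n) (fun w => dirac_fun R z (Z X l n w)) (qlaw l n z).
Proof.
elim: n z => [|n IH] z.
  have := quenched_meanZ (dirac_fun_ge0 R z 1) (quenched_mean1 (gens l 0)).
  by congr quenched_mean; apply/funext => w; rewrite /= mule1.
have := quenched_mean_series (fun y => quenched_mean_Zpsum (dirac_fun_ge0 R z) (IH y)).
congr quenched_mean; apply/funext => w /=.
rewrite (@eseries_single _ _ (Z X l n w)); first by rewrite /dirac_fun eqxx mul1e.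
by move=> k kX; rewrite /dirac_fun eq_sym (negbTE kX) mul0e.
Qed.

Lemma quenched_mean_integral D g g' h : quenched_mean D g g' ->
  measurable_fun (setT : set Tenv) h -> (forall w, (0 <= h w)%E) ->
  (\int[P]_w (g w * h w) = \int[P]_w (g' w * h w))%E.
Proof.
move=> [_ _ _ _ H] mh h0; have := H [::] (fun=> 0%N) h isT.
move=> /(_ (fun t (ht : t \in [::]) => False_ind _ (notF ht))) /(_ mh h0) E.
transitivity (\int[P]_w (g w * (\1_(cyl [::] (fun=> 0%N)) w)%:E * h w))%E.
  apply: eq_integral => w _; rewrite indicE mem_set ?mule1//.
transitivity (\int[P]_w (g' w * (cyl_pmf [::] (fun=> 0%N) w)%:E * h w))%E => //.
by apply: eq_integral => w _; rewrite /cyl_pmf big_nil mule1.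
Qed.

Lemma qlaw_ge0 l n z w : (0 <= qlaw l n z w)%E.
Proof. by have [_ _ _ + _] := quenched_mean_Z l n z; apply. Qed.

Lemma measurable_sum_law y f : (forall s, (0 <= f s)%E) ->
  measurable_fun setT (fun x => sum_law (pmf x) y f).
Proof.
elim: y f => [|y IH] f f0 /=; first exact: measurable_cst.
apply: ge0_emeasurable_sum => [k x _ _|k _].
  by rewrite mule_ge0 ?lee_fin ?pmf_ge0// sum_law_ge0// => ?; exact: pmf_ge0.
apply: emeasurable_funM; last exact: IH.
by apply/measurable_EFinP; exact: measurable_pmf.
Qed.

Lemma measurable_sum_law_dep (y : nat) (F : nat -> R -> \bar R) :
  (forall s x, (0 <= F s x)%E) -> (forall s, measurable_fun setT (F s)) ->
  measurable_fun setT (fun x => sum_law (pmf x) y (fun s => F s x)).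
Proof.
move=> F0 mF; under eq_fun => x do rewrite (sum_law_expand _ (pmf_ge0 x) (F0^~ x)).
apply: ge0_emeasurable_sum => [k x _ _|k _].
  by rewrite mule_ge0// sum_law_ge0// => ?; [exact: pmf_ge0|exact: dirac_fun_ge0].
by apply: emeasurable_funM => //; apply: measurable_sum_law => s; exact: dirac_fun_ge0.
Qed.

(** The law of generation n depends on the first n environments only, so that it is
    independent of the n-th one; this is what factorises [markov_le]. *)
Lemma qlaw_past l n z : measurable_fun (setT : set (g_sigma_algebraType (past xi n))) (qlaw l n z).
Proof.
elim: n z => [|n IH] z /=; first exact: measurable_cst.
have mono d' (T' : measurableType d') (f : T -> T') :
    measurable_fun (setT : set (g_sigma_algebraType (past xi n))) f ->
    measurable_fun (setT : set (g_sigma_algebraType (past xi n.+1))) f.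
  move=> mf _ B mB; have := mf measurableT B mB.
  by rewrite !setTI; apply: sub_sigma_algebra2; apply: past_mono.
apply: ge0_emeasurable_sum => [y w _ _|y _].
  rewrite mule_ge0 ?qlaw_ge0// sum_law_ge0// => ?; [exact: pmf_ge0|exact: dirac_fun_ge0].
apply: emeasurable_funM; first exact: mono (IH y).
have mm := measurable_sum_law y (dirac_fun_ge0 R z).
exact: (measurableT_comp mm (@measurable_env l n)).
Qed.

Lemma qlaw_env l n z : measurable_fun (setT : set Tenv) (qlaw l n z).
Proof. by have [_ _ ? _ _] := quenched_mean_Z l n z. Qed.

Lemma law_integral l n (phi : nat -> \bar R) (h : T -> \bar R) : (forall z, (0 <= phi z)%E) ->
  measurable_fun (setT : set Tenv) h -> (forall w, (0 <= h w)%E) ->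
  (\int[P]_w (phi (Z X l n w) * h w) =
   \sum_(0 <= z <oo) \int[P]_w (qlaw l n z w * (phi z * h w)))%E.
Proof.
move=> phi0 mh h0; have mh' := env_meas mh.
transitivity (\sum_(0 <= z <oo) \int[P]_w (dirac_fun R z (Z X l n w) * (phi z * h w)))%E.
  rewrite -integral_nneseries//; last 2 first.
  - move=> z; apply: emeasurable_funM; last exact: measurable_funeM.
    by have [? _ _ _ _] := quenched_mean_Z l n z.
  - by move=> z w _; rewrite !mule_ge0// dirac_fun_ge0.
  apply: eq_integral => w _; rewrite (@eseries_single _ _ (Z X l n w)).
    by rewrite /dirac_fun eqxx mul1e.
  by move=> k kX; rewrite /dirac_fun eq_sym (negbTE kX) mul0e.
apply: eq_eseriesr => z _; apply: (quenched_mean_integral (quenched_mean_Z l n z)).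
  exact: measurable_funeM.
by move=> w; rewrite mule_ge0.
Qed.

(** The Markov property given the environment. *)
Lemma markov_env l n (F : nat -> nat -> T -> \bar R) : (forall z z' w, (0 <= F z z' w)%E) ->
  (forall z z', measurable_fun (setT : set Tenv) (F z z')) ->
  (\int[P]_w F (Z X l n w) (Z X l n.+1 w) w =
   \sum_(0 <= z <oo) \int[P]_w (qlaw l n z w *
      sum_law (pmf (env xi l n w)) z (fun z' => F z z' w)))%E.
Proof.
move=> F0 mF; have mF' z z' := env_meas (mF z z').
have QM z z' := quenched_mean_Zpsum (dirac_fun_ge0 R z') (quenched_mean_Z l n z).
have m1 z z' : measurable_fun setT (fun w => dirac_fun R z (Z X l n w) * dirac_fun R z' (psum l n z w) * F z z' w)%E.
  by apply: emeasurable_funM => //; have [? _ _ _ _] := QM z z'.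
have p1 z z' w : (0 <= dirac_fun R z (Z X l n w) * dirac_fun R z' (psum l n z w) * F z z' w)%E.
  by rewrite !mule_ge0// dirac_fun_ge0.
have p2 z z' w : (0 <= sum_law (pmf (env xi l n w)) z (dirac_fun R z'))%E.
  by rewrite sum_law_ge0// => ?; [exact: pmf_ge0|exact: dirac_fun_ge0].
transitivity (\sum_(0 <= z <oo) \sum_(0 <= z' <oo)
   \int[P]_w (dirac_fun R z (Z X l n w) * dirac_fun R z' (psum l n z w) * F z z' w))%E.
  under eq_eseriesr => z _.
    rewrite -integral_nneseries//.
    over.
  rewrite -integral_nneseries//; last 2 first.
  - by move=> z; apply: ge0_emeasurable_sum.
  - by move=> z w _; apply: nneseries_ge0.
  apply: eq_integral => w _.
  rewrite (@eseries_single _ _ (Z X l n w)); last first.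
    move=> k kX; rewrite eseries0// => i _ _.
    by rewrite /dirac_fun eq_sym (negbTE kX) !mul0e.
  rewrite (@eseries_single _ _ (Z X l n.+1 w)).
    by rewrite /dirac_fun /= /psum !eqxx !mul1e.
  move=> k kX; have -> : dirac_fun R k (psum l n (Z X l n w) w) = 0%E.
    by rewrite /dirac_fun eq_sym (negbTE kX).
  by rewrite mule0 mul0e.
apply: eq_eseriesr => z _.
transitivity (\sum_(0 <= z' <oo)
   \int[P]_w (qlaw l n z w * sum_law (pmf (env xi l n w)) z (dirac_fun R z') * F z z' w))%E.
  by apply: eq_eseriesr => z' _; apply: (quenched_mean_integral (QM z z')).
rewrite -integral_nneseries//; last 2 first.
- move=> z'; apply: emeasurable_funM => //; have [_ _ h _ _] := QM z z'.
  exact: env_meas h.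
- by move=> z' w _; rewrite !mule_ge0// qlaw_ge0.
apply: eq_integral => w _.
rewrite [in RHS]sum_law_expand//; last exact: pmf_ge0.
rewrite -nneseriesZe ?qlaw_ge0//; last by move=> z'; rewrite mule_ge0.
by apply: eq_eseriesr => z' _; rewrite muleA.
Qed.

Hypothesis xi_iid : iid xi.

(** Given the environment, generation n + 1 is a sum of offspring numbers, and the
    environment n is independent of generation n; a bound of the conditional mean that
    separates the two therefore separates the integrals. *)
Lemma markov_le l n (F : nat -> nat -> R -> \bar R) (phi : nat -> \bar R) (psi : R -> \bar R) :
  (forall z z' x, (0 <= F z z' x)%E) -> (forall z z', measurable_fun setT (F z z')) ->
  (forall z, (0 <= phi z)%E) -> (forall x, (0 <= psi x)%E) -> measurable_fun setT psi ->
  {ae P, forall w, forall z, (sum_law (pmf (env xi l n w)) z (fun z' => F z z' (env xi l n w))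
     <= phi z * psi (env xi l n w))%E} ->
  (\int[P]_w F (Z X l n w) (Z X l n.+1 w) (env xi l n w) <=
   (\int[P]_w phi (Z X l n w)) * \int[P]_w psi (env xi l 0 w))%E.
Proof.
move=> F0 mF phi0 psi0 mpsi H.
rewrite (@markov_env l n (fun z z' w => F z z' (env xi l n w)))//; last first.
  by move=> z z'; exact: (measurableT_comp (mF z z') (measurable_env' l n)).
have qm z := env_meas (qlaw_env l n z).
have me : measurable_fun setT (env xi l n) := env_meas (measurable_env' l n).
have E : (\int[P]_w phi (Z X l n w) = \sum_(0 <= z <oo) phi z * \int[P]_w qlaw l n z w)%E.
  have := @law_integral l n phi (fun=> 1%E) phi0 => /(_ _ _) L.
  transitivity (\int[P]_w (phi (Z X l n w) * 1))%E; first by apply: eq_integral => w _; rewrite mule1.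
  rewrite L//; apply: eq_eseriesr => z _.
  under eq_integral do rewrite mule1 muleC.
  by rewrite ge0_integralZl// => w _; exact: qlaw_ge0.
have psiI : (0 <= \int[P]_w psi (env xi l 0 w))%E by apply: integral_ge0.
rewrite E muleC -nneseriesZe//; last first.
  by move=> z; rewrite mule_ge0// integral_ge0// => w _; exact: qlaw_ge0.
apply: lee_nneseries => z _.
  move=> _; apply: integral_ge0 => w _; rewrite mule_ge0 ?qlaw_ge0//.
  by rewrite sum_law_ge0// => ?; exact: pmf_ge0.
apply: (@le_trans _ _ (\int[P]_w (phi z * (qlaw l n z w * psi (env xi l n w))))%E).
  apply: ae_ge0_le_integral => //.
  - move=> w _; rewrite mule_ge0 ?qlaw_ge0// sum_law_ge0// => ?; exact: pmf_ge0.
  - apply: emeasurable_funM => //.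
    apply: (@measurableT_comp _ _ _ _ _ _ (fun x => sum_law (pmf x) z (fun z' => F z z' x)) _ (env xi l n)) => //.
    exact: measurable_sum_law_dep.
  - by move=> w _; rewrite !mule_ge0// qlaw_ge0.
  - apply: measurable_funeM; apply: emeasurable_funM => //; exact: measurableT_comp.
  - by apply: filterS H => w Hw _; rewrite muleCA lee_wpmul2l ?qlaw_ge0.
rewrite ge0_integralZl//; last 2 first.
- by apply: emeasurable_funM => //; exact: measurableT_comp.
- by move=> w _; rewrite mule_ge0// qlaw_ge0.
rewrite [leRHS]muleCA lee_wpmul2l//.
pose pr (x : R * R) : R := if l then x.2 else x.1.
have mpr : measurable_fun setT pr := @measurable_proj R l.
have := @past_indep_integral _ T R P xi xi_iid n (qlaw l n z) (psi \o pr).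
rewrite /= => ->//.
- by rewrite muleC.
- exact: qlaw_past.
- by move=> w; exact: qlaw_ge0.
- exact: measurableT_comp.
Qed.

End quenched.

(** * Estimates for one generation *)

Lemma prob_le_integral d (T : measurableType d) (R : realType) (P : probability T R)
  (A : set T) (f : T -> \bar R) : measurable A -> measurable_fun setT f ->
  (forall w, (0 <= f w)%E) -> {ae P, forall w, A w -> (1 <= f w)%E} ->
  (P A <= \int[P]_w f w)%E.
Proof.
move=> mA mf f0 H.
have -> : P A = (\int[P]_w (\1_A w)%:E)%E by rewrite integral_indic// setIT.
apply: ae_ge0_le_integral => //.
- exact: measurable_EFin_indic.
- apply: filterS H => w Hw _; rewrite indicE.
  by case: (boolP (w \in A)) => [|_]; [rewrite inE => /Hw|rewrite f0].
Qed.

Section sum_law_bounds.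
Context (R : realType) (a : nat -> R).
Hypothesis a0 : forall k, 0 <= a k.
Hypothesis a1 : (\sum_(0 <= k <oo) (a k)%:E = 1)%E.

Lemma sum_law_cst y (c : \bar R) : (0 <= c)%E -> sum_law a y (fun=> c) = c.
Proof.
move=> c0; elim: y => [|y IH] //=.
under eq_eseriesr do rewrite IH muleC.
by rewrite nneseriesZe ?a1 ?mule1// => i; rewrite lee_fin.
Qed.

(** Wald's identity for a fixed number of terms. *)
Lemma sum_law_mean y :
  sum_law a y (fun s => (s%:R)%:E) =
  ((y%:R)%:E * \sum_(0 <= k <oo) (k%:R * a k)%:E)%E.
Proof.
have m0 : (0 <= \sum_(0 <= k <oo) (k%:R * a k)%:E)%E.
  by apply: nneseries_ge0 => k _ _; rewrite lee_fin mulr_ge0.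
elim: y => [|y IH] /=; first by rewrite mul0e.
under eq_eseriesr => k _.
  under [X in sum_law _ _ X]eq_fun do rewrite natrD EFinD.
  rewrite sum_lawD//.
  rewrite sum_law_cst ?lee_fin// IH ge0_muleDr ?lee_fin ?mule_ge0//.
  rewrite -EFinM mulrC.
  over.
rewrite nneseriesD//; last 2 first.
- by move=> k _; rewrite lee_fin mulr_ge0.
- by move=> k _; rewrite !mule_ge0// lee_fin.
under [X in (_ + X)%E]eq_eseriesr do rewrite muleC.
rewrite nneseriesZe ?mule_ge0 ?lee_fin//.
rewrite a1 mule1 -[in RHS]natr1 EFinD ge0_muleDl ?lee_fin// mul1e addeC.
by [].
Qed.

(** The value at 0 is what makes a bound of the integral of [hinv] exclude extinction. *)
Definition hinv (z : nat) : \bar R := if z is 0%N then +oo%E else ((z%:R)^-1)%:E.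

Lemma hinv_ge0 z : (0 <= hinv z)%E.
Proof. by case: z => [|z] //=; rewrite lee_fin invr_ge0. Qed.

Lemma hinv_gt0 z : (0 < hinv z)%E.
Proof. by case: z => [|z] //=; rewrite lte_fin invr_gt0. Qed.

(** Convexity of the inverse: 1 / (k + s) <= p^2 / k + q^2 / s when p + q = 1, here with
    the weights 1 / (z + 1) and z / (z + 1) that are optimal for s = z k. *)
Lemma hinv_add (z k s : nat) : (0 < z)%N ->
  (hinv (k + s) <= (((z.+1%:R ^+ 2)^-1)%:E * hinv k + ((z%:R / z.+1%:R) ^+ 2)%:E * hinv s))%E.
Proof.
move=> z0; have z0' : 0 < z%:R :> R by rewrite ltr0n.
have cs0 : (0 <= ((z%:R / z.+1%:R : R) ^+ 2)%:E * hinv s)%E.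
  by rewrite mule_ge0 ?hinv_ge0// lee_fin sqr_ge0.
case: k => [|k].
  rewrite [hinv 0]/= gt0_muley ?lte_fin ?invr_gt0 ?exprn_gt0//.
  by rewrite addye ?leey// gt_eqF// (lt_le_trans _ cs0)// ltNyr.
clear cs0; case: s => [|s].
  by rewrite /= gt0_muley ?lte_fin ?exprn_gt0 ?divr_gt0// addey ?leey.
rewrite addSn /= -!EFinM -EFinD lee_fin -addSn natrD.
have k0 : 0 < k.+1%:R :> R by rewrite ltr0n.
have s0 : 0 < s.+1%:R :> R by rewrite ltr0n.
rewrite -(natr1 z); move: (z%:R : R) z0' (k.+1%:R : R) k0 (s.+1%:R : R) s0 => u u0 x x0 y y0.
rewrite -subr_ge0.
have -> : ((u + 1) ^+ 2)^-1 / x + (u / (u + 1)) ^+ 2 / y - (x + y)^-1 =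
   (y - u * x) ^+ 2 / ((u + 1) ^+ 2 * x * y * (x + y)).
  by field; rewrite !gt_eqF//; lra.
by rewrite divr_ge0 ?sqr_ge0// !mulr_ge0 ?sqr_ge0 ?ltW//; lra.
Qed.

Lemma sum_lawS y f : sum_law a y.+1 f =
  (\sum_(0 <= k <oo) (a k)%:E * sum_law a y (fun s => f (k + s)%N))%E.
Proof. by []. Qed.

(** With y terms the harmonic moment is divided by y, as for the harmonic mean; the
    weights of [hinv_add] turn the factor 1 / y into 1 / (y + 1). *)
Lemma sum_law_hinv y : (sum_law a y hinv <= hinv y * \sum_(0 <= k <oo) (a k)%:E * hinv k)%E.
Proof.
set r := (\sum_(0 <= k <oo) (a k)%:E * hinv k)%E.
have t0 k : (0 <= (a k)%:E * hinv k)%E by rewrite mule_ge0 ?lee_fin// hinv_ge0.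
have r0 : (0 <= r)%E by apply: nneseries_ge0.
have rp : (0 < r)%E.
  rewrite lt_def r0 andbT; apply/eqP => rz.
  have az k : a k = 0.
    have : ((a k)%:E * hinv k <= r)%E.
      apply: le_trans (nneseries_lim_ge k.+1 _) => //.
      by rewrite big_nat_recr//= leeDr// sume_ge0.
    rewrite rz => h; have /eqP : ((a k)%:E * hinv k = 0)%E by apply/eqP; rewrite eq_le h t0.
    by rewrite mule_eq0 (gt_eqF (hinv_gt0 k)) orbF => /eqP[].
  by move: a1; rewrite eseries0 => [/eqP|k _ _]; rewrite ?az// eqe eq_sym oner_eq0.
case: y => [|y]; first by rewrite /= gt0_mulye// leey.
elim: y => [|y IH].
  rewrite [leLHS]/=; apply: le_trans (_ : r <= _)%E.
    by under eq_eseriesr do rewrite /= addn0.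
  by rewrite /= invr1 mul1e.
rewrite sum_lawS.
set A := ((y.+2%:R ^+ 2)^-1 : R); set B := ((y.+1%:R / y.+2%:R) ^+ 2 : R).
have A0 : 0 <= A by rewrite invr_ge0 sqr_ge0.
have B0 : 0 <= B by rewrite sqr_ge0.
set Q := sum_law a y.+1 hinv in IH.
have Q0 : (0 <= Q)%E by apply: sum_law_ge0 => // z; exact: hinv_ge0.
apply: (@le_trans _ _ (\sum_(0 <= k <oo) (A%:E * ((a k)%:E * hinv k) + B%:E * Q * (a k)%:E))%E).
  apply: lee_nneseries => k _.
    move=> _; rewrite mule_ge0 ?lee_fin//.
    by apply: (@sum_law_ge0 _ a y.+1) => // s; exact: hinv_ge0.
  rewrite muleCA [X in (_ + X)%E]muleC -ge0_muleDr ?mule_ge0 ?lee_fin ?hinv_ge0//.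
  apply: lee_wpmul2l; first by rewrite lee_fin.
  apply: (@le_trans _ _ (sum_law a y.+1 (fun s => A%:E * hinv k + B%:E * hinv s)%E)).
    apply: (@sum_law_le _ a y.+1) => // s; first exact: hinv_ge0.
    exact: hinv_add.
  rewrite sum_lawD//; last 2 first.
  - by move=> s; rewrite mule_ge0 ?lee_fin ?hinv_ge0.
  - by move=> s; rewrite mule_ge0 ?lee_fin ?hinv_ge0.
  rewrite sum_law_cst ?mule_ge0 ?lee_fin ?hinv_ge0// sum_lawZ ?lee_fin//.
  exact: hinv_ge0.
rewrite nneseriesD//; last 2 first.
- by move=> k _; rewrite mule_ge0 ?lee_fin.
- by move=> k _; rewrite !mule_ge0 ?lee_fin.
rewrite nneseriesZe ?lee_fin// -/r nneseriesZe ?mule_ge0 ?lee_fin//.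
rewrite a1 mule1.
apply: (@le_trans _ _ (A%:E * r + B%:E * (hinv y.+1 * r)))%E.
  by rewrite leeD2l// lee_wpmul2l// lee_fin.
rewrite muleA -ge0_muleDl ?mule_ge0 ?lee_fin ?invr_ge0//.
rewrite lee_wpmul2r// /= -EFinM -EFinD lee_fin /A /B -(natr1 y.+1).
have : 0 < y.+1%:R :> R by rewrite ltr0n.
move: (y.+1%:R : R) => u u0; rewrite le_eqVlt; apply/orP; left; apply/eqP.
by field; rewrite !gt_eqF//; lra.
Qed.

Lemma sum_law_exp (b c : R) y : 0 <= b ->
  (\sum_(0 <= k <oo) (a k * b ^+ k)%:E <= c%:E)%E ->
  (sum_law a y (fun s => (b ^+ s)%:E) <= (c ^+ y)%:E)%E.
Proof.
move=> b0 H.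
have c0 : 0 <= c.
  by rewrite -lee_fin; apply: le_trans H; apply: nneseries_ge0 => k _ _; rewrite lee_fin mulr_ge0// exprn_ge0.
elim: y => [|y IH]; first by rewrite /= expr0.
rewrite sum_lawS; under eq_eseriesr => k _.
  under [X in sum_law _ _ X]eq_fun do rewrite exprD EFinM.
  rewrite sum_lawZ ?lee_fin ?exprn_ge0//; last by move=> s; rewrite lee_fin exprn_ge0.
  rewrite muleA -EFinM muleC.
  over.
have h0 s : (0 <= (b ^+ s)%:E)%E by rewrite lee_fin exprn_ge0.
rewrite nneseriesZe ?sum_law_ge0//; last by move=> k; rewrite lee_fin mulr_ge0// exprn_ge0.
rewrite exprSr EFinM; apply: lee_pmul => //; first by rewrite sum_law_ge0.
by apply: nneseries_ge0 => k _ _; rewrite lee_fin mulr_ge0// exprn_ge0.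
Qed.

(** For x <= 1 it follows from 1 / (1 + x) <= 1 - x + x^2, beyond from x <= x^q. *)
Lemma expRN_le_pow (q x : R) : 1 < q <= 2 -> 0 <= x -> expR (- x) <= 1 - x + x `^ q.
Proof.
move=> /andP[q1 q2] x0.
have [x1|x1] := leP x 1; last first.
  have : x <= x `^ q by rewrite -[leLHS]powRr1// ler_powR// ltW.
  have : expR (- x) <= 1 by rewrite -expR0 ler_expR oppr_le0.
  by lra.
have H : x ^+ 2 <= x `^ q.
  have [->|xn0] := eqVneq x 0; first by rewrite expr0n/= powR_ge0.
  by rewrite -powR_mulrn// ger_powR// lt_def xn0 x0.
have E : expR (- x) * (1 + x) <= 1.
  apply: (@le_trans _ _ (expR (- x) * expR x)); last by rewrite -expRD addNr expR0.
  by rewrite ler_wpM2l ?expR_ge0// expR_ge1Dx.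
have D : 0 < 1 + x by lra.
apply: (@le_trans _ _ (1 - x + x ^+ 2)); last by rewrite lerD2l.
rewrite -(ler_pM2r D); apply: le_trans E _.
have -> : (1 - x + x ^+ 2) * (1 + x) = 1 + x ^+ 3 by ring.
by rewrite lerDl exprn_ge0.
Qed.

Variables (m q : R).
Hypotheses (m0 : 0 < m) (am : (\sum_(0 <= k <oo) (k%:R * a k)%:E = m%:E)%E).
Hypothesis q12 : 1 < q <= 2.

Definition rel_moment : \bar R := (\sum_(0 <= k <oo) (a k * (k%:R / m) `^ q)%:E)%E.

(** Averaging [expRN_le_pow]; a moment of order q > 1 replaces the variance. *)
Lemma laplace_le (s v : R) : 0 <= s -> rel_moment = v%:E ->
  (\sum_(0 <= k <oo) (a k * expR (- (s / m)) ^+ k)%:E <= (expR (- s + s `^ q * v))%:E)%E.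
Proof.
move=> s0 vE; set L := (\sum_(0 <= k <oo) _)%E.
have L0 k : (0 <= (a k * expR (- (s / m)) ^+ k)%:E)%E.
  by rewrite lee_fin mulr_ge0// exprn_ge0// expR_ge0.
have H : (L + s%:E <= 1 + (s `^ q * v)%:E)%E.
  have -> : (s%:E = \sum_(0 <= k <oo) (s / m)%:E * (k%:R * a k)%:E)%E.
    rewrite nneseriesZl; last by move=> k _; rewrite lee_fin mulr_ge0.
    by rewrite am -EFinM divfK// gt_eqF.
  have -> : ((s `^ q * v)%:E = \sum_(0 <= k <oo) (s `^ q)%:E * (a k * (k%:R / m) `^ q)%:E)%E.
    rewrite nneseriesZl; last by move=> k _; rewrite lee_fin mulr_ge0// powR_ge0.
    by rewrite -/rel_moment vE EFinM.
  rewrite -a1 -!nneseriesD//; try by [move=> k _; rewrite lee_fin|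
    move=> k _; rewrite -EFinM lee_fin !mulr_ge0 ?invr_ge0 ?powR_ge0// ltW].
  apply: lee_nneseries => k _.
    by move=> _; rewrite adde_ge0// -EFinM lee_fin !mulr_ge0// invr_ge0 ltW.
  rewrite -!EFinM -!EFinD lee_fin -expRM_natl.
  have -> : s / m * (k%:R * a k) = a k * (s * (k%:R / m)) by ring.
  have -> : s `^ q * (a k * (k%:R / m) `^ q) = a k * (s * (k%:R / m)) `^ q.
    by rewrite mulrCA -powRM// divr_ge0// ltW.
  have -> : k%:R * - (s / m) = - (s * (k%:R / m)) by ring.
  have := expRN_le_pow q12 (_ : 0 <= s * (k%:R / m)) => /(_ _)/wrap[].
    by rewrite mulr_ge0// divr_ge0// ltW.
  move=> h; apply: (@le_trans _ _ (a k * (expR (- (s * (k%:R / m))) + s * (k%:R / m)))).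
    by rewrite mulrDr.
  rewrite -{2}(mulr1 (a k)) -[leRHS]mulrDr ler_wpM2l//.
  by move: h; lra.
have Lf : L \is a fin_num.
  rewrite ge0_fin_numE ?nneseries_ge0//.
  rewrite ltey; apply/eqP => E; move: H; by rewrite E addye.
move: H; rewrite -(fineK Lf) -!EFinD !lee_fin => H.
by apply: le_trans (expR_ge1Dx _); lra.
Qed.

Definition hpow (al : R) (z : nat) : \bar R :=
  if z is 0%N then +oo%E else (z%:R `^ (- al))%:E.

Lemma hpow_gt0 al z : (0 < hpow al z)%E.
Proof. by case: z => [|z] //=; rewrite lte_fin powR_gt0. Qed.

(** If A > 1 + v, then exp (v - A) <= 1 / (1 + A - v) <= (1 + v) / A. *)
Lemma min_exp_le (v A : R) : 0 <= v -> 0 < A ->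
  Num.min 1 (expR (v - A)) <= (1 + v) / A.
Proof.
move=> v0 A0; rewrite ge_min; have [h|h] := leP A (1 + v).
  by rewrite ler_pdivlMr ?mul1r// h.
apply/orP; right.
have E : expR (v - A) * (1 + (A - v)) <= 1.
  apply: (@le_trans _ _ (expR (v - A) * expR (A - v))).
    by rewrite ler_wpM2l ?expR_ge0// expR_ge1Dx.
  by rewrite -expRD addrC subrKA subrr expR0.
rewrite ler_pdivlMr//; have := expR_gt0 (v - A); move: (expR (v - A)) E => e E e0.
nra.
Qed.

(** Chernoff's bound for a population of z individuals at the slope s / m with
    s = z^(-1/q): the q-th moment then contributes a bounded factor exp v, while the
    deviation contributes exp (- (1 - ka) z^(1 - 1/q)).  The polynomial form
    given by [min_exp_le] is linear in the moment, so that it can be integrated over the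
    environment. *)
Lemma low_offspring (ka : R) z : 0 < ka < 1 ->
  (sum_law a z (fun z' => ((z'%:R <= ka * m * z%:R :> R)%R%:R)%:E) <=
   hpow (1 - q^-1) z * (((1 - ka)^-1)%:E * (1 + rel_moment)))%E.
Proof.
move=> /andP[ka0 ka1].
have v0 : (0 <= rel_moment)%E.
  by apply: nneseries_ge0 => k _ _; rewrite lee_fin mulr_ge0// powR_ge0.
have ki : 0 < (1 - ka)^-1 by rewrite invr_gt0 subr_gt0.
case: z => [|z].
  rewrite gt0_mulye ?leey// mule_gt0 ?lte_fin//.
  by rewrite (lt_le_trans lte01)// leeDl.
case vE : rel_moment v0 => [v| |]// v0; last first.
  by rewrite addey// !gt0_muley ?hpow_gt0 ?lte_fin ?leey.
rewrite lee_fin in v0.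
move: z => z1; set z := z1.+1; have z0 : 0 < z%:R :> R by rewrite ltr0n.
have qp : 0 < q by case/andP: q12 => h _; lra.
(* the slope for which s^q z = 1 *)
pose s := z%:R `^ (- q^-1).
have s0 : 0 < s by rewrite powR_gt0.
have sq : s `^ q * z%:R = 1.
  rewrite /s -powRrM mulNr mulVf ?gt_eqF// powR_inv1 ?ltW// mulVf// gt_eqF//.
have zs : z%:R * s = z%:R `^ (1 - q^-1).
  by rewrite powRD ?powRr1 ?ltW//; apply/implyP => _; rewrite gt_eqF.
pose A := (1 - ka) * z%:R `^ (1 - q^-1).
have A0 : 0 < A by rewrite mulr_gt0 ?subr_gt0 ?powR_gt0.
have i0 (z' : nat) : (0 <= ((z'%:R <= ka * m * z%:R :> R)%:R : R)%:E)%E by rewrite lee_fin.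
apply: (@le_trans _ _ (Num.min 1 (expR (v - A)))%:E).
  rewrite EFin_min le_min; apply/andP; split.
    rewrite -[leRHS](sum_law_cst z) ?lee01//; apply: sum_law_le => // k.
    by rewrite lee_fin; case: (k%:R <= ka * m * z%:R).
  apply: (@le_trans _ _ ((expR (s * ka * z%:R))%:E * sum_law a z (fun z' => (expR (- (s / m)) ^+ z')%:E))%E).
    rewrite -sum_lawZ ?lee_fin ?expR_ge0//.
    apply: sum_law_le => // k; rewrite -EFinM lee_fin.
    case: (leP k%:R (ka * m * z%:R)) => [h|_]; last by rewrite mulr_ge0 ?exprn_ge0 ?expR_ge0.
    rewrite -expRM_natl -expRD -[leLHS](@expR0 R) ler_expR.
    have -> : s * ka * z%:R + k%:R * - (s / m) = s / m * (ka * m * z%:R - k%:R).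
      by field; rewrite gt_eqF.
    by rewrite mulr_ge0 ?subr_ge0// divr_ge0 ?ltW.
  apply: (@le_trans _ _ ((expR (s * ka * z%:R))%:E * (expR (- s + s `^ q * v) ^+ z)%:E)%E).
    rewrite lee_wpmul2l ?lee_fin ?expR_ge0// sum_law_exp ?expR_ge0//.
    exact: (laplace_le (ltW s0) vE).
  rewrite -EFinM lee_fin -expRM_natl -expRD ler_expR /A -zs.
  have -> : s * ka * z%:R + z%:R * (- s + s `^ q * v) = (s `^ q * z%:R) * v - (1 - ka) * (z%:R * s).
    by ring.
  by rewrite sq mul1r.
rewrite -!EFinD -!EFinM lee_fin; apply: le_trans (min_exp_le v0 A0) _.
rewrite /A powRN invfM le_eqVlt; apply/orP; left; apply/eqP.
by rewrite [LHS]mulrC -mulrA mulrCA.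
Qed.

End sum_law_bounds.

(** * Exponential tails of the normalised population *)

Lemma measurable_gt d (T : measurableType d) (R : realType) (f : T -> R) (t : R) :
  measurable_fun setT f -> measurable [set w | t < f w].
Proof.
move=> mf; have -> : [set w | t < f w] = setT `&` f @^-1` `]t, +oo[%classic.
  by rewrite setTI; apply/seteqP; split => w /=; rewrite in_itv/= andbT.
exact: mf.
Qed.

Lemma measurable_ge d (T : measurableType d) (R : realType) (f : T -> R) (t : R) :
  measurable_fun setT f -> measurable [set w | t <= f w].
Proof.
move=> mf; have -> : [set w | t <= f w] = setT `&` f @^-1` `[t, +oo[%classic.
  by rewrite setTI; apply/seteqP; split => w /=; rewrite in_itv/= andbT.
exact: mf.
Qed.

Lemma integral_prob1 d (T : measurableType d) (R : realType) (P : probability T R) :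
  (\int[P]_w cst 1%E w = 1)%E.
Proof. by rewrite integral_cst// mul1e; exact: probability_setT. Qed.

Section branching_tails.
Context d (T : measurableType d) (R : realType) (P : probability T R).
Variable xi : nat -> {RV P >-> (R * R)%type}.
Variable p : R.-pker R ~> nat.
Variable X : bool -> nat -> nat -> {RV P >-> nat}.
Variable l : bool.
Local Notation Tenv := (g_sigma_algebraType (env_events xi)).
Local Notation pmf := (offspring_pmf p).
Local Notation M n := (M_ xi p l n).
Local Notation Zn := (Z X l).

(** On such environments the offspring mean is a real number, at least 1, and nobody
    dies childless; so M is nonnegative and the population does not decrease. *)
Definition good (x : R) : Prop := (mean_law p x < +oo)%E /\ pmf x 0 = 0.

Definition log_mean (x : R) : R := ln (fine (mean_law p x)).

Lemma measurable_mean_law : measurable_fun setT (mean_law p).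
Proof.
apply: ge0_emeasurable_sum => [k x _ _|k _].
  by rewrite lee_fin mulr_ge0// pmf_ge0.
by apply/measurable_EFinP; apply: measurable_funM => //; exact: measurable_pmf.
Qed.

Lemma measurable_log_mean : measurable_fun setT log_mean.
Proof.
apply: measurableT_comp; first exact: measurable_ln.
by apply: measurableT_comp measurable_mean_law; exact: fine_measurable.
Qed.

Lemma measurable_good : measurable [set x | good x].
Proof.
have -> : [set x | good x] =
    ~` (mean_law p @^-1` [set +oo%E]) `&` ((fun x => pmf x 0) @^-1` [set 0]).
  by apply/seteqP; split => x /=; rewrite /good ltey; [move=> [/eqP]|move=> [/eqP]].
apply: measurableI.
  apply: measurableC; rewrite -[X in measurable X]setTI.
  by apply: measurable_mean_law => //; exact: emeasurable_set1.
rewrite -[X in measurable X]setTI.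
by apply: measurable_pmf.
Qed.

Lemma measurable_M n : measurable_fun (setT : set (g_sigma_algebraType (past xi n.+1))) (M n).
Proof.
have mm := measurable_log_mean.
exact: (measurableT_comp mm (@measurable_env _ _ _ _ xi l n)).
Qed.

Lemma good_mean x : good x ->
  [/\ mean_law p x = (fine (mean_law p x))%:E, 1 <= fine (mean_law p x),
      0 <= log_mean x & expR (log_mean x) = fine (mean_law p x)].
Proof.
move=> [moo p0].
have m1 : (1 <= mean_law p x)%E.
  rewrite -(pmf_sum1 p x); apply: lee_nneseries => k _; first by rewrite lee_fin pmf_ge0.
  rewrite lee_fin; case: k => [|k]; first by rewrite p0 mulr0.
  by rewrite ler_peMl ?pmf_ge0// ler1n.
have mf : mean_law p x \is a fin_num.
  by rewrite ge0_fin_numE// (le_trans _ m1).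
have m1' : 1 <= fine (mean_law p x) by rewrite -lee_fin fineK.
split => //; first by rewrite fineK.
- exact: ln_ge0.
- by rewrite lnK// posrE (lt_le_trans _ m1').
Qed.

Hypothesis xi_iid : iid xi.
Hypothesis X_law : offspring_given_env xi p X.
Hypothesis good_env0 : {ae P, forall w, good (env xi l 0 w)}.

Lemma env_distribution n (B : set R) : measurable B ->
  P (env xi l n @^-1` B) = P (env xi l 0 @^-1` B).
Proof.
move=> mB; have [H _] := xi_iid.
pose pr (x : R * R) := if l then x.2 else x.1.
have mprB : measurable (pr @^-1` B).
  by rewrite -[X in measurable X]setTI; exact: (@measurable_proj R l).
have := H n _ mprB; rewrite /distribution /= /pushforward.
by [].
Qed.

Lemma good_env : {ae P, forall w, forall n, good (env xi l n w)}.
Proof.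
apply: ae_foralln => n.
have me k : measurable (env xi l k @^-1` ~` [set x | good x]).
  rewrite -[X in measurable X]setTI.
  apply: (env_meas (@measurable_env' _ _ _ _ xi l k)) => //.
  by apply: measurableC; exact: measurable_good.
exists (env xi l n @^-1` ~` [set x | good x]); split => //.
apply: etrans (env_distribution n (measurableC measurable_good)) _.
by apply: measure_negligible.
Qed.

Definition S_ n (w : T) : R := \sum_(i < n) M i w.

Lemma measurable_S n : measurable_fun (setT : set (g_sigma_algebraType (past xi n))) (S_ n).
Proof.
rewrite /S_; apply: measurable_sum => i; move=> mT B mB; have := @measurable_M i measurableT _ mB.
apply: sub_sigma_algebra2; exact: (past_mono (ltn_ord i)).
Qed.

Lemma measurable_Senv n : measurable_fun (setT : set Tenv) (S_ n).
Proof. by have := @measurable_S n; apply: past_env. Qed.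

Lemma measurable_ST n : measurable_fun setT (S_ n).
Proof. exact: env_meas (measurable_Senv n). Qed.

Lemma measurable_Zn n : measurable_fun setT (Zn n).
Proof.
move=> _ B _; rewrite setTI.
have -> : Zn n @^-1` B = \bigcup_(z in B) (Zn n @^-1` [set z]).
  by apply/seteqP; split => w /=; [exists (Zn n w)|move=> [z zB /= ->]].
apply: bigcup_measurable => z _.
have [mg _ _ _ _] := quenched_mean_Z X_law l n z.
have -> : Zn n @^-1` [set z] = (fun w => dirac_fun R z (Zn n w)) @^-1` [set 1%E].
  apply/seteqP; split => w /=; rewrite /dirac_fun; first by move=> ->; rewrite eqxx.
  by case: eqP => // _ /eqP; rewrite eqe eq_sym oner_eq0.
by rewrite -[X in measurable X]setTI; apply: mg => //; exact: emeasurable_set1.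
Qed.

Lemma measurable_of_Z d' (T' : measurableType d') n (f : nat -> T') :
  measurable_fun setT (fun w => f (Zn n w)).
Proof. by apply: measurableT_comp (measurable_Zn n). Qed.

(** The normalised population is a martingale. *)
Lemma integral_W n : (\int[P]_w ((Zn n w)%:R * expR (- S_ n w))%:E = 1)%E.
Proof.
elim: n => [|n IH].
  under eq_integral do rewrite /S_ big_ord0 oppr0 expR0 mulr1.
  transitivity (\int[P]_w cst 1%E w)%E; first by apply: eq_integral.
  exact: integral_prob1.
have mE k : measurable_fun (setT : set Tenv) (fun w => (expR (- S_ k w))%:E).
  apply/measurable_EFinP; apply: measurableT_comp => //.
  exact: measurableT_comp (measurable_Senv k).
have E0 k w : (0 <= (expR (- S_ k w))%:E)%E by rewrite lee_fin expR_ge0.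
rewrite -[RHS]IH.
transitivity (\int[P]_w ((Zn n.+1 w)%:R%:E * (expR (- S_ n.+1 w))%:E)%E)%E.
  by apply: eq_integral => w _; rewrite EFinM.
rewrite (markov_env X_law l n (F := fun z z' w => (z'%:R%:E * (expR (- S_ n.+1 w))%:E)%E))//; last first.
  by move=> z z'; exact: measurable_funeM.
transitivity (\int[P]_w ((Zn n w)%:R%:E * (expR (- S_ n w))%:E)%E)%E; last first.
  by apply: eq_integral => w _; rewrite EFinM.
rewrite (law_integral X_law l n (phi := fun z => z%:R%:E))//; last first.
apply: eq_eseriesr => z _; have qm := env_meas (qlaw_env X_law l n z).
apply: ge0_ae_eq_integral => //.
- apply: emeasurable_funM => //.
  under eq_fun do under [X in sum_law _ _ X]eq_fun do rewrite muleC.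
  have H w : sum_law (pmf (env xi l n w)) z (fun z' => (expR (- S_ n.+1 w))%:E * z'%:R%:E)%E
    = ((expR (- S_ n.+1 w))%:E * sum_law (pmf (env xi l n w)) z (fun z' => z'%:R%:E))%E.
    by rewrite sum_lawZ// => k; exact: pmf_ge0.
  under eq_fun do rewrite H.
  have mE1 := env_meas (mE n.+1).
  apply: emeasurable_funM => //.
  have ms : measurable_fun setT (fun x => sum_law (pmf x) z (fun z' => z'%:R%:E)).
    exact: measurable_sum_law.
  have me := env_meas (@measurable_env' _ _ _ _ xi l n).
  exact: (measurableT_comp ms me).
- apply: emeasurable_funM => //.
  by have mE1 := env_meas (mE n); exact: measurable_funeM.
- move=> w _; apply: mule_ge0; first exact: (qlaw_ge0 X_law).
  by apply: sum_law_ge0 => k; [exact: pmf_ge0|rewrite mule_ge0// lee_fin].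
- by move=> w _; rewrite !mule_ge0 ?(qlaw_ge0 X_law)// lee_fin.
apply: filterS good_env => w gw _; congr (_ * _)%E.
have [mE' m1 _ eM] := good_mean (gw n).
under [X in sum_law _ _ X]eq_fun do rewrite muleC.
rewrite sum_lawZ//; last by move=> k; exact: pmf_ge0.
rewrite sum_law_mean//; [|exact: pmf_ge0|exact: pmf_sum1].
rewrite -/(mean_law p _) mE' muleCA; congr (_ * _)%E.
rewrite -EFinM; congr (_%:E).
rewrite {1}/S_ big_ord_recr/= opprD expRD -mulrA -[RHS]mulr1 -/(S_ n w); congr (_ * _).
by rewrite expRN -[M_ _ _ _ _ _]/(log_mean (env xi l n w)) eM mulVf// gt_eqF// (lt_le_trans _ m1).
Qed.

Lemma tail_upper n t : 0 <= t ->
  (P [set w | (t < ln (Zn n w)%:R - S_ n w)%R] <= (expR (- t))%:E)%E.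
Proof.
move=> t0.
have mf : measurable_fun setT (fun w => ((Zn n w)%:R * expR (- S_ n w))%:E).
  apply/measurable_EFinP; apply: measurable_funM.
    exact: (measurable_of_Z n (fun z => z%:R : R)).
  by apply: measurableT_comp => //; apply: measurableT_comp => //; exact: measurable_ST.
have mg : measurable_fun setT (fun w => ln (Zn n w)%:R - S_ n w).
  apply: measurable_funB; last exact: measurable_ST.
  exact: (measurable_of_Z n (fun z => ln z%:R : R)).
apply: (@le_trans _ _ (\int[P]_w ((expR (- t))%:E * ((Zn n w)%:R * expR (- S_ n w))%:E))%E); last first.
  rewrite ge0_integralZl ?lee_fin ?expR_ge0//.
  by rewrite integral_W mule1.
apply: prob_le_integral.
- exact: measurable_gt.
- exact: measurable_funeM.
- by move=> w; rewrite -EFinM lee_fin !mulr_ge0 ?expR_ge0.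
apply: filterS good_env => w gw /= tw.
rewrite -EFinM lee_fin.
have S0 : 0 <= S_ n w.
  by apply: sumr_ge0 => i _; have [_ _ ? _] := good_mean (gw i).
have Z0 : 0 < (Zn n w)%:R :> R.
  rewrite ltr0n lt0n; apply/eqP => Z0; move: tw; rewrite Z0 ln0//; lra.
rewrite -{1}(lnK Z0) -!expRD -[leLHS]expR0 ler_expR; lra.
Qed.

Hypothesis M_nondeg : ~ {ae P, forall w, M 0 w = 0}.

Definition single_mean : R := fine (\int[P]_w (pmf (env xi l 0 w) 1)%:E).

Lemma measurable_pmf_env n k : measurable_fun setT (fun w => pmf (env xi l n w) k).
Proof.
have me := env_meas (@measurable_env' _ _ _ _ xi l n).
exact: (measurableT_comp (measurable_pmf p k) me).
Qed.

Lemma pmf_le1 x k : pmf x k <= 1.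
Proof.
rewrite -lee_fin -(pmf_sum1 p x); apply: le_trans (nneseries_lim_ge k.+1 _) => //.
  by rewrite big_nat_recr//= leeDr// sume_ge0// => i _; rewrite lee_fin pmf_ge0.
by move=> i _; rewrite lee_fin pmf_ge0.
Qed.

Lemma single_mean_ge0 : 0 <= single_mean.
Proof. by apply: fine_ge0; apply: integral_ge0 => w _; rewrite lee_fin pmf_ge0. Qed.

Lemma single_meanE : (\int[P]_w (pmf (env xi l 0 w) 1)%:E = single_mean%:E)%E.
Proof.
rewrite fineK// ge0_fin_numE; last by apply: integral_ge0 => w _; rewrite lee_fin pmf_ge0.
apply: (@le_lt_trans _ _ (\int[P]_w cst 1%E w)%E); last first.
  by rewrite integral_prob1 ltry.
apply: ge0_le_integral => //.
- by move=> w _; rewrite lee_fin pmf_ge0.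
- by apply/measurable_EFinP; exact: measurable_pmf_env.
- by move=> w _; rewrite lee_fin pmf_le1.
Qed.

(** Otherwise every individual has exactly one child almost surely, and M vanishes. *)
Lemma single_mean_lt1 : single_mean < 1.
Proof.
rewrite ltNge; apply/negP => h; apply: M_nondeg.
have f0 w : (0 <= (1 - pmf (env xi l 0 w) 1)%:E)%E by rewrite lee_fin subr_ge0 pmf_le1.
have mf : measurable_fun setT (fun w => (1 - pmf (env xi l 0 w) 1)%:E).
  by apply/measurable_EFinP; apply: measurable_funB => //; exact: measurable_pmf_env.
have Iz : (\int[P]_w (1 - pmf (env xi l 0 w) 1)%:E = 0)%E.
  apply/eqP; rewrite eq_le integral_ge0// andbT.
  have : (\int[P]_w cst 1%E w = 1)%E.
    exact: integral_prob1.
  have -> : (\int[P]_w cst 1%E w =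
      \int[P]_w ((pmf (env xi l 0 w) 1)%:E + (1 - pmf (env xi l 0 w) 1)%:E))%E.
    by apply: eq_integral => w _; rewrite -EFinD addrC subrK.
  rewrite ge0_integralD//; last 2 first.
  - by move=> w _; rewrite lee_fin pmf_ge0.
  - by apply/measurable_EFinP; exact: measurable_pmf_env.
  rewrite single_meanE; case: (\int[P]_w _)%E => [r||]//.
  by rewrite -EFinD => -[] E; rewrite lee_fin; lra.
have := (ae_eq_integral_abs P measurableT mf).1.
under eq_integral do rewrite gee0_abs//.
move=> /(_ Iz) H; apply: filterS2 H good_env0 => w /(_ I) [] /eqP.
rewrite subr_eq0 eq_sym => /eqP p1 [_ p0].
set x := env xi l 0 w in p1 p0.
have pk k : k != 1%N -> pmf x k = 0.
  move=> k1; apply/eqP; rewrite eq_le pmf_ge0 andbT -(lerD2l 1) addr0.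
  rewrite -{1}p1 -lee_fin -(pmf_sum1 p x).
  apply: le_trans (nneseries_lim_ge (maxn 2 k.+1) _); last first.
    by move=> i _; rewrite lee_fin pmf_ge0.
  rewrite big_mkord.
  have h1 : (1 < maxn 2 k.+1)%N by rewrite leq_max.
  have hk : (k < maxn 2 k.+1)%N by rewrite leq_max ltnSn orbT.
  rewrite (bigD1 (Ordinal h1))//= (bigD1 (Ordinal hk))//= EFinD leeD2l//.
  by rewrite leeDl// sume_ge0// => i _; rewrite lee_fin pmf_ge0.
rewrite /M_ /m_ /mean_law -/x (@eseries_single _ _ 1).
  by rewrite mul1r p1 ln1.
by move=> k k1; rewrite pk ?mulr0.
Qed.

(** An individual has one child, or at least two, which halves the inverse; the bound for
    the harmonic moment of one offspring number is thus (1 + p_1) / 2. *)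
Definition hinv_rate : R := (1 + single_mean) / 2.

Lemma hinv_rate_gt0 : 0 < hinv_rate.
Proof. by rewrite /hinv_rate; have := single_mean_ge0; lra. Qed.

Lemma hinv_rate_lt1 : hinv_rate < 1.
Proof. by rewrite /hinv_rate; have := single_mean_lt1; lra. Qed.

Lemma good_hinv x : good x ->
  (\sum_(0 <= k <oo) (pmf x k)%:E * hinv R k <= ((1 + pmf x 1) / 2)%:E)%E.
Proof.
move=> [_ p0].
have d0 k c : 0 <= c -> (0 <= dirac_fun R k 1 * c%:E)%E.
  by move=> c0; rewrite mule_ge0 ?dirac_fun_ge0 ?lee_fin.
have -> : (((1 + pmf x 1) / 2)%:E = \sum_(0 <= k <oo)
    (2^-1%:E * (pmf x k)%:E + dirac_fun R k 1 * (pmf x 1 / 2)%:E))%E.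
  rewrite nneseriesD//; last 2 first.
  - by move=> k _; rewrite -EFinM lee_fin mulr_ge0// pmf_ge0.
  - by move=> k _; rewrite d0// divr_ge0// pmf_ge0.
  rewrite nneseriesZl; last by move=> k _; rewrite lee_fin pmf_ge0.
  rewrite pmf_sum1 mule1 (dirac_expand (fun=> (pmf x 1 / 2)%:E)) -EFinD.
  by congr (_%:E); rewrite mulrDl mul1r.
apply: lee_nneseries => k _.
  by move=> _; rewrite mule_ge0 ?lee_fin ?pmf_ge0 ?hinv_ge0.
case: k => [|[|k]].
- by rewrite p0 mul0e mule0 add0e d0// divr_ge0// pmf_ge0.
- rewrite /= invr1 mule1 /dirac_fun eqxx mul1e -EFinM -EFinD lee_fin.
  by have := pmf_ge0 p x 1; lra.
- rewrite /= -EFinM /dirac_fun/= mul0e adde0 -EFinM lee_fin mulrC ler_wpM2r ?pmf_ge0//.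
  by rewrite lef_pV2 ?posrE// ler_nat.
Qed.

(** One generation multiplies the harmonic moment of the population by at most that of one
    offspring number ([sum_law_hinv]). *)
Lemma integral_hinv n : (\int[P]_w hinv R (Zn n w) <= (hinv_rate ^+ n)%:E)%E.
Proof.
elim: n => [|n IH].
  rewrite expr0; apply: (@le_trans _ _ (\int[P]_w cst 1%E w)%E).
    by rewrite le_eqVlt; apply/orP; left; apply/eqP; apply: eq_integral => w _ /=; rewrite invr1.
  by rewrite integral_prob1.
pose psi x := (\sum_(0 <= k <oo) (pmf x k)%:E * hinv R k)%E.
have t0 x k : (0 <= (pmf x k)%:E * hinv R k)%E.
  by rewrite mule_ge0 ?lee_fin ?pmf_ge0 ?hinv_ge0.
have psi0 x : (0 <= psi x)%E by apply: nneseries_ge0.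
have mpsi : measurable_fun setT psi.
  apply: ge0_emeasurable_sum => [k x _ _|k _] //.
  by apply: emeasurable_funM => //; apply/measurable_EFinP; exact: measurable_pmf.
have := @markov_le _ T R P xi p X X_law xi_iid l n (fun _ z' _ => hinv R z') (hinv R) psi.
move=> /(_ (fun _ z' _ => hinv_ge0 R z') (fun _ _ => measurable_cst _) (hinv_ge0 R) psi0 mpsi).
move=> H; apply: le_trans (H _) _.
  apply: nearW => w z; apply: sum_law_hinv; [exact: pmf_ge0|exact: pmf_sum1].
rewrite exprSr EFinM; apply: lee_pmul => //.
- by apply: integral_ge0 => w _; exact: hinv_ge0.
- exact: integral_ge0.
have me := env_meas (@measurable_env' _ _ _ _ xi l 0).
apply: (@le_trans _ _ (\int[P]_w ((1 + pmf (env xi l 0 w) 1) / 2)%:E)%E).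
  apply: ae_ge0_le_integral => //.
  - exact: (measurableT_comp mpsi me).
  - by move=> w _; rewrite lee_fin divr_ge0// addr_ge0// pmf_ge0.
  - apply/measurable_EFinP; apply: measurable_funM => //; apply: measurable_funD => //.
    exact: measurable_pmf_env.
  - by apply: filterS good_env0 => w gw _; exact: good_hinv.
under eq_integral do rewrite EFinM EFinD.
rewrite ge0_integralZr//; last 2 first.
- apply: emeasurable_funD => //; apply/measurable_EFinP; exact: measurable_pmf_env.
- by move=> w _; rewrite adde_ge0// lee_fin pmf_ge0.
rewrite ge0_integralD//; last 2 first.
- by move=> w _; rewrite lee_fin pmf_ge0.
- by apply/measurable_EFinP; exact: measurable_pmf_env.
rewrite single_meanE -[X in (_ <= X)%E]/(((1 + single_mean) / 2)%:E) EFinM EFinD.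
rewrite lee_wpmul2r ?lee_fin// leeD2r//.
apply: (@le_trans _ _ (\int[P]_w cst 1%E w)%E) => //.
by rewrite integral_prob1.
Qed.

Lemma Z_gt0 : {ae P, forall w, forall n, (0 < Zn n w)%N}.
Proof.
apply: ae_foralln => n.
have mh : measurable_fun setT (fun w => hinv R (Zn n w)) by exact: measurable_of_Z.
have ih : P.-integrable setT (fun w => hinv R (Zn n w)).
  apply/integrableP; split => //.
  under eq_integral do rewrite gee0_abs ?hinv_ge0//.
  exact: le_lt_trans (integral_hinv n) (ltry _).
apply: filterS (integrable_ae measurableT ih) => w /(_ I).
by case: (Zn n w).
Qed.

Variable q0 : R.
Hypothesis q0_gt1 : 1 < q0.
Hypothesis Zq_fin : (\int[P]_w ((Zn 1 w)%:R `^ q0 / m_ xi p l 0 w)%:E < +oo)%E.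

(** [laplace_le] needs an exponent that is at most 2. *)
Definition moment_exp : R := Num.min q0 2.
Local Notation q := moment_exp.

Lemma moment_exp12 : 1 < q <= 2.
Proof. by rewrite /q lt_min q0_gt1 ge_min lexx orbT ltr1n. Qed.

Definition env_moment (x : R) : \bar R := rel_moment (pmf x) (fine (mean_law p x)) q.

Lemma env_moment_ge0 x : (0 <= env_moment x)%E.
Proof.
apply: nneseries_ge0 => k _ _; rewrite lee_fin mulr_ge0 ?powR_ge0//.
exact: pmf_ge0.
Qed.

Lemma mean_law_ge0 x : (0 <= mean_law p x)%E.
Proof. by apply: nneseries_ge0 => k _ _; rewrite lee_fin mulr_ge0// pmf_ge0. Qed.

Lemma measurable_mean_inv : measurable_fun setT (fun x => (fine (mean_law p x))^-1).
Proof.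
have -> : (fun x => (fine (mean_law p x))^-1) = (fun y => y `^ (-1)) \o fine \o mean_law p.
  by apply/funext => x /=; rewrite powR_inv1// fine_ge0// mean_law_ge0.
apply: measurableT_comp; last exact: measurable_mean_law.
by apply: measurableT_comp; [exact: measurable_powR|exact: fine_measurable].
Qed.

Lemma measurable_env_moment : measurable_fun setT env_moment.
Proof.
apply: ge0_emeasurable_sum => [k x _ _|k _].
  by rewrite lee_fin mulr_ge0 ?powR_ge0// pmf_ge0.
apply/measurable_EFinP; apply: measurable_funM; first exact: measurable_pmf.
have mk : measurable_fun setT (fun x => k%:R / fine (mean_law p x)).
  by apply: measurable_funM => //; exact: measurable_mean_inv.
have mq := measurable_powR q; exact: (measurableT_comp mq mk).
Qed.

(** In law Z_1 is one offspring number; and since m >= 1, (k / m)^q <= k^q0 / m. *)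
Lemma moment_fin : (\int[P]_w env_moment (env xi l 0 w) < +oo)%E.
Proof.
apply: le_lt_trans Zq_fin.
pose F (z z' : nat) (w : T) := (z'%:R `^ q0 / m_ xi p l 0 w)%:E.
have m0 w : 0 <= m_ xi p l 0 w by rewrite fine_ge0// mean_law_ge0.
have F0 z z' w : (0 <= F z z' w)%E by rewrite lee_fin divr_ge0// powR_ge0.
have mF z z' : measurable_fun (setT : set Tenv) (F z z').
  apply/measurable_EFinP; apply: measurable_funM => //.
  have mi := measurable_mean_inv.
  exact: (measurableT_comp mi (@measurable_env' _ _ _ _ xi l 0)).
rewrite -[leRHS]/(\int[P]_w F (Zn 0 w) (Zn 1 w) w)%E.
rewrite (markov_env X_law l 0 F0 mF) (@eseries_single _ _ 1); last first.
  move=> k k1; rewrite -[RHS](integral0 P setT); apply: eq_integral => w _.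
  by rewrite /= /dirac_fun eq_sym (negbTE k1) mul0e.
have me := env_meas (@measurable_env' _ _ _ _ xi l 0).
apply: ae_ge0_le_integral => //.
- by move=> w _; exact: env_moment_ge0.
- have mv := measurable_env_moment; exact: (measurableT_comp mv me).
- move=> w _; apply: mule_ge0; first by rewrite /= dirac_fun_ge0.
  by apply: sum_law_ge0 => [k|s]; [exact: pmf_ge0|exact: F0].
- rewrite /= /dirac_fun eqxx; under eq_fun do rewrite mul1e.
  apply: ge0_emeasurable_sum => [k w _ _|k _].
    by apply: mule_ge0; [rewrite lee_fin pmf_ge0|exact: F0].
  apply: emeasurable_funM; last by have := env_meas (mF 0%N (k + 0)%N).
  by apply/measurable_EFinP; exact: measurable_pmf_env.
apply: filterS good_env0 => w gw _.
rewrite /= /dirac_fun eqxx mul1e; apply: lee_nneseries => k _.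
  by move=> _; rewrite lee_fin mulr_ge0 ?powR_ge0// pmf_ge0.
rewrite addn0 lee_fin -/(m_ xi p l 0 w) ler_wpM2l ?pmf_ge0//.
have [_ m1 _ _] := good_mean gw.
have m1' : 1 <= m_ xi p l 0 w by [].
have mp : 0 < m_ xi p l 0 w by rewrite (lt_le_trans _ m1').
have /andP[q1 _] := moment_exp12.
rewrite powRM ?invr_ge0//; apply: ler_pM; rewrite ?powR_ge0//.
  case: k => [|k]; first by rewrite powR0 ?powR_ge0// gt_eqF// (lt_trans _ q1).
  by rewrite ler_powR ?ler1n// ge_min lexx.
rewrite -powR_inv1// -powRrM mulN1r !powRN lef_pV2 ?posrE ?powR_gt0//.
by rewrite powRr1// le1r_powR// ltW.
Qed.

Definition hpow_exp : R := 1 - q^-1.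
Definition sqrt_rate : R := Num.sqrt hinv_rate.
Definition pow_rate : R := sqrt_rate `^ hpow_exp.
Definition fail_rate : R := Num.sqrt pow_rate.

Lemma hpow_exp01 : 0 < hpow_exp < 1.
Proof.
have /andP[q1 q2] := moment_exp12; have qp : 0 < q by rewrite (lt_trans _ q1).
by rewrite /hpow_exp subr_gt0 invf_lt1// q1 ltrBlDr ltrDl invr_gt0.
Qed.

Lemma sqrt_rate01 : 0 < sqrt_rate < 1.
Proof.
rewrite sqrtr_gt0 hinv_rate_gt0 -(@sqrtr1 R) ltr_sqrt//.
exact: hinv_rate_lt1.
Qed.

Lemma pow_rate01 : 0 < pow_rate < 1.
Proof.
have /andP[r0 r1] := sqrt_rate01; have /andP[e0 e1] := hpow_exp01.
have E1 : 1 = 1 `^ hpow_exp :> R by rewrite powR1.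
rewrite /pow_rate powR_gt0//= [ltRHS]E1 gt0_ltr_powR// nnegrE ?ler01//.
exact: ltW.
Qed.

Lemma fail_rate01 : 0 < fail_rate < 1.
Proof.
have /andP[r0 r1] := pow_rate01.
by rewrite sqrtr_gt0 r0 -(@sqrtr1 R) ltr_sqrt.
Qed.

(** A negative power of small order is controlled by the inverse: split according to
    whether z exceeds 1 / t. *)
Lemma hpow_le_hinv (t al : R) z : 0 < t < 1 -> 0 <= al ->
  (hpow al z <= (t `^ al)%:E + (t^-1)%:E * hinv R z)%E.
Proof.
move=> /andP[t0 t1] al0; case: z => [|z].
  by rewrite [hinv _ _]/= gt0_muley ?lte_fin ?invr_gt0// addey// leey.
rewrite /= -EFinM -EFinD lee_fin.
have zp : 0 < z.+1%:R :> R by rewrite ltr0n.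
have [h|h] := leP (z.+1%:R^-1) t.
  apply: ler_wpDr; first by rewrite divr_ge0// invr_ge0 ltW.
  rewrite -[- al]mulN1r powRrM powR_inv1//.
  by apply: ge0_ler_powR => //; rewrite nnegrE ?invr_ge0// ltW.
rewrite ler_wpDl ?powR_ge0//.
apply: (@le_trans _ _ 1).
  by rewrite -[leRHS](powRr0 (z.+1%:R : R)) ler_powR ?ler1n// oppr_le0.
by rewrite mulrC ler_pdivlMr// mul1r ltW.
Qed.

Lemma integral_hpow n :
  (\int[P]_w hpow hpow_exp (Zn n w) <= (2 * pow_rate ^+ n)%:E)%E.
Proof.
case: n => [|n].
  rewrite expr0 mulr1; apply: (@le_trans _ _ (\int[P]_w cst 1%E w)%E).
    rewrite le_eqVlt; apply/orP; left; apply/eqP; apply: eq_integral => w _ /=.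
    by rewrite powR1.
  by rewrite integral_prob1 lee_fin ler1n.
have /andP[r0 r1] := sqrt_rate01; have /andP[e0 e1] := hpow_exp01.
move: n => n1; set n := n1.+1; pose t := sqrt_rate ^+ n.
have t01 : 0 < t < 1 by rewrite exprn_gt0//= exprn_ilt1 ?ltW.
have mh : measurable_fun setT (fun w => hinv R (Zn n w)) by exact: measurable_of_Z.
have h0 w : (0 <= hinv R (Zn n w))%E by exact: hinv_ge0.
have /andP[t0 _] := t01.
apply: (@le_trans _ _ (\int[P]_w ((t `^ hpow_exp)%:E + (t^-1)%:E * hinv R (Zn n w)))%E).
  apply: ge0_le_integral => //.
  - by move=> w _; rewrite ltW ?hpow_gt0.
  - exact: measurable_of_Z.
  - by apply: emeasurable_funD => //; exact: measurable_funeM.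
  - by move=> w _; rewrite hpow_le_hinv// ltW.
rewrite ge0_integralD//; last 3 first.
- by move=> w _; rewrite lee_fin powR_ge0.
- by move=> w _; rewrite mule_ge0// lee_fin invr_ge0 ltW.
- exact: measurable_funeM.
rewrite ge0_integralZl ?lee_fin ?invr_ge0 ?(ltW t0)//.
have -> : (2 * pow_rate ^+ n = pow_rate ^+ n + pow_rate ^+ n :> R) by rewrite mulr2n mulrDl mul1r.
rewrite EFinD; apply: leeD.
  rewrite (_ : (\int[P]_w _)%E = (t `^ hpow_exp)%:E).
    by rewrite lee_fin /t /pow_rate -(powR_mulrn n (ltW r0)) -(powR_mulrn n (powR_ge0 _ _)) powRAC.
  under eq_integral do rewrite -[_%:E]mule1.
  by rewrite ge0_integralZl ?lee_fin ?powR_ge0// (integral_prob1 P) mule1.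
apply: (@le_trans _ _ ((t^-1)%:E * (hinv_rate ^+ n)%:E)%E).
  by rewrite lee_wpmul2l ?lee_fin ?invr_ge0 ?(ltW t0)// integral_hinv.
rewrite -EFinM lee_fin.
have -> : hinv_rate ^+ n = t * t.
  by rewrite /t -exprMn -expr2 sqr_sqrtr// ltW// hinv_rate_gt0.
rewrite mulKf ?gt_eqF// /t; apply: lerXn2r; rewrite ?nnegrE ?powR_ge0//; first exact: ltW.
by rewrite /pow_rate -[leLHS](powRr1 (ltW r0)); apply: ger_powR; [rewrite r0 ltW|exact: ltW].
Qed.

(** The factors exp (- h^n) have a positive product, yet they leave room for the deviations
    of [low_offspring]. *)
Definition shrink n : R := expR (- fail_rate ^+ n).

Lemma shrink01 n : 0 < shrink n < 1.
Proof.
have /andP[h0 h1] := fail_rate01.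
by rewrite expR_gt0 -expR0 ltr_expR oppr_lt0 exprn_gt0.
Qed.

Lemma shrink_gap n : (1 - shrink n)^-1 <= 2 / fail_rate ^+ n.
Proof.
have /andP[h0 h1] := fail_rate01; have /andP[_ k1] := shrink01 n.
rewrite -invf_div lef_pV2 ?posrE ?divr_gt0 ?exprn_gt0 ?subr_gt0// /shrink.
have y0 : 0 < fail_rate ^+ n by rewrite exprn_gt0.
have y1 : fail_rate ^+ n <= 1 by rewrite exprn_ile1// ltW.
have := expR_ge1Dx (fail_rate ^+ n); rewrite expRN.
move: (fail_rate ^+ n) y0 y1 => y y0 y1 h.
have : (expR y)^-1 <= (1 + y)^-1 by rewrite lef_pV2 ?posrE ?expR_gt0//; lra.
have : (1 + y)^-1 <= 1 - y / 2.
  by rewrite -div1r ler_pdivrMr; nra.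
by lra.
Qed.

Definition shortfall n : set T :=
  [set w | (Zn n.+1 w)%:R <= shrink n * m_ xi p l n w * (Zn n w)%:R :> R].

Lemma measurable_m n : measurable_fun setT (fun w => m_ xi p l n w).
Proof.
have me := env_meas (@measurable_env' _ _ _ _ xi l n).
have mm : measurable_fun setT (fun x => fine (mean_law p x)).
  by apply: measurableT_comp measurable_mean_law; exact: fine_measurable.
exact: (measurableT_comp mm me).
Qed.

Lemma measurable_fail n : measurable (shortfall n).
Proof.
have -> : shortfall n = [set w | 0 <= shrink n * m_ xi p l n w * (Zn n w)%:R - (Zn n.+1 w)%:R].
  by apply/seteqP; split => w; rewrite /shortfall /= subr_ge0.
have mZ k := measurable_of_Z k (fun z => z%:R : R).
apply: measurable_ge; apply: measurable_funB => //.
apply: measurable_funM => //; apply: measurable_funM => //; exact: measurable_m.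
Qed.

Definition fail_const : R := 4 * (1 + fine (\int[P]_w env_moment (env xi l 0 w))).

(** [low_offspring] gives the factor 1 / (1 - shrink n), of order h^(-n), and the mean
    of Z^(- hpow_exp), at most 2 h^(2n). *)
Lemma prob_fail n : (P (shortfall n) <= (fail_const * fail_rate ^+ n)%:E)%E.
Proof.
have /andP[h0 h1] := fail_rate01; have /andP[k0 k1] := shrink01 n.
pose F (z z' : nat) (x : R) :=
  (((z'%:R <= shrink n * fine (mean_law p x) * z%:R :> R)%R%:R : R)%:E).
(* the two factors of low_offspring, one for the population and one for the environment *)
pose psi x := (((1 - shrink n)^-1)%:E * (1 + env_moment x))%E.
have F0 z z' x : (0 <= F z z' x)%E by rewrite lee_fin.
have mm : measurable_fun setT (fun x => fine (mean_law p x)).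
  by apply: measurableT_comp measurable_mean_law; exact: fine_measurable.
have mF z z' : measurable_fun setT (F z z').
  have -> : F z z' = fun x => (\1_[set x | 0 <= shrink n * fine (mean_law p x) * z%:R - z'%:R] x)%:E.
    apply/funext => x; rewrite /F indicE.
    case: (boolP (x \in _)) => [|/negP]; rewrite inE/= subr_ge0; first by move=> ->.
    by move=> /negP/negbTE ->.
  apply: measurable_EFin_indic; apply: measurable_ge; apply: measurable_funB => //.
  by apply: measurable_funM => //; apply: measurable_funM.
have ki : 0 <= (1 - shrink n)^-1 by rewrite invr_ge0 subr_ge0 ltW.
have psi0 x : (0 <= psi x)%E.
  by rewrite mule_ge0 ?lee_fin// adde_ge0// env_moment_ge0.
have mv := measurable_env_moment.
have mpsi : measurable_fun setT psi.
  by apply: measurable_funeM; exact: emeasurable_funD.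
have := markov_le X_law xi_iid (l := l) (n := n) F0 mF (fun z => ltW (hpow_gt0 hpow_exp z)) psi0 mpsi.
move=> /(_ _)/wrap[|H].
  apply: filterS good_env => w gw z.
  have [mE m1 _ _] := good_mean (gw n).
  apply: (low_offspring (pmf_ge0 p _) (pmf_sum1 p _) _ _ moment_exp12) => //.
  - exact: lt_le_trans m1.
  - by rewrite k0.
have -> : P (shortfall n) = (\int[P]_w F (Zn n w) (Zn n.+1 w) (env xi l n w))%E.
  rewrite -[shortfall n]setIT -integral_indic//; last exact: measurable_fail.
  apply: eq_integral => w _; rewrite /F indicE; congr ((nat_of_bool _)%:R%:E).
  by apply/idP/idP; rewrite inE.
apply: le_trans H _.
have me := env_meas (@measurable_env' _ _ _ _ xi l 0).
have mve := measurableT_comp mv me.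
have I1 : (\int[P]_w env_moment (env xi l 0 w) = (fine (\int[P]_w env_moment (env xi l 0 w)))%:E)%E.
  rewrite fineK// ge0_fin_numE ?moment_fin//.
  by apply: integral_ge0 => w _; exact: env_moment_ge0.
have -> : (\int[P]_w psi (env xi l 0 w) =
   ((1 - shrink n)^-1 * (1 + fine (\int[P]_w env_moment (env xi l 0 w))))%:E)%E.
  rewrite ge0_integralZl//; last 2 first.
  - exact: emeasurable_funD.
  - by move=> w _; rewrite adde_ge0// env_moment_ge0.
  rewrite ge0_integralD//; last by move=> w _; exact: env_moment_ge0.
  by rewrite (integral_prob1 P) EFinM EFinD -I1.
have v0 : 0 <= fine (\int[P]_w env_moment (env xi l 0 w)).
  by rewrite fine_ge0// integral_ge0// => w _; exact: env_moment_ge0.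
apply: (@le_trans _ _ ((2 * pow_rate ^+ n)%:E *
   (2 / fail_rate ^+ n * (1 + fine (\int[P]_w env_moment (env xi l 0 w))))%:E)%E).
  apply: lee_pmul.
  - by apply: integral_ge0 => w _; rewrite ltW// hpow_gt0.
  - by rewrite lee_fin mulr_ge0// addr_ge0.
  - exact: integral_hpow.
  - by rewrite lee_fin ler_wpM2r ?addr_ge0// shrink_gap.
rewrite -EFinM lee_fin /fail_const.
have -> : pow_rate ^+ n = fail_rate ^+ n * fail_rate ^+ n.
  by rewrite -exprMn -expr2 sqr_sqrtr// ltW//; case/andP: pow_rate01.
have y0 : fail_rate ^+ n != 0 by rewrite expf_neq0// gt_eqF.
rewrite le_eqVlt; apply/orP; left; apply/eqP; field.
exact: y0.
Qed.

Variable c0 : R.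
Hypothesis c0_gt0 : 0 < c0.
Hypothesis exp_fin : (\int[P]_w (expR (c0 * M 0 w))%:E < +oo)%E.

Definition exp_const : R := fine (\int[P]_w (expR (c0 * M 0 w))%:E).

Lemma integral_expS k :
  (\int[P]_w (expR (c0 * S_ k w))%:E = (exp_const ^+ k)%:E)%E.
Proof.
elim: k => [|k IH].
  rewrite expr0 -[RHS](integral_prob1 P); apply: eq_integral => w _.
  by rewrite /S_ big_ord0 mulr0 expR0.
pose pr (x : R * R) : R := if l then x.2 else x.1.
have mpr : measurable_fun setT pr := @measurable_proj R l.
pose psi (x : R * R) := (expR (c0 * log_mean (pr x)))%:E.
have ml := measurable_log_mean.
have mE (d' : measure_display) (T' : measurableType d') (f : T' -> R) :
  measurable_fun setT f -> measurable_fun setT (fun x => (expR (c0 * f x))%:E).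
  by move=> mf; apply/measurable_EFinP; apply: measurableT_comp => //; exact: measurable_funM.
have mf := @mE _ _ _ (@measurable_S k).
have := @past_indep_integral _ T R P xi xi_iid k (fun w => (expR (c0 * S_ k w))%:E) psi mf.
move=> /(_ (fun w => expR_ge0 _) (mE _ _ _ (measurableT_comp ml mpr)) (fun x => expR_ge0 _)).
rewrite IH => H; rewrite exprSr EFinM.
rewrite (_ : exp_const%:E = \int[P]_w psi (xi 0%N w))%E; last first.
  rewrite fineK// ge0_fin_numE; last by apply: integral_ge0 => w _; rewrite lee_fin expR_ge0.
  exact: exp_fin.
rewrite -H; apply: eq_integral => w _.
by rewrite -EFinM -expRD -mulrDr /S_ big_ord_recr.
Qed.

Lemma prob_S k u :
  (P [set w | (u <= S_ k w)%R] <= (expR (- (c0 * u)) * exp_const ^+ k)%:E)%E.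
Proof.
have mS := measurable_ST k.
have mE : measurable_fun setT (fun w => (expR (c0 * S_ k w))%:E).
  by apply/measurable_EFinP; apply: measurableT_comp => //; exact: measurable_funM.
rewrite EFinM -integral_expS -ge0_integralZl ?lee_fin ?expR_ge0//.
apply: prob_le_integral.
- exact: measurable_ge.
- exact: measurable_funeM.
- by move=> w; rewrite -EFinM lee_fin mulr_ge0 ?expR_ge0.
- apply: nearW => w /= uS; rewrite -EFinM lee_fin -expRD -[leLHS](@expR0 R) ler_expR.
  by rewrite addrC -mulrBr mulr_ge0 ?subr_ge0// ltW.
Qed.

(** Before generation k only Z >= 1 is used; after it, one generation without shortfall costs
    at most h^j. *)
Lemma log_lower k n : {ae P, forall w, (forall j, (k <= j < n)%N -> ~ shortfall j w) ->
  S_ n w - ln (Zn n w)%:R <= S_ k w + \sum_(j < n) fail_rate ^+ j}.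
Proof.
apply: filterS2 good_env Z_gt0 => w gw Z0.
have M0 i : 0 <= M i w by have [_ _ ? _] := good_mean (gw i).
have S0 i : 0 <= S_ i w by apply: sumr_ge0.
have /andP[h0 h1] := fail_rate01.
have L0 i : 0 <= ln (Zn i w)%:R :> R by rewrite ln_ge0// ler1n.
have F0 i : 0 <= \sum_(j < i) fail_rate ^+ j.
  by apply: sumr_ge0 => j _; rewrite exprn_ge0// ltW.
elim: n => [|n IH] H.
  by rewrite {1}/S_ big_ord0 big_ord0 addr0 sub0r (le_trans _ (S0 k))// oppr_le0.
have [nk|kn] := ltnP n k.
  apply: (@le_trans _ _ (S_ n.+1 w)); first by rewrite gerBl.
  apply: (@le_trans _ _ (S_ k w)); last by rewrite lerDl.
  rewrite /S_ -(subnKC nk) big_split_ord/= lerDl.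
  exact: sumr_ge0.
have /IH {}IH : forall j, (k <= j < n)%N -> ~ shortfall j w.
  by move=> j /andP[kj jn]; apply: H; rewrite kj ltnS ltnW.
have := H n; rewrite kn ltnS leqnn => /(_ isT)/negP.
rewrite /shortfall /= -ltNge => Hf.
have [mE m1 _ eM] := good_mean (gw n).
have mp : 0 < m_ xi p l n w by rewrite (lt_le_trans _ m1).
have Zp i : 0 < (Zn i w)%:R :> R by rewrite ltr0n.
have /andP[s0 _] := shrink01 n.
have : ln (shrink n * m_ xi p l n w * (Zn n w)%:R) <= ln (Zn n.+1 w)%:R.
  by rewrite ler_ln ?posrE ?mulr_gt0// ltW.
rewrite !lnM ?posrE ?mulr_gt0// /shrink expRK => Hl.
move: IH; rewrite /S_ !big_ord_recr/= -/(S_ n w) -/(S_ k w) => IH.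
have -> : M_ xi p l n w = ln (m_ xi p l n w) by [].
lra.
Qed.

Lemma fail_rate_sum k n : \sum_(k <= j < n) fail_rate ^+ j <= fail_rate ^+ k / (1 - fail_rate).
Proof.
have /andP[h0 h1] := fail_rate01.
have [nk|kn] := leqP n k.
  by rewrite big_geq// divr_ge0 ?exprn_ge0 ?subr_ge0// ltW.
rewrite -(subnKC (ltnW kn)) geometric_partial_tail geometric_le_lim ?exprn_ge0 ?ltW//.
by rewrite ger0_norm// ltW.
Qed.

Lemma tail_lower_k k n t :
  (P [set w | (t < S_ n w - ln (Zn n w)%:R)%R] <=
   (expR (- (c0 * (t - (1 - fail_rate)^-1))) * exp_const ^+ k +
    fail_const * (fail_rate ^+ k / (1 - fail_rate)))%:E)%E.
Proof.
have /andP[h0 h1] := fail_rate01.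
pose U := [set w | t - (1 - fail_rate)^-1 <= S_ k w].
have mU : measurable U by apply: measurable_ge; exact: measurable_ST.
have mfu : measurable_fun setT (fun w => (\1_U w)%:E : \bar R) := measurable_EFin_indic mU.
have mff j : measurable_fun setT (fun w => (\1_(shortfall j) w)%:E : \bar R).
  exact: measurable_EFin_indic (measurable_fail j).
have ms : measurable_fun setT (fun w => \sum_(k <= j < n) (\1_(shortfall j) w)%:E : \bar R)%E.
  exact: emeasurable_sum.
have s0 w : (0 <= \sum_(k <= j < n) (\1_(shortfall j) w)%:E :> \bar R)%E.
  by apply: sume_ge0 => j _; rewrite lee_fin.
apply: (@le_trans _ _ (\int[P]_w ((\1_U w)%:E + \sum_(k <= j < n) (\1_(shortfall j) w)%:E))%E).
  apply: prob_le_integral.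
  - apply: measurable_gt; apply: measurable_funB; first exact: measurable_ST.
    exact: (measurable_of_Z n (fun z => ln z%:R : R)).
  - exact: emeasurable_funD.
  - by move=> w; rewrite adde_ge0// lee_fin.
  apply: filterS (log_lower k n) => w H /= tw.
  have [[j /andP[kj jn] fj]|nf] := pselect (exists2 j, (k <= j < n)%N & shortfall j w).
    apply: le_trans (leeDr _ _); last by rewrite lee_fin.
    rewrite (big_cat_nat kj (ltnW jn))/= (big_ltn jn)/= indicE (mem_set fj).
    rewrite addeCA leeDl// adde_ge0// sume_ge0// => i _; by rewrite lee_fin.
  apply: le_trans (leeDl _ _); last exact: s0.
  rewrite indicE mem_set// /U /=.
  have := H (fun j kj fj => nf (ex_intro2 _ _ j kj fj)).
  have := fail_rate_sum 0 n; rewrite big_mkord expr0 mul1r.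
  by move: (\sum_(j < n) _) => F; lra.
rewrite ge0_integralD//.
rewrite ge0_integral_sum//.
rewrite integral_indic// setIT EFinD; apply: leeD.
  exact: prob_S.
apply: (@le_trans _ _ (\sum_(k <= j < n) (fail_const * fail_rate ^+ j)%:E)%E).
  apply: lee_sum => j _; rewrite integral_indic//; last exact: measurable_fail.
  rewrite setIT; exact: prob_fail.
rewrite sumEFin lee_fin -mulr_sumr ler_wpM2l ?fail_rate_sum//.
rewrite /fail_const mulr_ge0// addr_ge0// fine_ge0// integral_ge0// => w _.
exact: env_moment_ge0.
Qed.

(** The choice k = floor (de t) makes exp (L k) smaller than exp (c t / 2), while h^k is
    still exponentially small in t. *)
Lemma exp_comb (h c L C1 C2 t : R) : 0 < h < 1 -> 0 < c -> 0 <= L -> 0 <= C1 -> 0 <= C2 -> 0 <= t ->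
  let de := c / (2 * (L + 1)) in
  exists k : nat, expR (- (c * t)) * expR L ^+ k * C1 + C2 * h ^+ k <=
    (C1 + C2 / h) * expR (- (Num.min (c / 2) (de * - ln h) * t)).
Proof.
move=> /andP[h0 h1] c0' L0 C10 C20 t0 de.
have de0 : 0 < de by rewrite divr_gt0// mulr_gt0//; lra.
have [k1 k2] := andP (truncn_itv (mulr_ge0 (ltW de0) t0)).
exists (Num.truncn (de * t)); set k := Num.truncn _ in k1 k2 *.
have lnh : ln h < 0 by rewrite ln_lt0// h0.
set m := Num.min _ _.
have m1 : m <= c / 2 by rewrite ge_min lexx.
have m2 : m <= de * - ln h by rewrite ge_min lexx orbT.
rewrite mulrDl; apply: lerD.
  rewrite mulrC ler_wpM2l// -expRM_natl -expRD ler_expR.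
  have : k%:R * L <= de * t * L by rewrite ler_wpM2r.
  have : de * t * L <= c / 2 * t.
    rewrite mulrAC ler_wpM2r// /de.
    rewrite mulrAC ler_pdivrMr ?mulr_gt0//; last by lra.
    have -> : c / 2 * (2 * (L + 1)) = c * L + c by field.
    lra.
  have : m * t <= c / 2 * t by rewrite ler_wpM2r.
  by move=> ? ? ?; lra.
rewrite -mulrA ler_wpM2l// mulrC ler_pdivlMr// -exprSr.
have -> : h ^+ k.+1 = expR (k.+1%:R * ln h) by rewrite expRM_natl lnK.
rewrite ler_expR.
have : k.+1%:R * ln h <= de * t * ln h by rewrite ler_wnM2r// ltW.
have : m * t <= de * - ln h * t by rewrite ler_wpM2r.
by move=> ? ?; lra.
Qed.

(** The upper tail is Markov's inequality for the martingale; the lower one combines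
    [tail_lower_k] with the choice of k in [exp_comb]. *)
Lemma log_deviation : exists C c : R, [/\ 0 < C, 0 < c & forall n t, 0 <= t ->
  (P [set w | (t < `|ln (Zn n w)%:R - S_ n w|)%R] <= (C * expR (- (c * t)))%:E)%E].
Proof.
have /andP[h0 h1] := fail_rate01.
have I0 : 0 <= exp_const.
  by apply: fine_ge0; apply: integral_ge0 => w _; rewrite lee_fin expR_ge0.
pose L := ln (exp_const + 1).
have L0 : 0 <= L by rewrite ln_ge0// lerDr.
have eL : expR L = exp_const + 1 by rewrite lnK// posrE; lra.
pose C1 := expR (c0 * (1 - fail_rate)^-1).
have fc0 : 0 <= fail_const.
  rewrite /fail_const mulr_ge0// addr_ge0// fine_ge0// integral_ge0// => w _.
  exact: env_moment_ge0.
pose C2 := fail_const / (1 - fail_rate).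
have C10 : 0 <= C1 by rewrite expR_ge0.
have C20 : 0 <= C2 by rewrite divr_ge0// subr_ge0 ltW.
pose c1 := Num.min (c0 / 2) (c0 / (2 * (L + 1)) * - ln fail_rate).
have c10 : 0 < c1.
  rewrite lt_min divr_gt0//= mulr_gt0// ?divr_gt0// ?mulr_gt0//; first by lra.
  by rewrite oppr_gt0 ln_lt0// h0.
exists (1 + (C1 + C2 / fail_rate)), (Num.min 1 c1).
have D0 : 0 <= C1 + C2 / fail_rate by rewrite addr_ge0// divr_ge0// ltW.
split; [lra|by rewrite lt_min ltr01|move=> n t t0].
have [k kP] := exp_comb (fail_rate01) c0_gt0 L0 C10 C20 t0.
have mg : measurable_fun setT (fun w => ln (Zn n w)%:R - S_ n w : R).
  apply: measurable_funB; last exact: measurable_ST.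
  exact: (measurable_of_Z n (fun z => ln z%:R : R)).
have mg' : measurable_fun setT (fun w => S_ n w - ln (Zn n w)%:R : R).
  apply: measurable_funB; first exact: measurable_ST.
  exact: (measurable_of_Z n (fun z => ln z%:R : R)).
apply: (@le_trans _ _ (P ([set w | (t < ln (Zn n w)%:R - S_ n w)%R] `|`
   [set w | (t < S_ n w - ln (Zn n w)%:R)%R]))%E).
  apply: le_measure; rewrite ?inE.
  - by apply: measurable_gt; apply: measurableT_comp.
  - by apply: measurableU; exact: measurable_gt.
  - by move=> w /=; rewrite ltr_normr opprB => /orP[]; [left|right].
apply: le_trans (measureU2 _ _ _) _; try exact: measurable_gt.
rewrite mulrDl EFinD; apply: leeD.
  apply: le_trans (tail_upper _ t0) _; rewrite lee_fin mul1r ler_expR lerN2.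
  by rewrite ler_piMl// ge_min lexx.
apply: le_trans (tail_lower_k k n t) _; rewrite lee_fin.
apply: (@le_trans _ _ ((C1 + C2 / fail_rate) * expR (- (c1 * t)))); last first.
  by rewrite ler_wpM2l// ler_expR lerN2 ler_wpM2r// ge_min lexx orbT.
apply: le_trans kP; apply: lerD.
  rewrite mulrBr opprB addrC expRD -/C1 [leRHS]mulrAC.
  rewrite ler_wpM2l ?mulr_ge0 ?expR_ge0//.
  by rewrite lerXn2r ?nnegrE ?expR_ge0// eL lerDl.
by rewrite /C2 mulrA mulrAC.
Qed.

End branching_tails.

(** * Combining two correlated noises *)

Section two_noises.
Context d (T : measurableType d) (R : realType) (P : probability T R).
Variables (u v : T -> R) (c s1 s2 r : R).
Hypotheses (mu : measurable_fun setT u) (mv : measurable_fun setT v).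
Hypothesis c0 : 0 < c.
Hypotheses (iu : P.-integrable setT (EFin \o (fun w => expR (c * `|u w|))))
  (iv : P.-integrable setT (EFin \o (fun w => expR (c * `|v w|)))).
Hypotheses (s10 : 0 < s1) (s20 : 0 < s2).
Hypotheses (Eu : \int[P]_w u w = 0) (Ev : \int[P]_w v w = 0).
Hypotheses (Eu2 : \int[P]_w (u w ^+ 2) = s1 ^+ 2) (Ev2 : \int[P]_w (v w ^+ 2) = s2 ^+ 2)
  (Euv : \int[P]_w (u w * v w) = r * s1 * s2).
Hypothesis r_le1 : r <= 1.

Definition comb_var (s1 s2 r a b : R) : R :=
  a ^+ 2 * s1 ^+ 2 + b ^+ 2 * s2 ^+ 2 - 2 * r * (a * s1) * (b * s2).
Local Notation Q := (comb_var s1 s2 r).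

Let H w := `|u w| + `|v w|.
(* H is a sum of two variables with exponential moment c; half of that moment survives for H,
   and half of it again pays for the powers of H *)
Let e := c / 4.

Let H0 w : 0 <= H w. Proof. by rewrite addr_ge0. Qed.
Let e0 : 0 < e. Proof. by rewrite divr_gt0. Qed.

Let mH : measurable_fun setT H.
Proof. by apply: measurable_funD; exact: measurableT_comp. Qed.

Let int_expH (k : R) : 0 <= k <= 2 -> P.-integrable setT (EFin \o (fun w => expR (k * e * H w))).
Proof.
move=> /andP[k0 k2]; apply: (integrable_le _ _ (intD iu iv)).
  by apply: measurableT_comp => //; exact: measurable_funM.
move=> w; rewrite ger0_norm ?expR_ge0//.
have h : k * e * H w <= (c * `|u w| + c * `|v w|) / 2.
  have : 0 <= (2 - k) * (c * H w) by rewrite !mulr_ge0 ?subr_ge0// ltW.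
  by rewrite /H /e; lra.
have [uv|vu] := leP (c * `|u w|) (c * `|v w|).
  rewrite -[leLHS]add0r lerD ?expR_ge0// ler_expR (le_trans h)//; lra.
rewrite -[leLHS]addr0 lerD ?expR_ge0// ler_expR (le_trans h)//; lra.
Qed.

Let powH (n : nat) w : H w ^+ n <= n`!%:R / e ^+ n * expR (e * H w).
Proof.
case: n => [|n].
  by rewrite !expr0 fact0 divr1 mul1r -expR0 ler_expR mulr_ge0// ltW.
have := @expR_ge1Dxn R (e * H w) n (mulr_ge0 (ltW e0) (H0 w)).
have f0 : 0 < (n.+1)`!%:R :> R by rewrite ltr0n fact_gt0.
rewrite exprMn mulrC => h.
rewrite mulrAC ler_pdivlMr ?exprn_gt0// [leLHS]mulrC.
by rewrite mulrC -ler_pdivrMl//; lra.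
Qed.

Let int_powH n : P.-integrable setT (EFin \o (fun w => H w ^+ n)).
Proof.
have i1 := intZl (n`!%:R / e ^+ n) (int_expH (_ : 0 <= 1 <= 2)).
apply: (integrable_le _ _ (i1 _)); rewrite ?ler01 ?ler1n//.
  exact: measurable_funX.
by move=> w; rewrite ger0_norm ?exprn_ge0// mul1r powH.
Qed.

Let int_H3exp : P.-integrable setT (EFin \o (fun w => H w ^+ 3 * expR (e * H w))).
Proof.
have i1 := intZl (3`!%:R / e ^+ 3) (int_expH (_ : 0 <= 2 <= 2)).
apply: (integrable_le _ _ (i1 _)); rewrite ?lexx ?ler0n//.
  apply: measurable_funM; first exact: measurable_funX.
  by apply: measurableT_comp => //; exact: measurable_funM.
move=> w; rewrite ger0_norm ?mulr_ge0 ?exprn_ge0 ?expR_ge0//.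
have -> : 2 * e * H w = e * H w + e * H w by ring.
by rewrite expRD mulrA ler_wpM2r ?expR_ge0// powH.
Qed.

Let iu1 : P.-integrable setT (EFin \o u).
Proof. by apply: (integrable_le _ _ (int_powH 1)) => // w; rewrite expr1 lerDl. Qed.
Let iv1 : P.-integrable setT (EFin \o v).
Proof. by apply: (integrable_le _ _ (int_powH 1)) => // w; rewrite expr1 lerDr. Qed.

Let sqH w (x y : R) : `|x| <= H w -> `|y| <= H w -> `|x * y| <= H w ^+ 2.
Proof. by move=> hx hy; rewrite normrM expr2; apply: ler_pM. Qed.

Let uH w : `|u w| <= H w. Proof. by rewrite lerDl. Qed.
Let vH w : `|v w| <= H w. Proof. by rewrite lerDr. Qed.

Let iu2 : P.-integrable setT (EFin \o (fun w => u w ^+ 2)).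
Proof.
apply: (integrable_le _ _ (int_powH 2)); first exact: measurable_funX.
by move=> w; rewrite [u w ^+ 2]expr2 sqH.
Qed.
Let iv2 : P.-integrable setT (EFin \o (fun w => v w ^+ 2)).
Proof.
apply: (integrable_le _ _ (int_powH 2)); first exact: measurable_funX.
by move=> w; rewrite [v w ^+ 2]expr2 sqH.
Qed.
Let iuv : P.-integrable setT (EFin \o (fun w => u w * v w)).
Proof.
apply: (integrable_le _ _ (int_powH 2)); first exact: measurable_funM.
by move=> w; rewrite sqH.
Qed.

Lemma comb_mean a b : \int[P]_w (a * u w - b * v w) = 0.
Proof.
rewrite (RintegralB _ (intZl a iu1) (intZl b iv1))//.
by rewrite !RintegralZl// Eu Ev !mulr0 subrr.
Qed.

Lemma comb_square a b : \int[P]_w ((a * u w - b * v w) ^+ 2) = Q a b.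
Proof.
transitivity (\int[P]_w ((a ^+ 2 * u w ^+ 2 + b ^+ 2 * v w ^+ 2) - (2 * a * b) * (u w * v w))).
  by apply: eq_Rintegral => w _; ring.
rewrite (RintegralB _ (intD (intZl (a ^+ 2) iu2) (intZl (b ^+ 2) iv2)) (intZl (2 * a * b) iuv))//.
rewrite (RintegralD _ (intZl (a ^+ 2) iu2) (intZl (b ^+ 2) iv2))//.
by rewrite !RintegralZl// Eu2 Ev2 Euv /comb_var; ring.
Qed.

Lemma comb_var_ge0 a b : 0 <= Q a b.
Proof. by rewrite -comb_square; apply: Rintegral_ge0 => w _; rewrite sqr_ge0. Qed.

(** The combination is of the size of its own standard deviation.  If r < 1, the quadratic
    form [comb_var] is bounded below by a multiple of the sum of the two squares; if
    r = 1, the two noises are almost surely proportional and the combination is a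
    multiple of one of them. *)
Lemma comb_dominated : exists2 ka : R, 0 < ka & forall a b : R, 0 <= a -> 0 <= b ->
  {ae P, forall w, `|a * u w - b * v w| <= ka * Num.sqrt (Q a b) * H w}.
Proof.
have [r1|r1] := ltP r 1.
  pose de := 1 - Num.max r 0.
  have de0 : 0 < de by rewrite subr_gt0 gt_max r1 ltr01.
  have sd0 : 0 < Num.sqrt de by rewrite sqrtr_gt0.
  exists ((s1 * Num.sqrt de)^-1 + (s2 * Num.sqrt de)^-1).
    by rewrite addr_gt0// invr_gt0 mulr_gt0.
  move=> a b a0 b0; apply: nearW => w.
  have Qge : de * ((a * s1) ^+ 2 + (b * s2) ^+ 2) <= Q a b.
    have x0 : 0 <= a * s1 by rewrite mulr_ge0// ltW.
    have y0 : 0 <= b * s2 by rewrite mulr_ge0// ltW.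
    have -> : Q a b = (a * s1) ^+ 2 + (b * s2) ^+ 2 - 2 * r * (a * s1) * (b * s2).
      by rewrite /comb_var !exprMn.
    move: (a * s1) (b * s2) x0 y0 => x y x0 y0.
    have h1 : r * (x * y) <= Num.max r 0 * (x * y) by rewrite ler_wpM2r ?mulr_ge0// le_max lexx.
    have h2 : 0 <= Num.max r 0 by rewrite le_max lexx orbT.
    have h3 : 0 <= Num.max r 0 * (x - y) ^+ 2 by rewrite mulr_ge0// sqr_ge0.
    rewrite /de; nra.
  have bd (x s : R) : 0 <= x -> 0 < s -> de * (x * s) ^+ 2 <= Q a b ->
      x <= (s * Num.sqrt de)^-1 * Num.sqrt (Q a b).
    move=> x0 s0 h; rewrite mulrC ler_pdivlMr ?mulr_gt0//.
    rewrite -(ler_pXn2r (ltn0Sn 1)) ?nnegrE ?sqrtr_ge0 ?mulr_ge0 ?sqrtr_ge0 ?(ltW s0)//.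
    rewrite !exprMn !sqr_sqrtr ?(ltW de0)//; last first.
      by apply: le_trans h; rewrite mulr_ge0 ?sqr_ge0// ltW.
    by rewrite mulrA -exprMn mulrC.
  have ha := bd a s1 a0 s10 (le_trans _ Qge); have hb := bd b s2 b0 s20 (le_trans _ Qge).
  have {}ha : a <= (s1 * Num.sqrt de)^-1 * Num.sqrt (Q a b).
    by apply: ha; rewrite ler_wpM2l ?(ltW de0)// lerDl sqr_ge0.
  have {}hb : b <= (s2 * Num.sqrt de)^-1 * Num.sqrt (Q a b).
    by apply: hb; rewrite ler_wpM2l ?(ltW de0)// lerDr sqr_ge0.
  apply: (le_trans (ler_normB _ _)); rewrite !normrM (ger0_norm a0) (ger0_norm b0) mulrDl.
  have K1 : 0 <= (s1 * Num.sqrt de)^-1 * Num.sqrt (Q a b) by apply: le_trans ha.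
  have K2 : 0 <= (s2 * Num.sqrt de)^-1 * Num.sqrt (Q a b) by apply: le_trans hb.
  rewrite mulrDl; apply: lerD.
    by apply: ler_pM => //; exact: uH.
  by apply: ler_pM => //; exact: vH.
have r1' : r = 1 by apply/eqP; rewrite eq_le r_le1 r1.
exists s1^-1; first by rewrite invr_gt0.
move=> a b a0 b0.
have mf : measurable_fun setT (fun w => ((s2 * u w - s1 * v w) ^+ 2)%:E).
  by apply/measurable_EFinP; apply: measurable_funX; apply: measurable_funB; exact: measurable_funM.
have I0 : (\int[P]_w ((s2 * u w - s1 * v w) ^+ 2)%:E = 0)%E.
  have := comb_square s2 s1; rewrite /comb_var r1' /Rintegral.
  have -> : s2 ^+ 2 * s1 ^+ 2 + s1 ^+ 2 * s2 ^+ 2 - 2 * 1 * (s2 * s1) * (s1 * s2) = 0 by ring.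
  move=> h0; suff Jf : (\int[P]_w ((s2 * u w - s1 * v w) ^+ 2)%:E)%E \is a fin_num.
    by rewrite -(fineK Jf) h0.
  apply: integrable_fin_num => //.
  have i2 := intB (intD (intZl (s2 ^+ 2) iu2) (intZl (s1 ^+ 2) iv2)) (intZl (2 * s2 * s1) iuv).
  apply: eq_integrable i2 => // w _ /=; congr (_%:E); ring.
have := (ae_eq_integral_abs P measurableT mf).1.
under eq_integral do rewrite gee0_abs ?lee_fin ?sqr_ge0//.
move=> /(_ I0); apply: filterS => w /(_ I) [] /eqP; rewrite sqrf_eq0 subr_eq0 => /eqP vw.
have -> : Q a b = (a * s1 - b * s2) ^+ 2 by rewrite /comb_var r1'; ring.
rewrite sqrtr_sqr.
have -> : a * u w - b * v w = (a * s1 - b * s2) * (u w / s1).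
  have -> : v w = s2 * u w / s1 by rewrite vw mulrAC mulfV ?mul1r// gt_eqF.
  by field; rewrite gt_eqF.
rewrite normrM [s1^-1 * _]mulrC -mulrA ler_wpM2l// normrM normfV (gtr0_norm s10) mulrC.
by rewrite ler_wpM2l ?invr_ge0 ?(ltW s10)// uH.
Qed.

Lemma integrable_le_ae (f g : T -> R) : measurable_fun setT f -> measurable_fun setT g ->
  {ae P, forall w, `|f w| <= g w} -> (forall w, 0 <= g w) ->
  P.-integrable setT (EFin \o g) ->
  P.-integrable setT (EFin \o f) /\ \int[P]_w `|f w| <= \int[P]_w g w.
Proof.
move=> mf mg fg g0 ig.
have h : (\int[P]_w `|(f w)%:E| <= \int[P]_w (g w)%:E)%E.
  apply: ae_ge0_le_integral => //.
  - by apply: measurableT_comp => //; exact/measurable_EFinP.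
  - by move=> w _; rewrite lee_fin.
  - exact/measurable_EFinP.
  - by apply: filterS fg => w h _; rewrite abse_EFin lee_fin.
have gfin : (\int[P]_w (g w)%:E)%E \is a fin_num by exact: integrable_fin_num.
have iF : P.-integrable setT (EFin \o f).
  apply/integrableP; split; first exact/measurable_EFinP.
  apply: le_lt_trans h _; rewrite -ge0_fin_numE//.
  by apply: integral_ge0 => w _; rewrite lee_fin.
split => //; rewrite /Rintegral; apply: fine_le => //.
by apply: integrable_fin_num => //; exact: (integrable_norm iF).
Qed.

(** By [comb_dominated] the third moment is of the order of the cube of the standard
    deviation, and the exponential weight at scale G is harmless when the standard
    deviation is a small multiple of G. *)
Lemma comb_sakhanenko : exists2 K : R, 0 < K & forall a b G : R, 0 <= a -> 0 <= b -> 0 < G ->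
  K * Num.sqrt (Q a b) <= G -> sakhanenko P G (fun w => a * u w - b * v w) (Q a b).
Proof.
have [ka ka0 kaP] := comb_dominated.
pose C3 := \int[P]_w (H w ^+ 3 * expR (e * H w)).
have C30 : 0 <= C3.
  by apply: Rintegral_ge0 => w _; rewrite mulr_ge0 ?exprn_ge0 ?expR_ge0.
have K0 : 0 < ka / e by rewrite divr_gt0.
have K1 : 0 <= ka ^+ 3 * C3 by rewrite mulr_ge0// exprn_ge0// ltW.
exists (ka / e + ka ^+ 3 * C3); first by rewrite ltr_wpDr.
move=> a b G a0 b0 G0 KG.
pose q := Num.sqrt (Q a b); have q0 : 0 <= q by rewrite sqrtr_ge0.
rewrite -/q mulrDl in KG.
have KG1 : ka * q <= e * G.
  rewrite [leRHS]mulrC -ler_pdivrMr// mulrAC; apply: le_trans KG.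
  by rewrite lerDl mulr_ge0.
have KG2 : ka ^+ 3 * C3 * q <= G.
  by apply: le_trans KG; rewrite lerDr mulr_ge0// ltW.
have mY : measurable_fun setT (fun w => a * u w - b * v w).
  by apply: measurable_funB; exact: measurable_funM.
(* KG1 keeps the exponent below e H, KG2 turns the bound ka^3 C3 q^3 into G q^2 *)
pose f w := `|a * u w - b * v w| ^+ 3 * expR (`|a * u w - b * v w| / G).
pose g w := (ka * q) ^+ 3 * (H w ^+ 3 * expR (e * H w)).
have f0 w : 0 <= f w by rewrite mulr_ge0 ?exprn_ge0 ?expR_ge0.
have ig : P.-integrable setT (EFin \o g) by exact: intZl.
have [] := @integrable_le_ae f g.
- apply: measurable_funM; first by apply: measurable_funX; exact: measurableT_comp.
  by apply: measurableT_comp => //; apply: measurable_funM => //; exact: measurableT_comp.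
- apply: measurable_funM => //; apply: measurable_funM; first exact: measurable_funX.
  by apply: measurableT_comp => //; exact: measurable_funM.
- apply: filterS (kaP a b a0 b0) => w; rewrite -/q => hw.
  rewrite ger0_norm// /f /g mulrA -exprMn; apply: ler_pM.
  + by rewrite exprn_ge0.
  + exact: expR_ge0.
  + by rewrite lerXn2r ?nnegrE// mulr_ge0// mulr_ge0// ltW.
  + rewrite ler_expR ler_pdivrMr//; apply: le_trans hw _.
    by rewrite [leRHS]mulrAC ler_wpM2r.
- by move=> w; rewrite !mulr_ge0 ?exprn_ge0 ?expR_ge0 ?mulr_ge0// ltW.
- exact: ig.
move=> iF hle; split => //.
- exact: comb_mean.
- exact: comb_square.
rewrite (_ : \int[P]_w _ = \int[P]_w `|f w|); last first.
  by apply: eq_Rintegral => w _; rewrite [RHS]ger0_norm.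
apply: le_trans hle _; rewrite /g RintegralZl// -/C3.
have -> : Q a b = q ^+ 2 by rewrite sqr_sqrtr// comb_var_ge0.
have -> : (ka * q) ^+ 3 * C3 = (ka ^+ 3 * C3 * q) * q ^+ 2 by ring.
by rewrite ler_wpM2r// sqr_ge0.
Qed.

End two_noises.

Section variance.
Context (R : realType) (s1 s2 r : R).
Hypotheses (s10 : 0 < s1) (s20 : 0 < s2).
Hypothesis r_range : (-1 <= r < 1) \/ (r = 1 /\ s1 <> s2).

(** The square of [V_ m n], with the parameters explicit. *)
Definition two_var (m n : nat) : R :=
  n%:R^-1 * s1 ^+ 2 + m%:R^-1 * s2 ^+ 2 - 2 * r * s1 * s2 * ((minn m n)%:R / (m%:R * n%:R)).

(** Multiplied by the smaller of the two indices, [two_var] is an affine function of the ratio of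
    the smaller index to the larger one.  At the ends of [0, 1] it equals one of the two
    variances and s1^2 + s2^2 - 2 r s1 s2, which are positive. *)
Lemma two_var_lower : exists2 c : R, 0 < c &
  forall m n, (0 < m)%N -> (0 < n)%N -> c / (minn m n)%:R <= two_var m n.
Proof.
pose D := s1 ^+ 2 + s2 ^+ 2 - 2 * r * s1 * s2.
have D0 : 0 < D.
  have -> : D = (s1 - s2) ^+ 2 + 2 * (1 - r) * (s1 * s2) by rewrite /D; ring.
  case: r_range => [/andP[_ r1]|[-> ne]].
    by rewrite ltr_wpDl ?sqr_ge0// !mulr_gt0// subr_gt0.
  rewrite subrr mulr0 mul0r addr0 lt_def sqr_ge0 andbT sqrf_eq0 subr_eq0.
  exact/eqP.
exists (Num.min D (Num.min (s1 ^+ 2) (s2 ^+ 2))).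
  by rewrite !lt_min D0 !exprn_gt0.
set c := Num.min _ _ => m n m0 n0.
have cD : c <= D by rewrite ge_min lexx.
have c1 : c <= s1 ^+ 2 by rewrite !ge_min lexx orbT.
have c2 : c <= s2 ^+ 2 by rewrite !ge_min lexx !orbT.
have mR : 0 < m%:R :> R by rewrite ltr0n.
have nR : 0 < n%:R :> R by rewrite ltr0n.
have key (x y k N : R) : 0 < N -> N <= k -> c <= x -> c <= x + y ->
    c / N <= N^-1 * x + k^-1 * y.
  move=> N0 Nk cx cxy; have k0 : 0 < k by lra.
  rewrite -(ler_pM2r (mulr_gt0 N0 k0)).
  have -> : c / N * (N * k) = c * k by field; rewrite gt_eqF.
  have -> : (N^-1 * x + k^-1 * y) * (N * k) = k * x + N * y by field; rewrite !gt_eqF.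
  nra.
rewrite /two_var; have [mn|nm] := leqP m n.
  have := key (s2 ^+ 2) (s1 ^+ 2 - 2 * r * s1 * s2) n%:R m%:R mR.
  rewrite ler_nat => /(_ mn c2) h; apply: (le_trans (h _)).
    by move: cD; rewrite /D; lra.
  rewrite le_eqVlt; apply/orP; left; apply/eqP; field; by rewrite !gt_eqF.
have := key (s1 ^+ 2) (s2 ^+ 2 - 2 * r * s1 * s2) m%:R n%:R nR.
rewrite ler_nat => /(_ (ltnW nm) c1) h; apply: (le_trans (h _)).
  by move: cD; rewrite /D; lra.
rewrite le_eqVlt; apply/orP; left; apply/eqP; field; by rewrite !gt_eqF.
Qed.

Lemma comb_var_sum (al be : R) (m n : nat) :
  \sum_(i < maxn m n) comb_var s1 s2 r (al * (i < n)%N%:R) (be * (i < m)%N%:R) =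
  al ^+ 2 * s1 ^+ 2 * n%:R + be ^+ 2 * s2 ^+ 2 * m%:R
   - 2 * r * (al * s1) * (be * s2) * (minn m n)%:R.
Proof.
have cnt (k K : nat) : (k <= K)%N -> \sum_(i < K) ((i < k)%N%:R : R) = k%:R.
  move=> kK; rewrite -(subnKC kK) big_split_ord/= [X in _ + X]big1 ?addr0; last first.
    by move=> i _; rewrite ltnNge leq_addr.
  rewrite (eq_bigr (fun=> 1)); last by move=> i _; rewrite ltn_ord.
  by rewrite sumr_const card_ord.
rewrite /comb_var sumrB big_split/=.
congr (_ + _ - _).
- rewrite -(cnt n (maxn m n)) ?leq_maxr// mulr_sumr; apply: eq_bigr => i _.
  by case: (i < n)%N => /=; ring.
- rewrite -(cnt m (maxn m n)) ?leq_maxl// mulr_sumr; apply: eq_bigr => i _.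
  by case: (i < m)%N => /=; ring.
- rewrite -(cnt (minn m n) (maxn m n)) ?(leq_trans (geq_minl _ _)) ?leq_maxl//.
  rewrite mulr_sumr; apply: eq_bigr => i _; rewrite leq_min.
  by case: (i < m)%N; case: (i < n)%N => /=; ring.
Qed.

Lemma comb_var_le a b : 0 <= a -> 0 <= b ->
  Num.sqrt (comb_var s1 s2 r a b) <= a * s1 + b * s2.
Proof.
move=> a0 b0.
have r1 : -1 <= r by case: r_range => [/andP[]//|[-> _]]; lra.
have x0 : 0 <= a * s1 by rewrite mulr_ge0// ltW.
have y0 : 0 <= b * s2 by rewrite mulr_ge0// ltW.
rewrite -[leRHS]ger0_norm ?addr_ge0// -sqrtr_sqr ler_sqrt ?sqr_ge0//.
rewrite /comb_var -!exprMn; move: (a * s1) (b * s2) x0 y0 => x y x0 y0.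
have : 0 <= (1 + r) * (x * y) by rewrite !mulr_ge0//; lra.
nra.
Qed.

End variance.

Lemma expR1_le4 (R : realType) : expR 1 <= 4 :> R.
Proof.
have h : 1 - 2^-1 <= expR (- 2^-1) :> R by exact: expR_ge1Dx.
have -> : (4 : R) = (1 - 2^-1) ^- 2 by field.
have -> : expR 1 = (expR (- 2^-1)) ^- 2 :> R.
  by rewrite -expRM_natl -expRN; congr expR; field.
rewrite lef_pV2 ?posrE ?exprn_gt0 ?expR_gt0//; last lra.
by rewrite lerXn2r ?nnegrE ?expR_ge0//; lra.
Qed.

(** Passing from Y to W costs a shift of x by th / (x + 1).  Since x times the shift is at
    most 1, the density between the shifted points is comparable with that at x, and the
    tail varies by a fraction of order th. *)
Lemma perturb_ratio d (T : measurableType d) (R : realType) (P : probability T R)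
  (Y W : T -> R) (A th x : R) : measurable_fun setT Y -> measurable_fun setT W ->
  0 <= A -> 0 < th <= 1 -> 0 <= x ->
  (forall y, x - 1 <= y <= x + 1 ->
    `|fine (P [set w | y <= Y w]) - Phib y| <= A * th * Phib y) ->
  fine (P [set w | th / (x + 1) < `|W w - Y w|]) <= th * Phib x ->
  `|fine (P [set w | x <= W w]) / Phib x - 1| <= (13 + 13 * A) * th.
Proof.
move=> mY mW A0 /andP[th0 th1] x0 HY HD.
set eta := th / (x + 1) in HD.
have x1 : 0 < x + 1 by lra.
have eta0 : 0 < eta by rewrite divr_gt0.
have eta1 : eta <= 1 by rewrite ler_pdivrMr// mul1r; lra.
have w1 : x - 1 <= x - eta <= x + 1 by apply/andP; split; lra.
have w2 : x - 1 <= x + eta <= x + 1 by apply/andP; split; lra.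
have v1 : x - eta <= x - eta <= x + eta by apply/andP; split; lra.
have v2 : x - eta <= x + eta <= x + eta by apply/andP; split; lra.
have xeta : x * eta <= 1.
  by rewrite mulrA ler_pdivrMr//; nra.
have Px : 0 < Phib x by apply: Phib_gt0; lra.
set E := expR (- x ^+ 2 / 2).
have E0 : 0 < E by exact: expR_gt0.
have PE : E / (3 * (x + 2)) <= Phib x.
  apply: le_trans (Phib_ge _); last lra.
  have /andP[h _] := phi_bounds x; rewrite invfM mulrA ler_wpM2r ?invr_ge0//; first lra.
  by rewrite mulrC.
have lip y : x - eta <= y <= x + eta -> `|Phib y - Phib x| <= 12 * th * Phib x.
  move=> /andP[y1 y2].
  have yx : `|y - x| <= eta by rewrite ler_norml; apply/andP; split; lra.
  apply: (le_trans (Phib_lip (M := 2 * E) _)).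
    move=> c cyx; have /andP[_ h] := phi_bounds c; apply: (le_trans h).
    have hc : expR (- c ^+ 2 / 2) <= expR 1 * E.
      rewrite -expRD ler_expR.
      have /andP[c1 c2] : x - eta <= c <= x + eta.
        move: cyx; rewrite ge_min le_max => /andP[/orP h1 /orP h2].
        by apply/andP; split; [case: h1|case: h2]; lra.
      have : (x - c) * x <= eta * x by rewrite ler_wpM2r//; lra.
      have := sqr_ge0 (x - c); move: xeta; lra.
    have := ler_wpM2r (ltW E0) (expR1_le4 R); lra.
  apply: (@le_trans _ _ (2 * E * eta)).
    by rewrite ler_wpM2l// mulr_ge0// ltW.
  apply: (@le_trans _ _ (12 * th * (E / (3 * (x + 2))))); last first.
    by rewrite ler_wpM2l// mulr_ge0// ltW.
  rewrite /eta; rewrite mulrA ler_pdivrMr// [X in _ <= X]mulrAC mulrA ler_pdivlMr; last lra.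
  have : 0 <= E * th * x by rewrite !mulr_ge0// ltW.
  lra.
have mset (f : T -> R) y : measurable_fun setT f -> measurable [set w | y <= f w].
  exact: measurable_ge.
have mD : measurable [set w | eta < `|W w - Y w|].
  by apply: measurable_gt; apply: measurableT_comp => //; exact: measurable_funB.
have fin (B : set T) : measurable B -> P B \is a fin_num by move=> mB; exact: fin_num_measure.
have sub (y z : R) (f g : T -> R) : measurable_fun setT f -> measurable_fun setT g ->
    [set w | y <= f w] `<=` [set w | z <= g w] `|` [set w | eta < `|W w - Y w|] ->
    fine (P [set w | y <= f w]) <= fine (P [set w | z <= g w]) + th * Phib x.
  move=> mf mg fg; apply: le_trans (lerD (lexx _) HD).
  have f1 := fin _ (mset f y mf); have f2 := fin _ (mset g z mg); have f3 := fin _ mD.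
  rewrite -lee_fin EFinD (fineK f1) (fineK f2) (fineK f3).
  apply: le_trans (measureU2 P (mset g z mg) mD).
  by apply: le_measure => //; rewrite inE; [exact: mset|apply: measurableU mD; exact: mset].
have up : fine (P [set w | x <= W w]) <= fine (P [set w | x - eta <= Y w]) + th * Phib x.
  apply: sub => // w /= xW; have [h|h] := leP `|W w - Y w| eta; [left|by right].
  by move: h; rewrite ler_norml => /andP[_ h] /=; lra.
have lo : fine (P [set w | x + eta <= Y w]) <= fine (P [set w | x <= W w]) + th * Phib x.
  apply: sub => // w /= xW; have [h|h] := leP `|W w - Y w| eta; [left|by right].
  by move: h; rewrite ler_norml => /andP[h _] /=; lra.
have HY1 := HY _ w1; have HY2 := HY _ w2; have L1 := lip _ v1; have L2 := lip _ v2.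
move: up lo HY1 HY2 L1 L2; rewrite !ler_norml.
move: (fine (P [set w | x - eta <= Y w])) (fine (P [set w | x + eta <= Y w])).
move: (fine (P [set w | x <= W w])) (Phib (x - eta)) (Phib (x + eta)) => p pm pp fm fp.
move=> up lo /andP[_ b1] /andP[b2 _] /andP[_ b3] /andP[b4 b5].
have thP : th * Phib x <= Phib x by rewrite ler_piMl// ltW.
have pm10 : A * th * pm <= A * th * (13 * Phib x).
  by rewrite ler_wpM2l ?mulr_ge0//; [rewrite ltW|lra].
have pp10 : A * th * pp <= A * th * (13 * Phib x).
  by rewrite ler_wpM2l ?mulr_ge0//; [rewrite ltW|lra].
have -> : p / Phib x - 1 = (p - Phib x) / Phib x by rewrite mulrBl mulfV// gt_eqF.
by rewrite ler_pdivlMr// ler_pdivrMr//; apply/andP; split; lra.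
Qed.

(** * The standardised difference of the two processes *)

Lemma cramer_const_ge0 (R : realType) : 0 <= cramer_const :> R.
Proof.
apply: mulr_ge0; last exact: expR_ge0.
by apply: mulr_ge0; [exact: ler0n|exact: step_const_ge0].
Qed.

Lemma shift_window (R : realType) (x y : R) : 0 <= x -> x - 1 <= y -> y <= x + 1 ->
  0 <= y + 2 /\ y + 2 <= x + 3.
Proof. by move=> x0 y1 y2; split; lra. Qed.

Lemma sakhanenkoN d (T : measurableType d) (R : realType) (P : probability T R)
  (G : R) (Y : T -> R) (s2 : R) : P.-integrable setT (EFin \o Y) ->
  sakhanenko P G Y s2 -> sakhanenko P G (fun w => - Y w) s2.
Proof.
move=> iY [mY iE m1 m2 m3]; have nE w : `|- Y w| = `|Y w| by rewrite normrN.
split.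
- exact: measurableT_comp.
- by apply: eq_integrable iE => // w _ /=; rewrite nE.
- under eq_Rintegral do rewrite -mulN1r.
  by rewrite RintegralZl// m1 mulr0.
- by under eq_Rintegral do rewrite sqrrN.
- by under eq_Rintegral do rewrite nE.
Qed.

Section iid_transfer.
Context d (T : measurableType d) (R : realType) (P : probability T R).
Variable xi : nat -> {RV P >-> (R * R)%type}.
Hypothesis xi_iid : iid xi.

(** [past_indep_integral] with a constant in place of the past covers nonnegative f; the
    general case follows by taking positive and negative parts. *)
Lemma iid_integral n (f : R * R -> \bar R) : measurable_fun setT f ->
  (\int[P]_w f (xi n w) = \int[P]_w f (xi 0%N w))%E.
Proof.
have nonneg (g : R * R -> \bar R) : measurable_fun setT g -> (forall x, 0 <= g x)%E ->
    (\int[P]_w g (xi n w) = \int[P]_w g (xi 0%N w))%E.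
  move=> mg g0.
  have := past_indep_integral xi_iid (n := n) (f := cst 1%E) (measurable_cst _) (fun _ => lee01) mg g0.
  rewrite (integral_prob1 P) mul1e => <-; apply: eq_integral => w _ /=; by rewrite mul1e.
move=> mf; rewrite integralE [RHS]integralE.
have -> : ((fun w => f (xi n w))^\+ = fun w => f^\+ (xi n w))%E by apply/funext => w; rewrite ?funeposE ?funenegE.
have -> : ((fun w => f (xi 0%N w))^\+ = fun w => f^\+ (xi 0%N w))%E by apply/funext => w; rewrite ?funeposE ?funenegE.
have -> : ((fun w => f (xi n w))^\- = fun w => f^\- (xi n w))%E by apply/funext => w; rewrite ?funeposE ?funenegE.
have -> : ((fun w => f (xi 0%N w))^\- = fun w => f^\- (xi 0%N w))%E by apply/funext => w; rewrite ?funeposE ?funenegE.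
rewrite !nonneg//; [exact: measurable_funeneg|exact: measurable_funepos].
Qed.

Lemma sakhanenko_iid n (f : R * R -> R) G s2 : measurable_fun setT f ->
  sakhanenko P G (fun w => f (xi 0%N w)) s2 -> sakhanenko P G (fun w => f (xi n w)) s2.
Proof.
move=> mf [_ iE m1 m2 m3].
have mxi i : measurable_fun setT (xi i) by exact: measurable_funP.
have ri (g : R * R -> R) : measurable_fun setT g ->
    \int[P]_w g (xi n w) = \int[P]_w g (xi 0%N w).
  move=> mg; congr fine; apply: (@iid_integral n (EFin \o g)).
  exact/measurable_EFinP.
pose g x := `|f x| ^+ 3 * expR (`|f x| / G).
have mn : measurable_fun setT (fun x => `|f x|) by exact: measurableT_comp.
have mg : measurable_fun setT g.
  apply: measurable_funM; first exact: measurable_funX.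
  by apply: measurableT_comp => //; exact: measurable_funM.
split.
- exact: measurableT_comp.
- move/integrableP: iE => [_ h]; apply/integrableP; split.
    by apply/measurable_EFinP; exact: (measurableT_comp mg (mxi n)).
  have := @iid_integral n (fun x => `|(g x)%:E|)%E => /(_ _)/wrap[|->//].
  by apply: measurableT_comp => //; exact/measurable_EFinP.
- by rewrite (ri f).
- by rewrite (ri (fun x => f x ^+ 2))//; exact: measurable_funX.
- by rewrite (ri g).
Qed.

(** The hypothesis of independence of [cramer], for increments that are functions of the
    successive environments. *)
Lemma partial_sum_indep (f : nat -> R * R -> R) : (forall i, measurable_fun setT (f i)) ->
  forall i A B, measurable A -> measurable B ->
  P ((fun w => \sum_(j < i) f j (xi j w))%R @^-1` A `&` (fun w => f i (xi i w)) @^-1` B) =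
  (P ((fun w => \sum_(j < i) f j (xi j w))%R @^-1` A) * P ((fun w => f i (xi i w)) @^-1` B))%E.
Proof.
move=> mf i A B mA mB.
have mS : measurable_fun (setT : set (g_sigma_algebraType (past xi i)))
    (fun w => \sum_(j < i) f j (xi j w)).
  apply: measurable_sum => j.
  have mx : measurable_fun (setT : set (g_sigma_algebraType (past xi i))) (xi j).
    by apply: xi_past; exact: ltn_ord.
  exact: (measurableT_comp (mf j) mx).
have sA := mS measurableT A mA; rewrite setTI in sA.
have mB' : measurable (f i @^-1` B) by rewrite -[X in measurable X]setTI; exact: mf.
exact: (past_indep xi_iid sA mB').
Qed.

End iid_transfer.

Section two_processes.
Context d (T : measurableType d) (R : realType) (P : probability T R).
Variable xi : nat -> {RV P >-> (R * R)%type}.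
Variable p : R.-pker R ~> nat.
Variable X : bool -> nat -> nat -> {RV P >-> nat}.
Hypothesis xi_iid : iid xi.
Hypothesis X_law : offspring_given_env xi p X.
Hypothesis good_env0 : forall l, {ae P, forall w, good p (env xi l 0 w)}.
Hypothesis sigma_pos_fin : forall l, (0 < 'V_P[M_ xi p l 0] < +oo)%E.
Variables lambda0 q0 : R.
Hypothesis lambda0_gt0 : 0 < lambda0.
Hypothesis exp_fin : forall l, (\int[P]_w (expR (lambda0 * M_ xi p l 0 w))%:E < +oo)%E.
Hypothesis q0_gt1 : 1 < q0.
Hypothesis Zq_fin : forall l, (\int[P]_w ((Z X l 1 w)%:R `^ q0 / m_ xi p l 0 w)%:E < +oo)%E.
Hypothesis rho_range : (-1 <= rho_ xi p < 1) \/
    (rho_ xi p = 1 /\ sigma_ xi p false <> sigma_ xi p true).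

Let M l := M_ xi p l 0.
Let cM l w := M l w - mu_ xi p l.

Let mM l : measurable_fun setT (M l).
Proof. by have := @measurable_M _ _ _ _ xi p l 0 => /past_env/env_meas. Qed.

Let mcM l : measurable_fun setT (cM l).
Proof. exact: measurable_funB. Qed.

Lemma integrable_exp_centered l :
  P.-integrable setT (EFin \o (fun w => expR (lambda0 * `|cM l w|))).
Proof.
pose g w := expR (lambda0 * `|mu_ xi p l|) * expR (lambda0 * M l w).
have mE : measurable_fun setT (fun w => expR (lambda0 * M l w)).
  by apply: measurableT_comp => //; exact: measurable_funM.
have ig : P.-integrable setT (EFin \o g).
  apply: intZl; apply/integrableP; split; first exact/measurable_EFinP.
  by under eq_integral do rewrite gee0_abs ?lee_fin ?expR_ge0//; exact: exp_fin.
have mf : measurable_fun setT (fun w => expR (lambda0 * `|cM l w|)).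
  apply: measurableT_comp => //; apply: measurable_funM => //; exact: measurableT_comp.
have [] := @integrable_le_ae _ T R P _ g mf _ _ _ ig => //.
- exact: measurable_funM.
- apply: filterS (good_env0 l) => w gw.
  have [_ _ M0 _] := good_mean gw.
  have {}M0 : 0 <= M l w by exact: M0.
  rewrite ger0_norm ?expR_ge0// /g -expRD ler_expR -mulrDr ler_wpM2l ?(ltW lambda0_gt0)//.
  by apply: (le_trans (ler_normB _ _)); rewrite addrC (ger0_norm M0).
- by move=> w; rewrite mulr_ge0 ?expR_ge0.
Qed.

Lemma integrable_M l : P.-integrable setT (EFin \o M l).
Proof.
have ig := intZl lambda0^-1 (integrable_exp_centered l).
have iC : P.-integrable setT (EFin \o cM l).
  apply: (integrable_le _ _ ig) => // w.
  rewrite ler_pdivlMl//.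
  by apply: le_trans (expR_ge1Dx _); rewrite lerDr.
have := intD iC (integrable_fin_cst P (mu_ xi p l)).
by apply: eq_integrable => // w _ /=; rewrite /cM subrK.
Qed.

Lemma mean_centered l : \int[P]_w cM l w = 0.
Proof.
rewrite /cM (RintegralB _ (integrable_M l) (integrable_fin_cst P (mu_ xi p l)))//.
rewrite Rintegral1 /mu_ unlock /Rintegral; exact: subrr.
Qed.

Lemma sigma_gt0 l : 0 < sigma_ xi p l.
Proof. by rewrite sqrtr_gt0; have /andP[v0 voo] := sigma_pos_fin l; exact: fine_gt0. Qed.

Lemma covariance_centered l l' :
  fine (covariance P (M l) (M l')) = \int[P]_w (cM l w * cM l' w).
Proof. by rewrite /cM /mu_ covariance.unlock expectation.unlock. Qed.

Lemma square_centered l : \int[P]_w (cM l w ^+ 2) = sigma_ xi p l ^+ 2.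
Proof.
rewrite sqr_sqrtr; last by have /andP[v0 _] := sigma_pos_fin l; exact/fine_ge0/ltW.
by rewrite /variance covariance_centered; apply: eq_Rintegral => w _; rewrite expr2.
Qed.

Lemma product_centered : \int[P]_w (cM false w * cM true w) =
  rho_ xi p * sigma_ xi p false * sigma_ xi p true.
Proof.
rewrite -covariance_centered /rho_ -mulrA divfK//.
by rewrite mulf_neq0// gt_eqF ?sigma_gt0.
Qed.

Lemma ae_Rintegral (f g : T -> R) : measurable_fun setT f -> measurable_fun setT g ->
  {ae P, forall w, f w = g w} -> \int[P]_w f w = \int[P]_w g w.
Proof.
move=> mf mg fg; congr fine; apply: ae_eq_integral => //; [exact/measurable_EFinP|exact/measurable_EFinP|].
by apply: filterS fg => w -> _.
Qed.

Lemma M_nondeg l : ~ {ae P, forall w, M l w = 0}.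
Proof.
move=> M0; have mc c : measurable_fun setT (fun _ : T => c : R) by exact: measurable_cst.
have := mean_centered l; rewrite (ae_Rintegral (mcM l) (mc (- mu_ xi p l))); last first.
  by apply: filterS M0 => w Mw; rewrite /cM Mw sub0r.
rewrite Rintegral1 => /eqP; rewrite oppr_eq0 => /eqP mu0.
have := square_centered l; rewrite (@ae_Rintegral _ (fun=> 0)) ?Rintegral1//; last 2 first.
- exact: measurable_funX.
- by apply: filterS M0 => w Mw; rewrite /cM Mw mu0 subrr expr0n.
by move=> /eqP; rewrite eq_sym sqrf_eq0 gt_eqF ?sigma_gt0.
Qed.

Lemma log_deviations : exists C c : R, [/\ 0 < C, 0 < c & forall l n t, 0 <= t ->
  (P [set w | (t < `|ln (Z X l n w)%:R - S_ xi p l n w|)%R] <= (C * expR (- (c * t)))%:E)%E].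
Proof.
have H l := log_deviation xi_iid X_law (good_env0 l) (@M_nondeg l) q0_gt1 (Zq_fin l)
  lambda0_gt0 (exp_fin l).
have [C1 [c1 [C10 c10 H1]]] := H false; have [C2 [c2 [C20 c20 H2]]] := H true.
exists (C1 + C2), (Num.min c1 c2); split; [lra|by rewrite lt_min c10|].
have mono (C c t : R) : 0 <= t -> 0 < C -> C <= C1 + C2 -> Num.min c1 c2 <= c ->
    (C * expR (- (c * t)) <= (C1 + C2) * expR (- (Num.min c1 c2 * t))).
  move=> t0 C0 hC hc; apply: ler_pM => //; rewrite ?expR_ge0 ?(ltW C0)//.
  by rewrite ler_expR lerN2 ler_wpM2r.
case=> n t t0; [apply: le_trans (H2 _ _ t0) _|apply: le_trans (H1 _ _ t0) _]; rewrite lee_fin.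
  by apply: mono => //; [lra|rewrite ge_min lexx orbT].
by apply: mono => //; [lra|rewrite ge_min lexx].
Qed.

Let noise (al be : R) (x : R * R) : R :=
  al * (log_mean p x.1 - mu_ xi p false) - be * (log_mean p x.2 - mu_ xi p true).

Let measurable_noise al be : measurable_fun setT (noise al be).
Proof.
have ml := measurable_log_mean p.
apply: measurable_funB; apply: measurable_funM => //; apply: measurable_funB => //.
  exact: (measurableT_comp ml measurable_fst).
exact: (measurableT_comp ml measurable_snd).
Qed.

Lemma noise_sakhanenko : exists2 K : R, 0 < K & forall n (al be G : R) (b : bool),
  0 <= al -> 0 <= be -> 0 < G ->
  K * Num.sqrt (comb_var (sigma_ xi p false) (sigma_ xi p true) (rho_ xi p) al be) <= G ->
  sakhanenko P G (fun w => (-1) ^+ b * noise al be (xi n w))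
    (comb_var (sigma_ xi p false) (sigma_ xi p true) (rho_ xi p) al be).
Proof.
have r1 : rho_ xi p <= 1 by case: rho_range => [/andP[_ /ltW]|[->]].
have [K K0 HK] := comb_sakhanenko (mcM false) (mcM true) lambda0_gt0
  (integrable_exp_centered false) (integrable_exp_centered true)
  (sigma_gt0 false) (sigma_gt0 true) (mean_centered false) (mean_centered true)
  (square_centered false) (square_centered true) product_centered r1.
exists K => // n al be G b al0 be0 G0 KG.
have H0 := HK al be G al0 be0 G0 KG.
have iY : P.-integrable setT (EFin \o (fun w => al * cM false w - be * cM true w)).
  have iC l : P.-integrable setT (EFin \o cM l).
    exact: intB (integrable_M l) (integrable_fin_cst P (mu_ xi p l)).
  by apply: intB; exact: intZl.
pose f x := (-1) ^+ b * noise al be x.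
apply: (@sakhanenko_iid _ T R P xi xi_iid n f); first exact: measurable_funM.
case: b @f; last first.
  by move=> f; rewrite /f expr0; under eq_fun do rewrite mul1r.
move=> f; rewrite /f expr1; under eq_fun do rewrite mulN1r.
exact: (sakhanenkoN iY H0).
Qed.

Lemma sum_trunc (n k : nat) (g : nat -> R) : (n <= k)%N ->
  \sum_(j < k) (j < n)%N%:R * g j = \sum_(j < n) g j.
Proof.
move=> nk; rewrite -(subnKC nk) big_split_ord/= [X in _ + X]big1 ?addr0; last first.
  by move=> i _; rewrite ltnNge leq_addr mul0r.
by apply: eq_bigr => i _; rewrite ltn_ord mul1r.
Qed.

Lemma sum_noise (m n : nat) (al be : R) w :
  \sum_(j < maxn m n) noise (al * (j < n)%N%:R) (be * (j < m)%N%:R) (xi j w) =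
  al * (S_ xi p false n w - n%:R * mu_ xi p false)
  - be * (S_ xi p true m w - m%:R * mu_ xi p true).
Proof.
rewrite /noise sumrB; congr (_ - _).
  under eq_bigr do rewrite -mulrA.
  rewrite -mulr_sumr (sum_trunc (fun j => log_mean p (xi j w).1 - mu_ xi p false)) ?leq_maxr//.
  by rewrite sumrB sumr_const card_ord mulr_natl.
under eq_bigr do rewrite -mulrA.
rewrite -mulr_sumr (sum_trunc (fun j => log_mean p (xi j w).2 - mu_ xi p true)) ?leq_maxl//.
by rewrite sumrB sumr_const card_ord mulr_natl.
Qed.

(** The sign makes the same bound serve for the two tails.  The scale of the increments
    and the typical size of the deviations of ln Z - S are both of order
    1 / sqrt (min m n), by [two_var_lower]. *)
Lemma clt_bound : exists K C c : R, [/\ 0 < K, 0 < C, 0 < c &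
  forall (m n : nat) (b : bool) (th x : R), (0 < m)%N -> (0 < n)%N -> 0 < th <= 1 -> 0 <= x ->
  K / Num.sqrt (minn m n)%:R * (x + 3) ^+ 3 <= th ^+ 2 ->
  C * expR (- (c * (th / (x + 1)) * Num.sqrt (minn m n)%:R)) <= th * Phib x ->
  `|fine (P [set w | x <= (-1) ^+ b * R_ xi p X m n w]) / Phib x - 1|
    <= (13 + 13 * cramer_const) * th].
Proof.
set s1 := sigma_ xi p false; set s2 := sigma_ xi p true; set r := rho_ xi p.
have s10 : 0 < s1 := sigma_gt0 false; have s20 : 0 < s2 := sigma_gt0 true.
have [cv cv0 Hcv] := two_var_lower s10 s20 rho_range.
have [K K0 HK] := noise_sakhanenko; have [C [c [C0 c0 Hdev]]] := log_deviations.
have scv : 0 < Num.sqrt cv by rewrite sqrtr_gt0.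
exists (K * (s1 + s2) / Num.sqrt cv), (2 * C), (c * Num.sqrt cv / 2).
split; [by rewrite divr_gt0 ?mulr_gt0 ?addr_gt0|by rewrite mulr_gt0|by rewrite divr_gt0 ?mulr_gt0|].
move=> m n b th x m0 n0 th01 x0 HKx HCx; have /andP[th0 th1] := th01.
set N := (minn m n)%:R in HKx HCx.
have N0 : 0 < N :> R by rewrite ltr0n leq_min m0.
have nR : 0 < n%:R :> R by rewrite ltr0n.
have mR : 0 < m%:R :> R by rewrite ltr0n.
have V2ge : cv / N <= two_var s1 s2 r m n by exact: Hcv.
have V20 : 0 < two_var s1 s2 r m n by apply: lt_le_trans V2ge; rewrite divr_gt0.
pose V := V_ xi p m n.
have VE : V = Num.sqrt (two_var s1 s2 r m n) by [].
have V0 : 0 < V by rewrite VE sqrtr_gt0.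
have VV : V ^+ 2 = two_var s1 s2 r m n by rewrite VE sqr_sqrtr// ltW.
pose sq := Num.sqrt cv * Num.sqrt N.
have sN : 0 < Num.sqrt N by rewrite sqrtr_gt0.
have sq0 : 0 < sq by rewrite mulr_gt0.
have sqNV : sq <= N * V.
  rewrite -(ler_pXn2r (ltn0Sn 1)) ?nnegrE ?(ltW sq0)//; last by rewrite mulr_ge0 ?ltW.
  rewrite /sq exprMn !sqr_sqrtr ?(ltW cv0) ?(ltW N0)// exprMn VV.
  have -> : cv * N = N ^+ 2 * (cv / N) by field; rewrite gt_eqF.
  by rewrite ler_wpM2l// sqr_ge0.
pose al := (n%:R * V)^-1; pose be := (m%:R * V)^-1.
have al0 : 0 < al by rewrite invr_gt0 mulr_gt0.
have be0 : 0 < be by rewrite invr_gt0 mulr_gt0.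
have alq : al <= sq^-1.
  rewrite lef_pV2 ?posrE ?mulr_gt0//; apply: le_trans sqNV _.
  by rewrite ler_wpM2r ?(ltW V0)// ler_nat geq_minr.
have beq : be <= sq^-1.
  rewrite lef_pV2 ?posrE ?mulr_gt0//; apply: le_trans sqNV _.
  by rewrite ler_wpM2r ?(ltW V0)// ler_nat geq_minl.
pose G := K * ((s1 + s2) / sq).
have G0 : 0 < G by rewrite mulr_gt0// divr_gt0// addr_gt0.
pose aa (i : nat) := al * (i < n)%N%:R; pose bb (i : nat) := be * (i < m)%N%:R.
have aa0 i : 0 <= aa i by rewrite mulr_ge0// ltW.
have bb0 i : 0 <= bb i by rewrite mulr_ge0// ltW.
pose f i x := (-1) ^+ b * noise (aa i) (bb i) x.
have mf i : measurable_fun setT (f i) by exact: measurable_funM.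
have sX i : sakhanenko P G (fun w => f i (xi i w)) (comb_var s1 s2 r (aa i) (bb i)).
  apply: HK => //; rewrite ler_wpM2l ?(ltW K0)//.
  apply: (le_trans (comb_var_le s10 s20 rho_range (aa0 i) (bb0 i))).
  rewrite [leRHS]mulrDl; apply: lerD.
    rewrite mulrC ler_wpM2l ?(ltW s10)//; apply: le_trans alq.
    by rewrite ler_piMr ?(ltW al0)//; case: (i < n)%N.
  rewrite mulrC ler_wpM2l ?(ltW s20)//; apply: le_trans beq.
  by rewrite ler_piMr ?(ltW be0)//; case: (i < m)%N.
have V1 : \sum_(j < maxn m n) comb_var s1 s2 r (aa j) (bb j) = 1.
  rewrite comb_var_sum.
  have -> : al ^+ 2 * s1 ^+ 2 * n%:R + be ^+ 2 * s2 ^+ 2 * m%:R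
      - 2 * r * (al * s1) * (be * s2) * (minn m n)%:R = two_var s1 s2 r m n / V ^+ 2.
    by rewrite /al /be /two_var; field; rewrite !gt_eqF.
  by rewrite -VV mulfV// expf_neq0// gt_eqF.
have cr := cramer G0 sX (partial_sum_indep xi_iid mf) V1.
pose Y w := \sum_(j < maxn m n) f j (xi j w).
have mY : measurable_fun setT Y.
  apply: measurable_sum => j.
  by have mx : measurable_fun setT (xi j) by []; exact: (measurableT_comp (mf j) mx).
have mL l k := measurable_of_Z l X_law k (fun z => ln z%:R : R).
have mR' : measurable_fun setT (R_ xi p X m n).
  apply: measurable_funM => //; apply: measurable_funB => //.
  by apply: measurable_funB; exact: measurable_funM.
apply: (perturb_ratio mY) => //.
- exact: measurable_funM.
- exact: cramer_const_ge0.
- move=> y /andP[y1 y2]; apply: cr => //; first lra.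
  apply: le_trans HKx.
  have -> : K * (s1 + s2) / Num.sqrt cv / Num.sqrt N = G.
    by rewrite /G /sq invfM !mulrA.
  have [y3 yx] := shift_window x0 y1 y2.
  apply: ler_wpM2l; first exact: ltW.
  by apply: lerXn2r => //; rewrite nnegrE// (le_trans y3).
apply: le_trans HCx.
set eta := th / (x + 1).
have eta0 : 0 < eta by rewrite divr_gt0//; lra.
pose D l k := [set w | eta / 2 * sq < `|ln (Z X l k w)%:R - S_ xi p l k w|].
have mS l k := measurable_ST xi p l k.
have mD l k : measurable (D l k).
  by apply: measurable_gt; apply: measurableT_comp => //; exact: measurable_funB.
have YE w : Y w = (-1) ^+ b * (al * (S_ xi p false n w - n%:R * mu_ xi p false)
  - be * (S_ xi p true m w - m%:R * mu_ xi p true)).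
  by rewrite -sum_noise mulr_sumr.
have t0 : 0 <= eta / 2 * sq by apply: mulr_ge0; [apply: divr_ge0 => //; exact: ltW|exact: ltW].
have mT : measurable [set w | eta < `|(-1) ^+ b * R_ xi p X m n w - Y w|].
  apply: measurable_gt; apply: measurableT_comp => //; apply: measurable_funB => //.
  exact: measurable_funM.
have fT : P [set w | eta < `|(-1) ^+ b * R_ xi p X m n w - Y w|] \is a fin_num.
  exact: fin_num_measure.
rewrite -lee_fin fineK//.
apply: (@le_trans _ _ (P (D false n `|` D true m))).
  apply: le_measure; rewrite ?inE//; first exact: measurableU.
  move=> w /=; rewrite YE -mulrBr normrM normrX normrN1 expr1n mul1r.
  have -> : R_ xi p X m n w - (al * (S_ xi p false n w - n%:R * mu_ xi p false)
    - be * (S_ xi p true m w - m%:R * mu_ xi p true)) =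
    al * (ln (Z X false n w)%:R - S_ xi p false n w)
    - be * (ln (Z X true m w)%:R - S_ xi p true m w).
    by rewrite /R_ -/V /al /be; field; rewrite !gt_eqF.
  move=> h; have [h1|h1] := ltP (eta / 2 * sq) `|ln (Z X false n w)%:R - S_ xi p false n w|.
    by left.
  right; rewrite /D /= ltNge; apply/negP => h2; move: h; apply/negP; rewrite -leNgt.
  apply: (le_trans (ler_normB _ _)); rewrite !normrM (gtr0_norm al0) (gtr0_norm be0).
  have e1 : al * `|ln (Z X false n w)%:R - S_ xi p false n w| <= sq^-1 * (eta / 2 * sq).
    by apply: ler_pM => //; exact: ltW.
  have e2 : be * `|ln (Z X true m w)%:R - S_ xi p true m w| <= sq^-1 * (eta / 2 * sq).
    by apply: ler_pM => //; exact: ltW.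
  have e3 : sq^-1 * (eta / 2 * sq) = eta / 2 by field; rewrite gt_eqF.
  by move: e1 e2; rewrite e3; lra.
apply: le_trans (measureU2 P (mD false n) (mD true m)) _.
apply: (le_trans (leeD (Hdev false n _ t0) (Hdev true m _ t0))).
rewrite -EFinD lee_fin le_eqVlt; apply/orP; left; apply/eqP.
have -> : c * Num.sqrt cv / 2 * eta * Num.sqrt N = c * (eta / 2 * sq).
  by rewrite /sq; field.
by ring.
Qed.

End two_processes.

(** * Uniformity and conclusion *)

(** The accuracy th is fixed first.  Then the two conditions hold as soon as (x + 3)^3 / s is
    small: the first one is of this form, and in the second one the exponent
    th s / (x + 1) exceeds any given multiple of (x + 3)^2, hence x^2 / 2 and the
    logarithms of the other factors. *)
Lemma mean_tail_choice (R : realType) (A K C c eps : R) :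
  0 <= A -> 0 < K -> 0 < C -> 0 < c -> 0 < eps ->
  exists th de : R, [/\ 0 < th <= 1, 0 < de, A * th <= eps &
    forall s x : R, 0 < s -> 0 <= x -> (x + 3) ^+ 3 <= de * s ->
      K / s * (x + 3) ^+ 3 <= th ^+ 2 /\
      C * expR (- (c * (th / (x + 1)) * s)) <= th * Phib x].
Proof.
move=> A0 K0 C0 c0 e0.
pose th := Num.min 1 (eps / (A + 1)).
have A1 : 0 < A + 1 by lra.
have th0 : 0 < th by rewrite lt_min ltr01 divr_gt0.
have th1 : th <= 1 by rewrite ge_min lexx.
have thA : A * th <= eps.
  apply: (@le_trans _ _ (A * (eps / (A + 1)))).
    by rewrite ler_wpM2l// ge_min lexx orbT.
  by rewrite mulrA ler_pdivrMr//; nra.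
pose L := `|ln (3 * C / th)|.
have L0 : 0 <= L by exact: normr_ge0.
(* the first bound serves the first condition; the second one gives L + (x + 1) + x^2 / 2 <= (L + 2) y^2 *)
pose de := Num.min (th ^+ 2 / K) (c * th / (L + 2)).
have L2 : 0 < L + 2 by lra.
have de0 : 0 < de by rewrite lt_min !divr_gt0 ?exprn_gt0 ?mulr_gt0.
exists th, de; split => //; first by rewrite th0.
move=> s x s0 x0 hx; set y := x + 3 in hx *.
have y3 : 3 <= y by rewrite /y; lra.
have y30 : 0 <= y ^+ 3 by rewrite exprn_ge0//; lra.
have d1 : de * K <= th ^+ 2 by rewrite -ler_pdivlMr// ge_min lexx.
have d2 : de * (L + 2) <= c * th by rewrite -ler_pdivlMr// ge_min lexx orbT.
split.
  rewrite mulrAC ler_pdivrMr//.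
  have : K * y ^+ 3 <= K * (de * s) by rewrite ler_wpM2l// ltW.
  have : de * K * s <= th ^+ 2 * s by rewrite ler_wpM2r// ltW.
  lra.
have x1 : 0 < x + 1 by lra.
have x2 : 0 < x + 2 by lra.
have PE : expR (- x ^+ 2 / 2) / (3 * (x + 2)) <= Phib x.
  apply: le_trans (Phib_ge _); last lra.
  have /andP[h _] := phi_bounds x; rewrite invfM mulrA ler_wpM2r ?invr_ge0 ?(ltW x2)//.
  by rewrite mulrC.
apply: (@le_trans _ _ (th * (expR (- x ^+ 2 / 2) / (3 * (x + 2))))); last first.
  by rewrite ler_wpM2l// ltW.
rewrite [leRHS]mulrA ler_pdivlMr; last by rewrite mulr_gt0.
have -> : C * expR (- (c * (th / (x + 1)) * s)) * (3 * (x + 2)) =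
   th * ((3 * C / th) * (x + 2) * expR (- (c * (th / (x + 1)) * s))).
  by field; rewrite !gt_eqF.
rewrite ler_wpM2l ?(ltW th0)//.
have CP : 0 < 3 * C / th by rewrite divr_gt0// mulr_gt0.
have E1 : 3 * C / th <= expR L.
  by rewrite -{1}(lnK CP) ler_expR ler_norm.
have E2 : x + 2 <= expR (x + 1).
  by apply: le_trans (expR_ge1Dx _); lra.
apply: (@le_trans _ _ (expR L * expR (x + 1) * expR (- (c * (th / (x + 1)) * s)))).
  rewrite ler_wpM2r ?expR_ge0//; apply: ler_pM => //; exact: ltW.
rewrite -!expRD ler_expR.
have h1 : (L + 2) * y ^+ 2 <= c * (th / (x + 1)) * s.
  have -> : c * (th / (x + 1)) * s = c * th * s / (x + 1) by field; rewrite gt_eqF.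
  rewrite ler_pdivlMr//.
  apply: (@le_trans _ _ ((L + 2) * y ^+ 3)).
    rewrite (exprSr y 2) [leRHS]mulrA; apply: ler_wpM2l.
      by rewrite mulr_ge0 ?sqr_ge0// ltW.
    rewrite /y; lra.
  apply: (@le_trans _ _ ((L + 2) * (de * s))); first by rewrite ler_wpM2l// ltW.
  have : de * (L + 2) * s <= c * th * s by rewrite ler_wpM2r// ltW.
  lra.
have h2 : L <= L * y ^+ 2.
  by rewrite ler_peMr// expr_ge1//; lra.
have h3 : x + 1 + x ^+ 2 / 2 <= 2 * y ^+ 2 by rewrite /y; nra.
lra.
Qed.

Lemma sup_cvg0 (R : realType) (f : nat * nat -> R -> R) (b : nat * nat -> R) :
  (forall mn, 0 <= b mn) ->
  (forall eps, 0 < eps -> \forall mn \near minn_infty,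
     forall x, 0 <= x <= b mn -> `|f mn x| <= eps) ->
  (fun mn => ereal_sup [set (`|f mn x|)%:E | x in `[0, b mn]]) @ minn_infty --> 0%E.
Proof.
move=> b0 H.
have sge mn : (0 <= ereal_sup [set (`|f mn x|)%:E | x in `[0%R, b mn]])%E.
  apply: (@le_trans _ _ (`|f mn 0|)%:E); first by rewrite lee_fin.
  by apply: ereal_sup_ubound; exists 0 => //=; rewrite in_itv/= lexx b0.
have sle eps : 0 < eps -> \forall mn \near minn_infty,
    (ereal_sup [set (`|f mn x|)%:E | x in `[0%R, b mn]] <= eps%:E)%E.
  move=> e0; apply: filterS (H _ e0) => mn h; apply: ge_ereal_sup => _ [x /= xb <-].
  by rewrite lee_fin h//; move: xb; rewrite in_itv.
apply/fine_cvgP; split.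
  apply: filterS (sle 1 ltr01) => mn h.
  by rewrite ge0_fin_numE// (le_lt_trans h) ?ltry.
apply/cvgrPdist_le => eps e0; apply: filterS (sle _ e0) => mn h.
rewrite sub0r normrN /= ger0_norm ?fine_ge0//.
by rewrite -lee_fin fineK// ge0_fin_numE// (le_lt_trans h) ?ltry.
Qed.

(** With s = sqrt N the condition (x + 3)^3 <= de s says that x + 3 is at most a small multiple
    of N^(1/6). *)
Lemma small_range (R : realType) (b : nat * nat -> R) (de : R) : 0 < de ->
  (b =o_minn_infty (fun mn => (minn mn.1 mn.2)%:R `^ 6^-1 : R)) ->
  \forall mn \near minn_infty, (0 < minn mn.1 mn.2)%N /\
    forall x, 0 <= x <= b mn -> (x + 3) ^+ 3 <= de * Num.sqrt (minn mn.1 mn.2)%:R.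
Proof.
move=> de0 bo.
pose e := Num.min 1 (de / 8).
have e0 : 0 < e by rewrite lt_min ltr01 divr_gt0.
have e1 : e <= 1 by rewrite ge_min lexx.
have e8 : e <= de / 8 by rewrite ge_min lexx orbT.
move/eqoP: bo => /(_ _ e0) bo.
pose N0 := (Num.truncn ((3 / e) ^+ 6)).+1.
have hN : \forall mn \near minn_infty, (N0 <= minn mn.1 mn.2)%N by exists N0.
apply: filterS2 bo hN => mn /= bmn Nmn.
have N1 : (0 < minn mn.1 mn.2)%N by exact: leq_trans Nmn.
split => // x /andP[x0 xb].
set N : R := (minn mn.1 mn.2)%:R in bmn *.
have Np : 0 < N by rewrite ltr0n.
set z := N `^ 6^-1 in bmn.
have z0 : 0 <= z by exact: powR_ge0.
have zE : z ^+ 3 = Num.sqrt N.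
  rewrite -powR12_sqrt ?(ltW Np)// -powR_mulrn// /z -powRrM; congr (_ `^ _); lra.
have z3 : 3 <= e * z.
  rewrite mulrC -ler_pdivrMr//.
  have e3 : 0 <= 3 / e by rewrite divr_ge0// ltW.
  have h6 : (3 / e) ^+ 6 <= N.
    have /andP[_ h] := truncn_itv (exprn_ge0 6 e3).
    by apply: (le_trans (ltW h)); rewrite ler_nat.
  have -> : 3 / e = ((3 / e) ^+ 6) `^ 6^-1.
    by rewrite -powR_mulrn// -powRrM mulfV// powRr1.
  by rewrite /z; apply: ge0_ler_powR; rewrite ?nnegrE ?exprn_ge0 ?invr_ge0// ltW.
have xz : x + 3 <= 2 * e * z.
  have : b mn <= e * z by rewrite -(ger0_norm z0); exact: le_trans (ler_norm _) bmn.
  by move: xb z3; lra.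
apply: (@le_trans _ _ ((2 * e * z) ^+ 3)).
  by apply: lerXn2r => //; rewrite nnegrE; lra.
rewrite exprMn zE ler_wpM2r ?sqrtr_ge0//.
have : e ^+ 3 <= e.
  by rewrite -[leRHS]expr1; apply: ler_wiXn2l => //; exact: ltW.
rewrite exprMn; lra.
Qed.

Lemma ratio_cvg0 (R : realType) (q : nat -> nat -> R -> R) (b : nat * nat -> R)
  (A K C c : R) :
  0 <= A -> 0 < K -> 0 < C -> 0 < c ->
  (forall mn, 0 <= b mn) ->
  (b =o_minn_infty (fun mn => (minn mn.1 mn.2)%:R `^ 6^-1 : R)) ->
  (forall (m n : nat) (th x : R), (0 < m)%N -> (0 < n)%N -> 0 < th <= 1 -> 0 <= x ->
    K / Num.sqrt (minn m n)%:R * (x + 3) ^+ 3 <= th ^+ 2 ->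
    C * expR (- (c * (th / (x + 1)) * Num.sqrt (minn m n)%:R)) <= th * Phib x ->
    `|q m n x - 1| <= A * th) ->
  (fun mn : nat * nat => ereal_sup
     [set (`|q mn.1 mn.2 x - 1|)%:E | x in `[0, b mn] ]) @ minn_infty --> 0%E.
Proof.
move=> A0 K0 C0 c0 b0 bo H.
apply: (sup_cvg0 (f := fun mn x => q mn.1 mn.2 x - 1)) => // eps e0.
have [th [de [th01 de0 Ath Hde]]] := mean_tail_choice A0 K0 C0 c0 e0.
apply: filterS (small_range de0 bo) => -[m n] /= [N0 Hx] x xb.
have /andP[m0 n0] : (0 < m)%N && (0 < n)%N by rewrite -leq_min.
have /andP[x0 _] := xb.
have s0 : 0 < Num.sqrt (minn m n)%:R :> R by rewrite sqrtr_gt0 ltr0n.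
have [h1 h2] := Hde _ x s0 x0 (Hx x xb).
by apply: le_trans Ath; exact: H.
Qed.

Theorem corollary2p4 (R : realType) (d : measure_display)
  (T : measurableType d) (P : probability T R)
  (xi : nat -> {RV P >-> (R * R)%type})
  (p : R.-pker R ~> nat)
  (X : bool -> nat -> nat -> {RV P >-> nat})
  (xi_iid : iid xi)
  (X_law : offspring_given_env xi p X)
  (m_fin : forall l, {ae P, forall w, (mean_law p (env xi l 0 w) < +oo)%E})
  (sigma_pos_fin : forall l, (0 < 'V_P[M_ xi p l 0] < +oo)%E)
  (ZlnZ_fin :
    ('E_P[fun w =>
       ((Z X false 1 w)%:R / m_ xi p false 0 w * lnplus (Z X false 1 w)%:R
      + (Z X true 1 w)%:R / m_ xi p true 0 w * lnplus (Z X true 1 w)%:R)%R]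
     < +oo)%E)
  (p0_eq0 : forall l,
    {ae P, forall w, offspring_pmf p (env xi l 0 w) 0 = 0})
  (rho_range : (-1 <= rho_ xi p < 1) \/
    (rho_ xi p = 1 /\ sigma_ xi p false <> sigma_ xi p true))
  (exp_moment : exists lambda0 : R, 0 < lambda0 /\
    ('E_P[fun w => (expR (lambda0 * M_ xi p false 0 w)
                  + expR (lambda0 * M_ xi p true 0 w))%R] < +oo)%E)
  (Zp_moment : exists q : R, 1 < q /\
    ('E_P[fun w => ((Z X false 1 w)%:R `^ q / m_ xi p false 0 w
                  + (Z X true 1 w)%:R `^ q / m_ xi p true 0 w)%R] < +oo)%E)
  (b : nat * nat -> R)
  (b_ge0 : forall mn, 0 <= b mn)
  (b_small : b =o_minn_infty
     (fun mn => (minn mn.1 mn.2)%:R `^ 6^-1 : R)) :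
  (fun mn : nat * nat => ereal_sup
     [set (`| fine (P [set w | x <= R_ xi p X mn.1 mn.2 w]) / (1 - Phi x) - 1 |)%:E
       | x in `[0, b mn] ]) @ minn_infty --> 0%E
  /\
  (fun mn : nat * nat => ereal_sup
     [set (`| fine (P [set w | R_ xi p X mn.1 mn.2 w <= - x]) / Phi (- x) - 1 |)%:E
       | x in `[0, b mn] ]) @ minn_infty --> 0%E.
Proof.
have good0 l : {ae P, forall w, good p (env xi l 0 w)}.
  by apply: filterS2 (m_fin l) (p0_eq0 l).
have [lambda0 [l0 El]] := exp_moment; have [q [q1 Eq]] := Zp_moment.
have mM l : measurable_fun setT (M_ xi p l 0).
  by have := @measurable_M _ _ _ _ xi p l 0 => /past_env/env_meas.
have split_fin (f g : T -> R) : measurable_fun setT f -> measurable_fun setT g ->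
    (forall w, 0 <= f w) -> (forall w, 0 <= g w) -> ('E_P[fun w => (f w + g w)%R] < +oo)%E ->
    (\int[P]_w (f w)%:E < +oo)%E /\ (\int[P]_w (g w)%:E < +oo)%E.
  move=> mf mg f0 g0; rewrite expectation.unlock => h.
  have mfg : measurable_fun setT (fun w => (f w + g w)%:E).
    by apply/measurable_EFinP; exact: measurable_funD.
  split; apply: le_lt_trans h; apply: ge0_le_integral => //;
    try (by move=> w _; rewrite lee_fin ?addr_ge0 ?lerDl ?lerDr);
    exact/measurable_EFinP.
have mE l : measurable_fun setT (fun w => expR (lambda0 * M_ xi p l 0 w)).
  by apply: measurableT_comp => //; exact: measurable_funM.
have exp_fin l : (\int[P]_w (expR (lambda0 * M_ xi p l 0 w))%:E < +oo)%E.
  by have [] := split_fin _ _ (mE false) (mE true) (fun=> expR_ge0 _) (fun=> expR_ge0 _) El; case: l.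
have mZ l : measurable_fun setT (fun w => (Z X l 1 w)%:R `^ q / m_ xi p l 0 w : R).
  have mz := measurable_of_Z l X_law 1 (fun z => z%:R `^ q : R).
  apply: measurable_funM => //.
  have me := env_meas (@measurable_env' _ _ _ _ xi l 0).
  exact: (measurableT_comp (measurable_mean_inv p) me).
have Z0 l w : 0 <= (Z X l 1 w)%:R `^ q / m_ xi p l 0 w :> R.
  by rewrite divr_ge0 ?powR_ge0// fine_ge0// mean_law_ge0.
have Zq_fin l : (\int[P]_w ((Z X l 1 w)%:R `^ q / m_ xi p l 0 w)%:E < +oo)%E.
  by have [] := split_fin _ _ (mZ false) (mZ true) (Z0 false) (Z0 true) Eq; case: l.
have [K [C [c [K0 C0 c0 H]]]] := clt_bound xi_iid X_law good0 sigma_pos_fin l0 exp_fin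
  q1 Zq_fin rho_range.
have A0 : 0 <= 13 + 13 * cramer_const :> R.
  by have := cramer_const_ge0 R; move: cramer_const => ? ?; lra.
split.
  apply: (@ratio_cvg0 _ (fun m n x => fine (P [set w | x <= R_ xi p X m n w]) / (1 - Phi x))
    b _ K C c A0 K0 C0 c0 b_ge0 b_small) => m n th x m0 n0 th01 x0 h1 h2.
  have := H m n false th x m0 n0 th01 x0 h1 h2.
  by under eq_set do rewrite expr0 mul1r.
apply: (@ratio_cvg0 _ (fun m n x => fine (P [set w | R_ xi p X m n w <= - x]) / Phi (- x))
  b _ K C c A0 K0 C0 c0 b_ge0 b_small) => m n th x m0 n0 th01 x0 h1 h2.
have := H m n true th x m0 n0 th01 x0 h1 h2.
by under eq_set do rewrite expr1 mulN1r lerNr; rewrite PhiN.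
Qed.
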